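(* Let $\mathcal{T}_h$ be a simplicial mesh of a bounded polyhedral domain $\Omega\subset\mathbb{R}^n$ and let $1\le k\le n$. Let $d_h^*:\mathcal{P}_1^-\Lambda^k(\mathcal{T}_h)\to\mathcal{P}_1\Lambda^{k-1}(\mathcal{T}_h)$ be the operator defined by $$\langle d_h^*u,\tau\rangle_h=\langle u,d\tau\rangle,\qquad u\in\mathcal{P}_1^-\Lambda^k(\mathcal{T}_h),\ \tau\in\mathcal{P}_1\Lambda^{k-1}(\mathcal{T}_h).$$ Then $d_h^*$ is local: for any vertex $x$ of $\mathcal{T}_h$, the values $(d_h^*u)_{x}$ (that is, the values at $x$ of $(d_h^*u)|_T$ for all $T\in\mathcal{T}_h$ having $x$ as a vertex) depend only on $u$ restricted to the macroelement $\Omega_x=\bigcup\{T\in\mathcal{T}_h: x\in\Delta_0(T)\}$.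
   Context: $\mathrm{Alt}^j(\mathbb{R}^n)$ is the space of alternating $j$-linear forms on $\mathbb{R}^n$ with inner product $\langle a,b\rangle_{\mathrm{Alt}}=\sum a(e_{\sigma_1},\dots,e_{\sigma_j})b(e_{\sigma_1},\dots,e_{\sigma_j})$, the sum over $1\le\sigma_1<\dots<\sigma_j\le n$, for an orthonormal basis $(e_i)$ of $\mathbb{R}^n$. $L^2\Lambda^j(\Omega)$ is the space of square integrable $j$-forms with $\langle u,v\rangle=\int_\Omega\langle u_x,v_x\rangle_{\mathrm{Alt}}\,dx$; $H\Lambda^j(\Omega)$ is the subspace of $u$ with exterior derivative $du\in L^2\Lambda^{j+1}(\Omega)$. $\Delta_0(T)$ is the set of vertices of $T$, and $|T|$ the volume. $\mathcal{P}_r\Lambda^j(T)$ is the space of $j$-forms on $T$ with polynomial coefficients of degree at most $r$. $\mathcal{P}_1\Lambda^{j}(\mathcal{T}_h)$ is the space of $u\in H\Lambda^{j}(\Omega)$ with $u|_T\in\mathcal{P}_1\Lambda^{j}(T)$ for all $T\in\mathcal{T}_h$. $\mathcal{P}_1^-\Lambda^j(\mathcal{T}_h)$ is the space of Whitney forms: $u\in H\Lambda^j(\Omega)$ with $u|_T\in\mathcal{P}_0\Lambda^j(T)+\kappa\mathcal{P}_0\Lambda^{j+1}(T)$, where $(\kappa u)_x=u_x\lrcorner x$ is contraction with the position vector. The modified inner product on $\mathcal{P}_1\Lambda^{k-1}(\mathcal{T}_h)$ is $$\langle u,v\rangle_h=\sum_{T\in\mathcal{T}_h}\frac{|T|}{n+1}\sum_{x\in\Delta_0(T)}\langle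 u_x,v_x\rangle_{\mathrm{Alt}},$$ where in the term for $T$ the values $u_x,v_x$ are those of $u|_T,v|_T$ at $x$. *)

(* Defs.v *)
(* MathComp-Analysis *)
From HB Require Import structures.
From mathcomp Require Import all_boot all_order all_algebra finmap.
From mathcomp Require Import all_classical all_reals all_analysis.
Set Implicit Arguments.
Unset Strict Implicit.
Unset Printing Implicit Defensive.
Import Order.TTheory GRing.Theory Num.Theory.
Import numFieldNormedType.Exports.
Local Open Scope classical_set_scope.
Local Open Scope ring_scope.

Definition rV_display : measure_display. Proof. exact: default_measure_display. Qed.

(* The product sigma-algebra on R^n, i.e. the Borel one. *)
Section rV_measurable.
Variables (R : realType) (n : nat).

Let coord (i : 'I_n) (x : 'rV[R]_n) : measurableTypeR R := x ord0 i.

HB.instance Definition _ := @isMeasurable.Build rV_display 'rV[R]_n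
  (g_sigma_preimage coord) (@sigma_algebra0 _ _ _)
  (@sigma_algebraC _ _) (@sigma_algebra_bigcup _ _ _).

Lemma measurable_rV_coord (i : 'I_n) :
  measurable_fun setT (fun x : 'rV[R]_n => x ord0 i : measurableTypeR R).
Proof.
move=> _ Y mY; rewrite setTI; apply: sub_sigma_algebra => /=.
rewrite -bigcup_seq/=; exists i => /=; first by rewrite mem_index_enum.
by exists Y => //; rewrite setTI.
Qed.

Lemma measurable_fun_rVP d (T : measurableType d) (f : T -> 'rV[R]_n) :
  (forall i, measurable_fun setT (fun x => f x ord0 i : measurableTypeR R)) ->
  measurable_fun setT f.
Proof.
move=> mf _ Y mY; rewrite setTI.
suff : g_sigma_preimage coord `<=` [set A | measurable (f @^-1` A)].
  by apply.
apply: smallest_sub.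
  split => /=.
  - by rewrite preimage_set0.
  - by move=> A mA; rewrite setTD preimage_setC; exact: measurableC.
  - by move=> F mF; rewrite preimage_bigcup; exact: bigcupT_measurable.
rewrite -bigcup_seq => A [i _ /=] [B mB <-].
by rewrite setTI; have := mf i measurableT B mB; rewrite setTI.
Qed.

End rV_measurable.

Section rV_cons.
Variables (R : realType) (n : nat).

Definition rV_cons (p : measurableTypeR R * 'rV[R]_n) : 'rV[R]_n.+1 :=
  \row_i if unlift ord0 i is Some j then p.2 ord0 j else p.1.

Definition rV_uncons (x : 'rV[R]_n.+1) : measurableTypeR R * 'rV[R]_n :=
  (x ord0 ord0, \row_i x ord0 (lift ord0 i)).

Lemma rV_consK : cancel rV_cons rV_uncons.
Proof.
move=> [t y]; rewrite /rV_uncons /rV_cons mxE unlift_none; congr pair.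
by apply/rowP => i; rewrite !mxE liftK.
Qed.

Lemma measurable_rV_cons : measurable_fun setT rV_cons.
Proof.
apply: measurable_fun_rVP => i; under eq_fun do rewrite mxE.
case: (unliftP ord0 i) => [j|] _; last exact: measurable_fst.
by apply: (measurableT_comp (@measurable_rV_coord R n j)); exact: measurable_snd.
Qed.

Lemma measurable_rV_uncons : measurable_fun setT rV_uncons.
Proof.
apply/measurable_fun_pairP; split; first exact: measurable_rV_coord.
apply: measurable_fun_rVP => i.
under eq_fun do rewrite /= mxE.
exact: measurable_rV_coord.
Qed.

Variable mu : {sigma_finite_measure set 'rV[R]_n -> \bar R}.

Definition lebesgue_cons : set 'rV[R]_n.+1 -> \bar R :=
  pushforward (@lebesgue_measure R \x mu)%E rV_cons.

Let lebesgue_cons0 : lebesgue_cons set0 = 0%E.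
Proof. by rewrite /lebesgue_cons /pushforward preimage_set0 measure0. Qed.

Let lebesgue_cons_ge0 A : (0 <= lebesgue_cons A)%E.
Proof. by rewrite /lebesgue_cons /pushforward; exact: measure_ge0. Qed.

Let mpre (A : set 'rV[R]_n.+1) : measurable A -> measurable (rV_cons @^-1` A).
Proof.
by move=> mA; rewrite -[X in measurable X]setTI; exact: measurable_rV_cons.
Qed.

Let lebesgue_cons_sigma_additive : semi_sigma_additive lebesgue_cons.
Proof.
move=> F mF tF mUF; rewrite /lebesgue_cons /pushforward preimage_bigcup.
apply: measure_semi_sigma_additive.
- by move=> i; exact: mpre.
- apply/trivIsetP => /= i j _ _ ij; rewrite -preimage_setI.
  by move/trivIsetP : tF => /(_ _ _ _ _ ij) ->//; rewrite preimage_set0.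
- by rewrite -preimage_bigcup; exact: mpre.
Qed.

HB.instance Definition _ := isMeasure.Build _ _ _ lebesgue_cons
  lebesgue_cons0 lebesgue_cons_ge0 lebesgue_cons_sigma_additive.

Let lebesgue_cons_sigma_finite : sigma_finite setT lebesgue_cons.
Proof.
have /sigma_finiteP[F [TF ndF Foo]] := sigma_finiteT (@lebesgue_measure R).
have /sigma_finiteP[G [TG ndG Goo]] := sigma_finiteT mu.
exists (fun i => rV_uncons @^-1` (F i `*` G i)).
  apply/esym/seteqP; split=> // x _.
  have [i _ Fi] : (\bigcup_i F i) (rV_uncons x).1 by rewrite -TF.
  have [j _ Gj] : (\bigcup_i G i) (rV_uncons x).2 by rewrite -TG.
  exists (maxn i j) => //; split.
  - by move: (_.1) Fi; exact/subsetPset/ndF/leq_maxl.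
  - by move: (_.2) Gj; exact/subsetPset/ndG/leq_maxr.
move=> i; have [mF Fi] := Foo i; have [mG Gi] := Goo i; split.
  rewrite -[X in measurable X]setTI.
  by apply: measurable_rV_uncons => //; exact: measurableX.
rewrite /lebesgue_cons /pushforward -comp_preimage.
have -> : rV_uncons \o rV_cons = idfun by apply/funext => p; exact: rV_consK.
by rewrite preimage_id product_measure1E// lte_mul_pinfty// ge0_fin_numE.
Qed.

HB.instance Definition _ := Measure_isSigmaFinite.Build _ _ _ lebesgue_cons
  lebesgue_cons_sigma_finite.

End rV_cons.

(* Lebesgue measure on R^n, as an iterated product measure. *)
Fixpoint lebesgue_rV (R : realType) (n : nat) :
    {sigma_finite_measure set 'rV[R]_n -> \bar R} :=
  match n with
  | 0 => \d_(0 : 'rV[R]_0)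
  | m.+1 => lebesgue_cons (lebesgue_rV R m)
  end.

Section forms.
Variables (R : realType) (n : nat).
Local Notation vec := 'rV[R]_n.
Local Notation leb := (lebesgue_rV R n).

Definition multilinear_form j (a : ('I_j -> vec) -> R) : Prop :=
  forall (v : 'I_j -> vec) (i : 'I_j) (c : R) (x y : vec),
    a [eta v with i |-> c *: x + y] =
    c * a [eta v with i |-> x] + a [eta v with i |-> y].

Definition alternating_form j (a : ('I_j -> vec) -> R) : Prop :=
  multilinear_form a /\
  forall (v : 'I_j -> vec) (i1 i2 : 'I_j), i1 != i2 -> v i1 = v i2 -> a v = 0.

Definition increasing j (s : {ffun 'I_j -> 'I_n}) : bool :=
  [forall i1 : 'I_j, forall i2 : 'I_j, (i1 < i2)%N ==> (s i1 < s i2)%N].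

Definition alt_ip j (a b : ('I_j -> vec) -> R) : R :=
  \sum_(s : {ffun 'I_j -> 'I_n} | increasing s)
    a (fun i => delta_mx ord0 (s i)) * b (fun i => delta_mx ord0 (s i)).

Definition diff_form j := vec -> ('I_j -> vec) -> R.

Definition vcons j (x : vec) (v : 'I_j -> vec) : 'I_j.+1 -> vec :=
  fun i => if unlift ord0 i is Some i' then v i' else x.

Definition kappa j (u : diff_form j.+1) : diff_form j :=
  fun x v => u x (vcons x v).

(* Square integrable forms are represented by functions, not by their classes
   modulo equality almost everywhere. *)
Definition L2_form j (Om : set vec) (u : diff_form j) : Prop :=
  [/\ forall x, Om x -> alternating_form (u x),
      forall v, measurable_fun Om (fun x => u x v) &
      (\int[leb]_(x in Om) (alt_ip (u x) (u x))%:E < +oo)%E].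

Definition L2_ip j (Om : set vec) (u v : diff_form j) : R :=
  \int[leb]_(x in Om) alt_ip (u x) (v x).

Definition iter_derive (s : seq vec) (f : vec -> R) : vec -> R :=
  foldr (fun v g => 'D_v g) f s.

Definition smooth (f : vec -> R) : Prop :=
  forall s x, differentiable (iter_derive s f) x.

Definition test_form j (Om : set vec) (phi : diff_form j) : Prop :=
  [/\ forall x, alternating_form (phi x),
      forall v, smooth (fun x => phi x v) &
      exists K : set vec, [/\ compact K, K `<=` Om &
        forall x, ~ K x -> forall v, phi x v = 0]].

(* The formal adjoint - \sum_i e_i _| D_{e_i} of the exterior derivative
   \sum_i e_i^* /\ D_{e_i}. *)
Definition codiff j (phi : diff_form j.+1) : diff_form j := fun x v =>
  - \sum_(i < n)
      'D_(delta_mx ord0 i) (fun y => phi y (vcons (delta_mx ord0 i) v)) x.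

(* w is the distributional exterior derivative of u on Om, and is in L^2. *)
Definition is_ext_d j (Om : set vec) (u : diff_form j)
    (w : diff_form j.+1) : Prop :=
  L2_form Om w /\
  forall phi, test_form Om phi -> L2_ip Om u (codiff phi) = L2_ip Om w phi.

Definition H_form j (Om : set vec) (u : diff_form j) : Prop :=
  L2_form Om u /\ exists w, is_ext_d Om u w.

Definition ext_d j (Om : set vec) (u : diff_form j) : diff_form j.+1 :=
  xget (fun _ _ => 0) [set w | is_ext_d Om u w].

Definition poly_fun (r : nat) (f : vec -> R) : Prop :=
  exists c : {ffun 'I_n -> 'I_r.+1} -> R, forall x,
    f x = \sum_(m : {ffun 'I_n -> 'I_r.+1} | (\sum_i m i <= r)%N)
            c m * \prod_i x ord0 i ^+ m i.

Definition poly_form (r j : nat) (p : diff_form j) : Prop :=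
  (forall x, alternating_form (p x)) /\
  forall v, poly_fun r (fun x => p x v).

Definition whitney_form j (p : diff_form j) : Prop :=
  exists (a : diff_form j) (b : diff_form j.+1),
    [/\ poly_form 0 a, poly_form 0 b &
    forall x v, p x v = a x v + kappa b x v].

End forms.

Section mesh.
Variables (R : realType) (n : nat).
Local Notation vec := 'rV[R]_n.
Local Notation leb := (lebesgue_rV R n).

(* A simplex is represented by its finite set of vertices, so that x \in T means
   that x is a vertex of T; the simplex as a subset of R^n is conv_hull T. *)
Definition affinely_independent (A : {fset vec}) : Prop :=
  forall w : vec -> R, \sum_(x <- A) w x = 0 -> \sum_(x <- A) w x *: x = 0 ->
    forall x, x \in A -> w x = 0.

Definition conv_hull (A : {fset vec}) : set vec :=
  [set y | exists w : vec -> R, [/\ forall x, x \in A -> 0 <= w x,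
    \sum_(x <- A) w x = 1 & y = \sum_(x <- A) w x *: x]].

Definition simplex (d : nat) (A : {fset vec}) : Prop :=
  #|` A| = d.+1 /\ affinely_independent A.

(* The boundary is a finite union of (n - 1)-simplices. *)
Definition polyhedral_domain (Om : set vec) : Prop :=
  [/\ Om !=set0, open Om, connected Om, bounded_set Om &
      exists F : {fset {fset vec}},
        (forall f, f \in F -> simplex n.-1 f) /\
        closure Om `\` Om = \bigcup_(f in [set` F]) conv_hull f].

(* The common face of two elements is empty when S = fset0. *)
Definition simplicial_mesh (Om : set vec) (Th : {fset {fset vec}}) : Prop :=
  [/\ forall T, T \in Th -> simplex n T,
      closure Om = \bigcup_(T in [set` Th]) conv_hull T &
      forall T1 T2, T1 \in Th -> T2 \in Th ->
        exists2 S : {fset vec}, (S `<=` T1)%fset && (S `<=` T2)%fset &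
          conv_hull T1 `&` conv_hull T2 = conv_hull S].

Definition ae_eq_on j (A : set vec) (u v : diff_form R n j) : Prop :=
  {ae leb, forall x, A x -> u x = v x}.

(* The polynomial form representing u on T: its value at a vertex of T is not
   the value there of u, which is only relevant up to a null set. *)
Definition restriction j (u : diff_form R n j) (T : {fset vec})
    : diff_form R n j :=
  xget (fun _ _ => 0) [set p | poly_form 1 p /\ ae_eq_on (conv_hull T) u p].

Definition P1_space j (Om : set vec) (Th : {fset {fset vec}})
    (u : diff_form R n j) : Prop :=
  H_form Om u /\ forall T, T \in Th ->
    exists p, poly_form 1 p /\ ae_eq_on (conv_hull T) u p.

Definition whitney_space j (Om : set vec) (Th : {fset {fset vec}})
    (u : diff_form R n j) : Prop :=
  H_form Om u /\ forall T, T \in Th ->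
    exists p, whitney_form p /\ ae_eq_on (conv_hull T) u p.

Definition volume (T : {fset vec}) : R := fine (leb (conv_hull T)).

Definition ip_h j (Th : {fset {fset vec}}) (u v : diff_form R n j) : R :=
  \sum_(T <- Th) volume T / n.+1%:R *
    \sum_(x <- T) alt_ip (restriction u T x) (restriction v T x).

Definition macroelement (Th : {fset {fset vec}}) (x : vec) : set vec :=
  \bigcup_(T in [set T | T \in Th /\ x \in T]) conv_hull T.

Definition is_discrete_coderivative k (Om : set vec) (Th : {fset {fset vec}})
    (dh : diff_form R n k.+1 -> diff_form R n k) : Prop :=
  forall u, whitney_space Om Th u -> P1_space Om Th (dh u) /\
    forall tau, P1_space Om Th tau ->
      ip_h Th (dh u) tau = L2_ip Om u (ext_d Om tau).

End mesh.

(* Main.v *)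
Require Import Defs.
From mathcomp Require Import all_boot all_order all_algebra perm finmap.
From mathcomp Require Import all_classical all_reals all_analysis.
From mathcomp Require Import measurable_realfun ring lra.
Set Implicit Arguments.
Unset Strict Implicit.
Unset Printing Implicit Defensive.
Import Order.TTheory GRing.Theory Num.Theory.
Import numFieldNormedType.Exports.
Local Open Scope classical_set_scope.
Local Open Scope ring_scope.

(* For an element [T] with vertex [x] let [sigma_T] be the difference of the values
   at [x] of [(d_h^* u)|_T] and [(d_h^* v)|_T], and let [tau] be the form equal to
   [lambda_x sigma_T] on the elements [T] with vertex [x], where [lambda_x] is the
   barycentric coordinate of [x], and to [0] on the other elements. Then [tau] is in
   [P_1 Lambda^{k-1}]: across a common face of two elements the jump of
   [d_h^* u - d_h^* v] has no tangential part at [x], and [lambda_x] is the same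
   from both sides. Testing with [tau] gives
   [\sum_T |T|/(n+1) |sigma_T|^2 = <u - v, d tau>], and the right-hand side is [0]:
   on the macroelement [u = v], and elsewhere [u - v] is piecewise affine while
   [tau = 0], so that [d tau] is orthogonal to it.

   As the domain may have slits that are not resolved by the mesh, membership in
   [H Lambda] is characterised by tangential jumps only near the points of [Om]
   interior to a common face of two elements. The remaining points of faces lie on
   the codimension 2 skeleton, which cutoff functions remove. *)

(** * Lebesgue measure on R^n *)

(** No surface measure appears. Translation invariance of Lebesgue measure turns a derivative
    integrated over a half-space into a limit of integrals over thin strips along its boundary, and
    only two consequences of this limit are used: its sign for non-negative functions, and its
    vanishing for functions that vanish on the hyperplane. This is why jumps are studied across full
    hyperplanes rather than across faces. The vertex [x] may lie on the boundary of the domain or on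
    the skeleton, where no test form sees the jump. But the jump of two affine forms is affine, so
    its vanishing near one interior point of a face propagates to the whole hyperplane, and thus to
    [x]. The source of locality is that [ip_h] reads vertex values only: [tau] is [sigma_T] at [x]
    and [0] at every other vertex, so pairing with it isolates the values at [x]. *)

Definition push_measure d d' (T : measurableType d) (T' : measurableType d')
    (R : realType) (mu : {measure set T -> \bar R}) (f : T -> T')
    (mf : measurable_fun setT f) : {measure set T' -> \bar R} :=
  measure_function_pushforward__canonical__measure_function_Measure mu mf.

Section lebesgue_rV_facts.
Variables (R : realType).

(** The norm on row vectors is the sup norm, so a ball is a box, that is, a finite intersection of
    coordinate slabs. *)
Lemma measurable_rV_ball n (x : 'rV[R]_n) r : measurable (ball x r).
Proof.
have [r0|r0] := ltP 0 r; last first.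
  rewrite (_ : ball x r = set0) //; apply/seteqP; split=> // y [].
  by rewrite ltNge r0.
rewrite (_ : ball x r = \bigcap_i [set y | ball (x ord0 i) r (y ord0 i)]).
  apply: fin_bigcap_measurable => // i _.
  have := @measurable_rV_coord R n i measurableT (ball (x ord0 i) r).
  by rewrite setTI; apply; rewrite ball_itv; exact: measurable_itv.
apply/seteqP; split=> y; first by move=> [_ h] i _; exact: h.
by move=> h; split=> // i j; rewrite (ord1 i); exact: h.
Qed.

(** The sigma-algebra is generated by the coordinates, so open sets enter through a countable base:
    the balls with rational centre and radius [1 / (m + 1)]. *)
Lemma measurable_rV_open n (U : set 'rV[R]_n) : open U -> measurable U.
Proof.
move=> oU.
pose B (p : 'rV[rat]_n * nat) : set 'rV[R]_n :=
  ball (map_mx ratr p.1 : 'rV[R]_n) p.2.+1%:R^-1.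
have -> : U = \bigcup_(p in [set p | B p `<=` U]) B p.
  apply/seteqP; split=> [x Ux|x [p pU]]; last exact: pU.
  have /nbhs_ballP[e /= e0 eU] : nbhs x U by apply: open_nbhs_nbhs.
  have [m mh] : exists m : nat, m.+1%:R^-1 *+ 2 < e.
    have [m _ mh] := near_infty_natSinv_lt (PosNum (divr_gt0 e0 (ltr0Sn R 1))).
    exists m; have /= := mh m (leqnn _); rewrite /=.
    by rewrite ltr_pdivlMr // mulr_natr.
  have m0 : 0 < m.+1%:R^-1 :> R by rewrite invr_gt0.
  have /choice[q qh] : forall i, exists q : rat,
      ball (x ord0 i) m.+1%:R^-1 (ratr q : R).
    move=> i.
    have /(_ _)[||y [/= h [r _ rE]]] :=
      @dense_rat R (ball (x ord0 i) m.+1%:R^-1).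
    - by exists (x ord0 i); exact: ballxx.
    - exact: ball_open.
    by exists r; rewrite rE.
  have xq : B (\row_i q i, m) x.
    by split=> // i j; rewrite !mxE (ord1 i); apply: ball_sym; exact: qh.
  exists (\row_i q i, m) => // y yq.
  apply: eU; apply: (le_ball (ltW mh)); rewrite mulr2n.
  by apply: ball_triangle yq; exact: ball_sym.
rewrite bigcup_mkcond; apply: countable_bigcupT_measurable => // p.
by case: ifP => // _; exact: measurable_rV_ball.
Qed.

Lemma continuous_rV_measurable n (f : 'rV[R]_n -> R) :
  continuous f -> measurable_fun setT f.
Proof.
move=> cf; apply: (measurability _ (RGenOpens.measurableE R)).
move=> _ [_ [a [b ->] <-]]; rewrite setTI; apply: measurable_rV_open.
by move/continuousP: cf; apply; exact: interval_open.
Qed.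

Lemma measurable_rV_shift n (v : 'rV[R]_n) :
  measurable_fun setT (fun y : 'rV[R]_n => y + v).
Proof.
apply: measurable_fun_rVP => i; under eq_fun do rewrite mxE.
by apply: measurable_funD => //; exact: measurable_rV_coord.
Qed.

Lemma lebesgue_measure_shift (t : R) (A : set R) : measurable A ->
  @lebesgue_measure R ((fun y => y + t) @^-1` A) = lebesgue_measure A.
Proof.
move=> mA.
have mt : measurable_fun setT (fun y : measurableTypeR R => (y + t : measurableTypeR R)).
  exact: measurable_funD.
apply/esym.
apply: (@lebesgue_measure_unique R (push_measure (@lebesgue_measure R) mt)) => //.
move=> _ [[a b] _ <-] /=; rewrite /pushforward.
rewrite (_ : _ @^-1` _ = `]a - t, b - t]%classic); last first.
  by apply/seteqP; split=> y /=; rewrite !in_itv/= ltrBlDr lerBrDr.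
rewrite !lebesgue_measure_itv /= !lte_fin ltrD2r.
by case: ifP => // _; rewrite -!EFinD; congr EFin; ring.
Qed.

Lemma lebesgue_rV_consE n (A : set 'rV[R]_n.+1) : lebesgue_rV R n.+1 A =
  (@lebesgue_measure R \x lebesgue_rV R n)%E (@rV_cons R n @^-1` A).
Proof. by []. Qed.

(** The shifted measure is again a measure on the product, and by uniqueness of product measures it
    suffices to compare rectangles; there the one-dimensional case and the induction hypothesis
    apply factor by factor. *)
Lemma lebesgue_rV_shift n (v : 'rV[R]_n) (A : set 'rV[R]_n) : measurable A ->
  lebesgue_rV R n ((fun y => y + v) @^-1` A) = lebesgue_rV R n A.
Proof.
elim: n v A => [|n IH] v A mA.
  by congr (_ _); apply/seteqP; split=> y /=; rewrite !(thinmx0 (_ : 'rV_0)).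
have [t tE] : exists t, t = v ord0 ord0 by exists (v ord0 ord0).
pose v' : 'rV[R]_n := \row_i v ord0 (lift ord0 i).
pose f (p : measurableTypeR R * 'rV[R]_n) : measurableTypeR R * 'rV[R]_n :=
  (p.1 + t, p.2 + v').
have mf : measurable_fun setT f.
  apply/measurable_fun_pairP; split.
    by apply: measurable_funD => //; exact: measurable_fst.
  by apply: (measurableT_comp (measurable_rV_shift v')); exact: measurable_snd.
rewrite !lebesgue_rV_consE.
have mA' : measurable (@rV_cons R n @^-1` A).
  by rewrite -[X in measurable X]setTI; exact: measurable_rV_cons.
rewrite (_ : _ @^-1` _ = f @^-1` (@rV_cons R n @^-1` A)); last first.
  apply/seteqP; split=> p /=; congr (A _); apply/rowP => i; rewrite !mxE;
    by case: unliftP => [j ->|->] /=; rewrite ?mxE // tE.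
apply/esym.
apply: (@product_measure_unique _ _ _ _ _ _ _ (push_measure
  (@lebesgue_measure R \x lebesgue_rV R n)%E mf)) => // B C mB mC.
rewrite /push_measure /= /pushforward.
rewrite (_ : f @^-1` _ =
  ((fun y => y + t) @^-1` B) `*` ((fun y => y + v') @^-1` C)) //.
rewrite product_measure1E.
- by congr (_ * _)%E; [exact: lebesgue_measure_shift|exact: IH].
- have mt : measurable_fun setT (fun y : measurableTypeR R => (y + t : measurableTypeR R)).
    exact: measurable_funD.
  by rewrite -[X in measurable X]setTI; exact: mt.
- by rewrite -[X in measurable X]setTI; exact: measurable_rV_shift.
Qed.

Lemma lebesgue_rV_ball n (x : 'rV[R]_n) r : 0 < r ->
  lebesgue_rV R n (ball x r) = ((r *+ 2) ^+ n)%:E.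
Proof.
move=> r0; elim: n x => [|n IH] x.
  rewrite /= diracE mem_set ?expr0 //.
  by split=> // i [].
rewrite lebesgue_rV_consE (_ : _ @^-1` _ =
  (ball (x ord0 ord0) r) `*` ball (\row_i x ord0 (lift ord0 i) : 'rV_n) r).
  rewrite product_measure1E ?IH; last 2 first.
  - rewrite ball_itv; exact: measurable_itv.
  - exact: measurable_rV_ball.
  by rewrite exprS EFinM; congr (_ * _)%E; apply: lebesgue_measure_ball; exact: ltW.
apply/seteqP; split=> -[t y] /=.
  move=> [_ h]; split=> /=.
    by have := h ord0 ord0; rewrite !mxE unlift_none.
  split=> // i j; rewrite mxE (ord1 i).
  by have := h ord0 (lift ord0 j); rewrite !mxE liftK.
move=> [/= h1 [_ h2]]; split=> // i j; rewrite (ord1 i) mxE.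
case: unliftP => [k ->|->] //=.
by have := h2 ord0 k; rewrite mxE.
Qed.

Lemma lebesgue_rV_open_gt0 n (U : set 'rV[R]_n) (x : 'rV[R]_n) :
  open U -> U x -> (0 < lebesgue_rV R n U)%E.
Proof.
move=> oU Ux.
have /nbhs_ballP[e /= e0 eU] : nbhs x U by apply: open_nbhs_nbhs.
apply: (@lt_le_trans _ _ (lebesgue_rV R n (ball x e))).
  by rewrite lebesgue_rV_ball // lte_fin exprn_gt0 // pmulrn_lgt0.
by apply: le_measure => //; rewrite inE; [exact: measurable_rV_ball|exact: measurable_rV_open].
Qed.

Lemma mem_rV_ball0 n (y : 'rV[R]_n) r : ball 0 r y <-> `|y| < r.
Proof. by rewrite -ball_normE /ball_ /= sub0r normrN. Qed.

(** Pairwise disjoint translates of [A] fit into [B]. With translation invariance this yields the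
    two volume estimates needed below, for hyperplanes and for neighbourhoods of codimension 2
    planes, without a linear change of variables. *)
Lemma packing n (A B : set 'rV[R]_n) m (F : nat -> 'rV[R]_n) :
  measurable A -> measurable B ->
  (forall i, (i < m)%N -> forall y, A y -> B (y + F i)) ->
  (forall i j y z, (i < m)%N -> (j < m)%N -> A y -> A z ->
    y + F i = z + F j -> i = j) ->
  (m%:R%:E * lebesgue_rV R n A <= lebesgue_rV R n B)%E.
Proof.
move=> mA mB AB Fi.
pose C i := (fun y => y - F i) @^-1` A.
have mC i : measurable (C i).
  by rewrite -[X in measurable X]setTI; apply: measurable_rV_shift.
have CE i : lebesgue_rV R n (C i) = lebesgue_rV R n A.
  exact: lebesgue_rV_shift.
have -> : (m%:R%:E * lebesgue_rV R n A = \sum_(i < m) lebesgue_rV R n (C i))%E.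
  under eq_bigr do rewrite CE -[lebesgue_rV R n A]mul1e.
  by rewrite -ge0_sume_distrl // sumEFin sumr_const card_ord.
rewrite -measure_bigsetU_ord //; last first.
  apply/trivIsetP => /= i j _ _ ij; apply/seteqP; split=> // y [/= Ci Cj].
  have : (i : nat) = j.
    by apply: (Fi i j _ _ _ _ Ci Cj) => //; rewrite !subrK.
  by move/val_inj => /eqP; rewrite (negPf ij).
apply: le_measure; rewrite ?inE //; first exact: bigsetU_measurable.
rewrite -bigcup_seq => y [i _ /= Ciy].
by have := AB i (ltn_ord i) _ Ciy; rewrite subrK.
Qed.

End lebesgue_rV_facts.

(** * Linear functionals and affine functions *)

Section dot.
Variables (R : realType) (n : nat).
Implicit Types (N y z : 'rV[R]_n) (c : R).

Definition dot N y : R := \sum_i N ord0 i * y ord0 i.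

Lemma dotDr N y z : dot N (y + z) = dot N y + dot N z.
Proof. by rewrite /dot -big_split; apply: eq_bigr => i _; rewrite mxE mulrDr. Qed.

Lemma dotZr N c y : dot N (c *: y) = c * dot N y.
Proof. by rewrite /dot mulr_sumr; apply: eq_bigr => i _; rewrite mxE mulrCA. Qed.

Lemma dotNr N y : dot N (- y) = - dot N y.
Proof. by rewrite -scaleN1r dotZr mulN1r. Qed.

Lemma dotBr N y z : dot N (y - z) = dot N y - dot N z.
Proof. by rewrite dotDr dotNr. Qed.

Lemma dot0r N : dot N 0 = 0.
Proof. by rewrite -(scale0r 0) dotZr mul0r. Qed.

Lemma dot_delta N i : dot N (delta_mx ord0 i) = N ord0 i.
Proof.
rewrite /dot (bigD1 i) //= mxE !eqxx mulr1 big1 ?addr0 // => j ji.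
by rewrite mxE eqxx (negPf ji) mulr0.
Qed.

Lemma dotC N y : dot N y = dot y N.
Proof. by apply: eq_bigr => i _; rewrite mulrC. Qed.

Lemma dot_gt0 N : N != 0 -> 0 < dot N N.
Proof.
move=> N0; rewrite lt_neqAle sumr_ge0 ?andbT; last first.
  by move=> i _; rewrite -expr2 sqr_ge0.
apply: contra N0; rewrite eq_sym psumr_eq0; last first.
  by move=> i _; rewrite -expr2 sqr_ge0.
move=> /allP h; apply/eqP/rowP => i; rewrite mxE.
have := h i (mem_index_enum _); rewrite -expr2 expf_eq0 /=.
by move/eqP.
Qed.

Lemma continuous_dot N : continuous (dot N).
Proof.
apply: (@continuous_big R _ +%R 0 xpredT add_continuous _ _
  (fun i z => N ord0 i * z ord0 i)) => i _ y.
apply: (@continuousM _ _ (fun=> N ord0 i) (fun z : 'rV[R]_n => z ord0 i)).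
  exact: (@cst_continuous _ _ _ y).
exact: coord_continuous.
Qed.

Definition affine (f : 'rV[R]_n -> R) :=
  exists c N, forall y, f y = c + dot N y.

Lemma affine_continuous f : affine f -> continuous f.
Proof.
move=> [c [N fE]]; rewrite (_ : f = fun y => c + dot N y); last exact/funext.
move=> y; apply: (@continuousD _ _ _ (fun=> c) (dot N)).
  exact: (@cst_continuous _ _ _ y).
exact: continuous_dot.
Qed.

Lemma affineD f g : affine f -> affine g -> affine (fun y => f y + g y).
Proof.
move=> [c [N fE]] [d [M gE]]; exists (c + d), (N + M) => y.
by rewrite fE gE !(dotC (_ : 'rV_n) y) dotDr; ring.
Qed.

Lemma affineZ a f : affine f -> affine (fun y => a * f y).
Proof.
move=> [c [N fE]]; exists (a * c), (a *: N) => y.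
by rewrite fE !(dotC (_ : 'rV_n) y) dotZr; ring.
Qed.

Lemma affine_cst a : affine (fun=> a).
Proof. by exists a, 0 => y; rewrite dotC dot0r addr0. Qed.

Lemma affine_sum (I : Type) (s : seq I) (P : pred I) (F : I -> 'rV[R]_n -> R) :
  (forall i, P i -> affine (F i)) -> affine (fun y => \sum_(i <- s | P i) F i y).
Proof.
move=> aF; elim: s => [|i s IH].
  by under eq_fun do rewrite big_nil; exact: affine_cst.
under eq_fun do rewrite big_cons.
by case Pi: (P i) => //; apply: affineD => //; exact: aF.
Qed.

Lemma affine_line f t y z : affine f ->
  f (z + t *: (y - z)) = f z + t * (f y - f z).
Proof. by move=> [c [N fE]]; rewrite !fE dotDr dotZr dotBr; ring. Qed.

End dot.

(** * Hyperplanes and thin neighbourhoods of codimension 2 planes *)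

Section null_sets.
Variables (R : realType) (n : nat).
Local Notation mu := (lebesgue_rV R n).
Implicit Types (N y z : 'rV[R]_n) (c : R).

Lemma lebesgue_rV_ballE (x : 'rV[R]_n) r : exists C : R, mu (ball x r) = C%:E.
Proof.
have [r0|r0] := ltP 0 r; first by exists ((r *+ 2) ^+ n); rewrite lebesgue_rV_ball.
exists 0; rewrite (_ : ball x r = set0) ?measure0 //.
by apply/seteqP; split => // y []; rewrite ltNge r0.
Qed.

Lemma measurable_le (f g : 'rV[R]_n -> R) : measurable_fun setT f ->
  measurable_fun setT g -> measurable [set y | f y <= g y].
Proof.
move=> mf mg.
have := measurable_fun_ler mf mg measurableT (Y := [set true]).
rewrite setTI; apply; exact: I.
Qed.

Lemma measurable_lt (f g : 'rV[R]_n -> R) : measurable_fun setT f ->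
  measurable_fun setT g -> measurable [set y | f y < g y].
Proof.
move=> mf mg.
have := measurable_fun_ltr mf mg measurableT (Y := [set true]).
rewrite setTI; apply; exact: I.
Qed.

Lemma hyperplane_measurable c N : measurable [set y | c + dot N y = 0].
Proof.
have mf : measurable_fun setT (fun y => c + dot N y).
  by apply: continuous_rV_measurable; apply: affine_continuous; exists c, N.
rewrite (_ : mkset _ = [set y | c + dot N y <= 0] `&` [set y | 0 <= c + dot N y]).
  by apply: measurableI; exact: measurable_le.
by apply/seteqP; split=> y /=; [move=> ->; rewrite lexx|case=> a b; apply/eqP; rewrite eq_le a b].
Qed.

(** Inside a fixed ball the set has, for every [m], [m] disjoint translates by the vectors
    [(i / m) N], all contained in one larger ball independent of [m]. Hence [m] times its measure
    stays bounded. *)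
Lemma hyperplane_null c N : N != 0 -> mu [set y | c + dot N y = 0] = 0%E.
Proof.
move=> N0; have mA := hyperplane_measurable c N.
pose A (M : nat) := [set y | c + dot N y = 0] `&` ball 0 M%:R.
have mAM M : measurable (A M) by apply: measurableI => //; exact: measurable_rV_ball.
have A0 M : mu (A M) = 0%E.
  have [C CE] := lebesgue_rV_ballE 0 (M%:R + `|N|).
  have /(_ _)h m : (m%:R%:E * mu (A M) <= C%:E)%E.
    rewrite -CE; apply: (@packing _ _ _ _ _ (fun i => (i%:R / m%:R) *: N)) => //.
    - exact: measurable_rV_ball.
    - move=> i im y [_ /mem_rV_ball0 yM]; apply/mem_rV_ball0.
      apply: (le_lt_trans (ler_normD _ _)); apply: ltr_leD => //.
      rewrite normrZ ler_piMl // ger0_norm ?divr_ge0 // ler_pdivrMr ?mul1r ?ler_nat ?(ltnW im) //.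
      by rewrite ltr0n; exact: leq_ltn_trans im.
    - move=> i j y z im jm [/= ly _] [/= lz _] /(congr1 (dot N)).
      rewrite !dotDr !dotZr => h.
      have m0 : m%:R != 0 :> R by rewrite pnatr_eq0 -lt0n; exact: leq_ltn_trans im.
      have : i%:R / m%:R * dot N N = j%:R / m%:R * dot N N by lra.
      move/(mulIf (lt0r_neq0 (dot_gt0 N0))) => /(mulIf (invr_neq0 m0)) /eqP.
      by rewrite eqr_nat => /eqP.
  have fin : mu (A M) \is a fin_num.
    rewrite ge0_fin_numE //; have := h 1%N; rewrite mul1e => /le_lt_trans; apply; exact: ltry.
  rewrite -(fineK fin); congr EFin; apply/eqP; rewrite eq_le fine_ge0 // andbT.
  apply/ler_addgt0Pl => e e0; rewrite addr0.
  have C0 : 0 <= C by rewrite -lee_fin -CE.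
  have [m mh] : exists m : nat, C / e < m%:R.
    by exists (Num.truncn (C / e)).+1; exact: truncnS_gt.
  have m0 : 0 < m%:R :> R by apply: le_lt_trans mh; rewrite divr_ge0 // ltW.
  have := h m; rewrite -(fineK fin) -EFinM lee_fin => hm.
  rewrite -(ler_pM2l m0); apply: (le_trans hm).
  by move: mh; rewrite ltr_pdivrMr // => /ltW.
rewrite (_ : mkset _ = \bigcup_M A M); last first.
  apply/seteqP; split=> y; last by case=> M _ [].
  move=> ly; exists (Num.truncn `|y|).+1 => //; split=> //.
  by apply/mem_rV_ball0; exact: truncnS_gt.
have /negligibleP -> // : mu.-negligible (\bigcup_M A M).
  apply: negligible_bigcup => M.
  by exists (A M); split; [exact: mAM|exact: A0|].
by apply: bigcup_measurable => M _; exact: mAM.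
Qed.

(** The vectors [v1] and [v2] are dual to the normals, so moving along one of them changes only one
    of the two affine functions. This gives [(m + 1)^2] disjoint translates in a fixed ball, hence a
    measure of order [1 / m^2]. *)
Lemma codim2_measure (c1 c2 : R) (N1 N2 v1 v2 : 'rV[R]_n) (M : R) :
  dot N1 v1 = 1 -> dot N1 v2 = 0 -> dot N2 v1 = 0 -> dot N2 v2 = 1 ->
  exists C : R, forall m : nat,
    ((m.+1 * m.+1)%:R%:E * mu ([set y | (`|c1 + dot N1 y| <= 2 / m.+1%:R)%R /\
        (`|c2 + dot N2 y| <= 2 / m.+1%:R)%R] `&` ball 0%R M)%classic <= C%:E)%E.
Proof.
move=> h11 h12 h21 h22.
have [C CE] := lebesgue_rV_ballE 0 (M + 5 * `|v1| + 5 * `|v2|).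
exists C => m; rewrite -CE.
have mp : 0 < m.+1%:R :> R by [].
(* Quotient and remainder of [i] by [m + 1] give the two grid indices. Two points of the set differ
   by at most [4 / (m + 1)] in either affine function, so a grid of mesh [5 / (m + 1)] separates the
   translates. *)
apply: (@packing _ _ _ _ _ (fun i => (5 / m.+1%:R) *:
  ((i %/ m.+1)%:R *: v1 + (i %% m.+1)%:R *: v2))).
- apply: measurableI; last exact: measurable_rV_ball.
  apply: measurableI; apply: measurable_le => //;
    apply: measurableT_comp => //; apply: continuous_rV_measurable;
    apply: affine_continuous; by [exists c1, N1|exists c2, N2].
- exact: measurable_rV_ball.
- move=> i im y [_ /mem_rV_ball0 yM]; apply/mem_rV_ball0.
  have k1 (k : nat) (v : 'rV[R]_n) : (k <= m.+1)%N ->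
      `|(5 / m.+1%:R) *: (k%:R *: v)| <= 5 * `|v|.
    move=> km; rewrite scalerA normrZ ler_wpM2r // ger0_norm ?mulr_ge0 //.
    by rewrite -mulrA -[leRHS]mulr1 ler_pM2l // mulrC ler_pdivrMr // mul1r ler_nat.
  apply: (le_lt_trans (ler_normD _ _)); rewrite -addrA; apply: ltr_leD => //.
  rewrite scalerDr; apply: (le_trans (ler_normD _ _)).
  apply: lerD; apply: k1; last by rewrite ltnW // ltn_pmod.
  by rewrite ltnW // ltn_divLR.
- move=> i j y z im jm [/= [y1 y2] _] [/= [z1 z2] _] E.
  have key (k l : nat) (a b : R) : `|a| <= 2 / m.+1%:R -> `|b| <= 2 / m.+1%:R ->
      a + 5 / m.+1%:R * k%:R = b + 5 / m.+1%:R * l%:R -> k = l.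
    move=> ha hb /eqP; rewrite -subr_eq0 => /eqP h.
    have : `|k%:R - l%:R| * 5 <= 4 :> R.
      have : `|a - b| <= 4 / m.+1%:R.
        apply: (le_trans (ler_normB _ _)); apply: (le_trans (lerD ha hb)).
        by rewrite -mulrDl ler_wpM2r ?invr_ge0 //; lra.
      have -> : a - b = - (5 / m.+1%:R * (k%:R - l%:R)).
        by apply/eqP; rewrite -subr_eq0 -{}h; apply/eqP; ring.
      rewrite normrN normrM ger0_norm ?divr_ge0 // mulrAC ler_pM2r ?invr_gt0 //.
      by rewrite mulrC.
    wlog kl : k l a b ha hb h / (k <= l)%N.
      move=> H; case: (leqP k l) => [|/ltnW] kl; first exact: (H _ _ a b).
      by rewrite distrC => /(H _ _ b a hb ha _ kl) -> //; rewrite -opprB h oppr0.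
    move=> kl5; apply/eqP; rewrite eqn_leq kl /= leqNgt; apply/negP => kl'.
    have : k.+1%:R <= l%:R :> R by rewrite ler_nat.
    have : l%:R - k%:R <= `|k%:R - l%:R| :> R by rewrite distrC ler_norm.
    by rewrite -natr1; lra.
  have e1 := congr1 (dot N1) E; have e2 := congr1 (dot N2) E.
  move: e1 e2; rewrite !(dotDr, dotZr) h11 h12 h21 h22 => e1 e2.
  rewrite (divn_eq i m.+1) (divn_eq j m.+1).
  move: e1 e2; rewrite !mulr0 !mulr1 !addr0 !add0r => e1 e2.
  congr (_ * _ + _)%N.
    by apply: (key _ _ _ _ y1 z1); rewrite -!addrA e1.
  by apply: (key _ _ _ _ y2 z2); rewrite -!addrA e2.
Qed.

End null_sets.

(** * Integrals of bounded functions of bounded support *)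

Section integrals.
Variables (R : realType) (n : nat).
Local Notation mu := (lebesgue_rV R n).
Implicit Types (y z v : 'rV[R]_n) (f g : 'rV[R]_n -> R) (D : set 'rV[R]_n).

(** One constant [M] bounds both the values and the support, so a single constant function on a ball
    of radius [|M| + 1] dominates [f]. It serves as majorant in dominated convergence. *)
Definition bounded_support f := measurable_fun setT f /\
  exists M, forall y, `|f y| <= M /\ (M < `|y| -> f y = 0).

Lemma integrable_cst_ball (M : R) : mu.-integrable setT (EFin \o (cst M \_ (ball 0 (`|M| +
  1)) : 'rV[R]_n -> R)).
Proof.
rewrite -restrict_EFin; apply/integrable_restrict => //=.
  exact: measurable_rV_ball.
rewrite setTI; apply/integrableP; split; first by apply/measurable_EFinP; exact: measurable_cst.
rewrite (eq_integral (cst `|M|%:E)) //.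
rewrite integral_cst; last exact: measurable_rV_ball.
have [C CE] := @lebesgue_rV_ballE R n 0 (`|M| + 1).
by apply: (@le_lt_trans _ _ (`|M|%:E * C%:E)%E); [rewrite -CE|rewrite -EFinM ltry].
Qed.

Lemma dominated_cst_ball f (M : R) : (forall y, `|f y| <= M /\ (M < `|y| -> f y = 0)) ->
  forall y, `|f y| <= ((cst M \_ (ball 0 (`|M| + 1)) : 'rV[R]_n -> R) y).
Proof.
move=> fM y; rewrite /patch; case: ifPn => [_|]; first exact: (fM y).1.
rewrite notin_setE => yM; rewrite (fM y).2 ?normr0 //.
have : ~ `|y| < `|M| + 1 by move/mem_rV_ball0.
move/negP; rewrite -leNgt; apply: lt_le_trans.
by rewrite (le_lt_trans (ler_norm _)) // ltrDl.
Qed.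

Lemma bounded_support_integrable f D : measurable D -> bounded_support f ->
  mu.-integrable D (EFin \o f).
Proof.
move=> mD [mf [M fM]]; apply: (integrableS measurableT) => //.
apply: le_integrable (integrable_cst_ball M) => //; first exact/measurable_EFinP.
move=> y _ /=; rewrite lee_fin.
by apply: (le_trans (dominated_cst_ball fM y)); exact: ler_norm.
Qed.

Lemma Rintegral_cvg D (f_ : nat -> 'rV[R]_n -> R) f g : measurable D ->
  (forall m, measurable_fun D (f_ m)) -> measurable_fun D f ->
  mu.-integrable D (EFin \o g) ->
  (forall m y, D y -> `|f_ m y| <= g y) ->
  {ae mu, forall y, D y -> f_ ^~ y @ \oo --> f y} ->
  \int[mu]_(y in D) f_ m y @[m --> \oo] --> \int[mu]_(y in D) f y.
Proof.
move=> mD mf_ mf ig fg fcvg.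
have [ | | | | | i _ h] := @dominated_convergence _ _ R mu D mD
  (fun m y => (f_ m y)%:E) (fun y => (f y)%:E) (EFin \o g).
- by move=> m; exact/measurable_EFinP.
- exact/measurable_EFinP.
- by apply: filterS fcvg => y /[apply] fy; apply: cvg_EFin => //; exact: nearW.
- exact: ig.
- by apply: nearW => y m Dy; rewrite /= lee_fin fg.
apply: (@fine_cvg _ _ _ _ _ _) => //.
rewrite fineK; first exact: h.
exact: integrable_fin_num.
Qed.

Lemma bounded_support_cvg D (f_ : nat -> 'rV[R]_n -> R) f M : measurable D ->
  (forall m, measurable_fun setT (f_ m)) -> measurable_fun setT f ->
  (forall m y, `|f_ m y| <= M /\ (M < `|y| -> f_ m y = 0)) ->
  {ae mu, forall y, D y -> f_ ^~ y @ \oo --> f y} ->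
  \int[mu]_(y in D) f_ m y @[m --> \oo] --> \int[mu]_(y in D) f y.
Proof.
move=> mD mf_ mf fM; apply: Rintegral_cvg => //.
- by move=> m; exact: measurable_funTS.
- exact: measurable_funTS.
- by apply: (integrableS measurableT) => //; exact: (integrable_cst_ball M).
- by move=> m y _; exact: dominated_cst_ball (fM m) y.
Qed.

(** A bound on [g] is asked only where [f] does not vanish, which admits unbounded continuous
    factors as in [bounded_support_cont]. *)
Lemma bounded_supportZ f g : bounded_support f -> measurable_fun setT g ->
  (exists M, forall y, f y != 0 -> `|g y| <= M) ->
  bounded_support (fun y => f y * g y).
Proof.
move=> [mf [M fM]] mg [M' gM]; split; first exact: measurable_funM.
exists (`|M| + `|M| * `|M'|) => y; split; last first.
  move=> h; rewrite (fM y).2 ?mul0r //; apply: le_lt_trans h.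
  by rewrite (le_trans (ler_norm M)) // lerDl mulr_ge0.
have [->|fy] := eqVneq (f y) 0; first by rewrite mul0r normr0 addr_ge0 // mulr_ge0.
rewrite normrM ler_wpDl // ler_pM //.
  by rewrite (le_trans (fM y).1) // ler_norm.
by rewrite (le_trans (gM y fy)) // ler_norm.
Qed.

Lemma bounded_supportD f g : bounded_support f -> bounded_support g ->
  bounded_support (fun y => f y + g y).
Proof.
move=> [mf [M fM]] [mg [M' gM]]; split; first exact: measurable_funD.
exists (`|M| + `|M'|) => y; split.
  apply: (le_trans (ler_normD _ _)); apply: lerD.
    by rewrite (le_trans (fM y).1) // ler_norm.
  by rewrite (le_trans (gM y).1) // ler_norm.
move=> h; rewrite (fM y).2 ?(gM y).2 ?addr0 //; apply: le_lt_trans h.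
  by rewrite (le_trans (ler_norm M')) // lerDr.
by rewrite (le_trans (ler_norm M)) // lerDl.
Qed.

Lemma bounded_support0 : bounded_support (fun=> 0).
Proof. by split=> //; exists 0 => y; rewrite normr0. Qed.

Lemma bounded_support_mulr a f : bounded_support f ->
  bounded_support (fun y => a * f y).
Proof.
move=> bf; under eq_fun do rewrite mulrC.
by apply: bounded_supportZ => //; exists `|a|.
Qed.

Lemma bounded_supportB f g : bounded_support f -> bounded_support g ->
  bounded_support (fun y => f y - g y).
Proof.
move=> bf bg; apply: bounded_supportD => //.
under eq_fun do rewrite -mulN1r; exact: bounded_support_mulr.
Qed.

Lemma bounded_support_sum (I : Type) (s : seq I) (P : pred I)
    (F : I -> 'rV[R]_n -> R) : (forall i, P i -> bounded_support (F i)) ->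
  bounded_support (fun y => \sum_(i <- s | P i) F i y).
Proof.
move=> bF; elim: s => [|i s IH].
  by under eq_fun do rewrite big_nil; exact: bounded_support0.
under eq_fun do rewrite big_cons.
by case Pi: (P i) => //; apply: bounded_supportD => //; exact: bF.
Qed.

Lemma bounded_support_indic f D : measurable D -> bounded_support f ->
  bounded_support (fun y => \1_D y * f y).
Proof.
move=> mD bf; under eq_fun do rewrite mulrC.
apply: bounded_supportZ => //; exists 1 => y _.
by rewrite indicE; case: (_ \in _); rewrite ?normr1 ?normr0.
Qed.

Lemma continuous_compact_bounded g K : continuous g -> compact K ->
  exists M, forall y, K y -> `|g y| <= M.
Proof.
move=> cg cK.
have /compact_bounded[M [_ h]] : compact (g @` K).
  by apply: continuous_compact => //; exact: continuous_subspaceT.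
exists (M + 1) => y Ky; apply: (h (M + 1)); first by rewrite ltrDl.
by exists y.
Qed.

Lemma continuous_bounded_support f K : continuous f -> compact K ->
  (forall y, ~ K y -> f y = 0) -> bounded_support f.
Proof.
move=> cf cK fK; split; first exact: continuous_rV_measurable.
have [M fM] := continuous_compact_bounded cf cK.
have /compact_bounded[M' [_ h]] := cK.
exists (`|M| + `|M'| + 1) => y; split.
  have [/fM fy|/fK->] := pselect (K y); last by rewrite normr0 !addr_ge0.
  rewrite (le_trans fy) // (le_trans (ler_norm M)) // -addrA lerDl addr_ge0 //.
move=> hy; apply: fK => Ky; move: hy; apply/negP; rewrite -leNgt.
apply: (h (`|M| + `|M'| + 1)) => //.
by rewrite (le_lt_trans (ler_norm _)) // addrAC ltr_pwDl // ltr_wpDl.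
Qed.

Lemma bounded_support_cont f g : bounded_support f -> continuous g ->
  bounded_support (fun y => f y * g y).
Proof.
move=> bf cg; apply: bounded_supportZ => //; first exact: continuous_rV_measurable.
have [_ [M fM]] := bf.
have cK : compact [set y : 'rV[R]_n | `|y| <= M].
  apply: bounded_closed_compact; first by exists M; split=> [|x Mx];
    [exact: num_real|move=> y /= /le_trans; apply; exact: ltW].
  rewrite (_ : mkset _ = (@Num.norm _ 'rV[R]_n) @^-1` [set t | t <= M]) //.
  apply: closed_comp; first by move=> y _; exact: norm_continuous.
  exact: closed_le.
have [M' gM] := continuous_compact_bounded cg cK.
exists M' => y fy; apply: gM => /=; rewrite leNgt; apply: contra fy => yM.
by rewrite (fM y).2.
Qed.

Lemma bounded_support_shift f v : bounded_support f ->
  bounded_support (fun y => f (y + v)).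
Proof.
move=> [mf [M fM]]; split.
  by apply: measurableT_comp => //; exact: measurable_rV_shift.
exists (`|M| + `|v|) => y; split.
  by rewrite (le_trans (fM _).1) // (le_trans (ler_norm M)) // lerDl.
move=> h; apply: (fM _).2; rewrite (le_lt_trans (ler_norm M)) //.
move: h; rewrite -ltrBrDr => /lt_le_trans; apply.
by rewrite -[X in `|X| - _](addrK v) lerBlDr ler_normB.
Qed.

Lemma Rintegral_shift D f v : measurable D -> bounded_support f ->
  \int[mu]_(y in (fun y => y + v) @^-1` D) f (y + v) = \int[mu]_(y in D) f y.
Proof.
move=> mD bf; have [mf _] := bf.
have ms := measurable_rV_shift v.
have mE A : measurable A -> A `<=` D -> push_measure mu ms A = mu A.
  by move=> mA _; exact: lebesgue_rV_shift.
rewrite /Rintegral; congr fine.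
transitivity (\int[push_measure mu ms]_(x in D) (f x)%:E)%E; last first.
  exact: eq_measure_integral.
rewrite [RHS](integral_pushforward ms) //; first exact/measurable_EFinP.
have mD' : measurable ((fun y => y + v) @^-1` D).
  by rewrite -[X in measurable X]setTI; exact: (measurable_rV_shift v).
apply: (@bounded_support_integrable (fun y => f (y + v))) => //.
exact: bounded_support_shift.
Qed.

Lemma Rintegral_ae D f g : measurable D -> measurable_fun D f -> measurable_fun D g ->
  {ae mu, forall y, D y -> f y = g y} ->
  \int[mu]_(y in D) f y = \int[mu]_(y in D) g y.
Proof.
move=> mD mf mg fg; rewrite /Rintegral; congr fine.
apply: ae_eq_integral => //; try exact/measurable_EFinP.
by apply: filterS fg => y h /h ->.
Qed.

Lemma Rintegral_indic D f : measurable D ->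
  \int[mu]_(y in D) f y = \int[mu]_y (\1_D y * f y).
Proof.
move=> mD; rewrite Rintegral_mkcond; apply: eq_Rintegral => y _.
by rewrite /patch indicE; case: (y \in D); rewrite ?mul1r ?mul0r.
Qed.

End integrals.

(** * Smooth functions and cutoffs *)

Section smooth_functions.
Variables (R : realType) (n : nat).
Local Notation vec := 'rV[R]_n.
Implicit Types (f g a : vec -> R) (x y v : vec).

(** Smoothness speaks of all iterated derivatives, so a direct induction on the order would need a
    formula for each of them. It is enough to exhibit a class of differentiable functions that is
    closed under directional derivatives; products, inverses and bumps below each come with such a
    class. *)
Lemma smooth_ind (C : set (vec -> R)) :
  (forall f, C f -> forall x, differentiable f x) ->
  (forall f v, C f -> C ('D_v f)) -> forall f, C f -> smooth f.
Proof.
move=> dC DC f Cf s.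
suff : C (iter_derive s f) by move=> h x; exact: dC.
by elim: s => //= v s IH; exact: DC.
Qed.

Lemma smooth_differentiable f x : smooth f -> differentiable f x.
Proof. by move=> /(_ [::]). Qed.

Lemma smooth_derivable f x v : smooth f -> derivable f x v.
Proof. by move=> sf; apply: diff_derivable; exact: smooth_differentiable. Qed.

Lemma smooth_derive f v : smooth f -> smooth ('D_v f).
Proof.
move=> sf s x; have := sf (rcons s v) x.
by rewrite /iter_derive -cats1 foldr_cat.
Qed.

Lemma smooth_continuous f : smooth f -> continuous f.
Proof.
by move=> sf x; apply: differentiable_continuous; exact: smooth_differentiable.
Qed.

Lemma derive_add f g v y : smooth f -> smooth g ->
  'D_v (fun y => f y + g y) y = 'D_v f y + 'D_v g y.
Proof.
move=> sf sg.
by apply: (@deriveD _ _ _ f g); exact: smooth_derivable.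
Qed.

Lemma derive_mul f g v y : smooth f -> smooth g ->
  'D_v (fun y => f y * g y) y = f y * 'D_v g y + g y * 'D_v f y.
Proof.
move=> sf sg.
by apply: (@deriveM _ _ f g); exact: smooth_derivable.
Qed.

Lemma smooth_cst (c : R) : smooth (fun _ : vec => c).
Proof.
apply: (@smooth_ind [set f | exists c, f = fun=> c]); last by exists c.
  by move=> _ [d ->] x; exact: differentiable_cst.
by move=> _ v [d ->]; exists 0; apply/funext => y; exact: derive_cst.
Qed.

Lemma smoothD f g : smooth f -> smooth g -> smooth (fun y => f y + g y).
Proof.
move=> sf sg; apply: (@smooth_ind [set h | exists f g, [/\ smooth f, smooth g &
  h = fun y => f y + g y]]); last by exists f, g.
  move=> _ [f1 [g1 [sf1 sg1 ->]]] x.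
  by apply: (@differentiableD _ _ _ f1 g1); exact: smooth_differentiable.
move=> _ v [f1 [g1 [sf1 sg1 ->]]]; exists ('D_v f1), ('D_v g1).
by split; [exact: smooth_derive|exact: smooth_derive|apply/funext => y; exact: derive_add].
Qed.

(** The class used for products in [smooth_ind]: a single product is not closed under
    differentiation, but by the Leibniz rule sums of products are. *)
Inductive product_sum : (vec -> R) -> Prop :=
| Product_mul f g : smooth f -> smooth g -> product_sum (fun y => f y * g y)
| Product_add f g : product_sum f -> product_sum g ->
    product_sum (fun y => f y + g y).

Lemma product_sum_differentiable f x : product_sum f -> differentiable f x.
Proof.
elim=> {}f g.
  move=> sf sg.
  by apply: (@differentiableM _ _ f g); exact: smooth_differentiable.
by move=> _ df _ dg; exact: (@differentiableD _ _ _ f g).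
Qed.

Lemma smoothM f g : smooth f -> smooth g -> smooth (fun y => f y * g y).
Proof.
move=> sf sg; apply: (@smooth_ind product_sum); last exact: Product_mul.
  by move=> h ph x; exact: product_sum_differentiable.
move=> h v; elim=> {f g h sf sg} f g.
  move=> sf sg; rewrite (_ : 'D_v _ = fun y => f y * 'D_v g y + g y * 'D_v f y).
    by apply: Product_add; apply: Product_mul => //; exact: smooth_derive.
  by apply/funext => y; exact: derive_mul.
move=> pf Cf pg Cg.
rewrite (_ : 'D_v _ = fun y => 'D_v f y + 'D_v g y); first exact: Product_add.
apply/funext => y; apply: (@deriveD _ _ _ f g);
  by apply: diff_derivable; exact: product_sum_differentiable.
Qed.

Lemma smoothZ (c : R) f : smooth f -> smooth (fun y => c * f y).
Proof. by apply: smoothM; exact: smooth_cst. Qed.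

Lemma derive_mulr (c : R) f v y : smooth f -> 'D_v (fun y => c * f y) y = c * 'D_v f y.
Proof.
move=> sf; rewrite derive_mul //; last exact: smooth_cst.
by rewrite (derive_cst c) mulr0 addr0.
Qed.

Lemma smoothN f : smooth f -> smooth (fun y => - f y).
Proof. by move=> sf; under eq_fun do rewrite -mulN1r; exact: smoothZ. Qed.

Lemma smoothB f g : smooth f -> smooth g -> smooth (fun y => f y - g y).
Proof. by move=> sf sg; apply: smoothD => //; exact: smoothN. Qed.

Lemma derive_sub f g v y : smooth f -> smooth g ->
  'D_v (fun y => f y - g y) y = 'D_v f y - 'D_v g y.
Proof.
move=> sf sg.
by apply: (@deriveB _ _ _ f g); exact: smooth_derivable.
Qed.

Lemma smooth_sum (I : Type) (s : seq I) (P : pred I) (F : I -> vec -> R) :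
  (forall i, P i -> smooth (F i)) -> smooth (fun y => \sum_(i <- s | P i) F i y).
Proof.
move=> sF; elim: s => [|i s IH].
  by under eq_fun do rewrite big_nil; exact: smooth_cst.
under eq_fun do rewrite big_cons.
by case Pi: (P i) => //; apply: smoothD => //; exact: sF.
Qed.

Lemma derive_bigsum (I : Type) (s : seq I) (P : pred I) (F : I -> vec -> R) v y :
  (forall i, P i -> smooth (F i)) ->
  'D_v (fun y => \sum_(i <- s | P i) F i y) y = \sum_(i <- s | P i) 'D_v (F i) y.
Proof.
move=> sF; elim: s => [|i s IH].
  rewrite (_ : (fun y => _) = fun=> 0); last by apply/funext => z; rewrite big_nil.
  by rewrite big_nil (derive_cst 0).
rewrite (_ : (fun y => _) = fun y =>
    if P i then F i y + \sum_(j <- s | P j) F j y else \sum_(j <- s | P j) F j y).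
  rewrite big_cons; case Pi: (P i); last exact: IH.
  by rewrite derive_add; [rewrite IH|exact: sF|exact: smooth_sum].
by apply/funext => z; rewrite big_cons.
Qed.

Lemma smooth_prod (I : Type) (s : seq I) (P : pred I) (F : I -> vec -> R) :
  (forall i, P i -> smooth (F i)) -> smooth (fun y => \prod_(i <- s | P i) F i y).
Proof.
move=> sF; elim: s => [|i s IH].
  by under eq_fun do rewrite big_nil; exact: smooth_cst.
under eq_fun do rewrite big_cons.
by case Pi: (P i) => //; apply: smoothM => //; exact: sF.
Qed.

Lemma smoothX f m : smooth f -> smooth (fun y => f y ^+ m).
Proof.
move=> sf; elim: m => [|m IH]; first exact: smooth_cst.
by under eq_fun do rewrite exprS; exact: smoothM.
Qed.

Lemma derive_dot (N : vec) v y : 'D_v (dot N) y = dot N v.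
Proof.
apply: cvg_lim => //.
apply: (@cvg_trans _ ((fun=> dot N v) @ 0^')); last exact: cvg_cst.
apply: near_eq_cvg; near=> h.
rewrite /= dotDr dotZr addrK /GRing.scale /= mulKf //.
by near: h; exact: nbhs_dnbhs_neq.
Unshelve. all: by end_near. Qed.

Lemma differentiable_dot (N : vec) x : differentiable (dot N) x.
Proof.
rewrite (_ : dot N = \sum_(i < n) (N ord0 i *: (fun z : vec => z ord0 i))).
  apply: differentiable_sum => i; apply: differentiableZ.
  exact: differentiable_coord.
by apply/funext => y; rewrite fct_sumE.
Qed.

Lemma affine_derive f v c N : (forall y, f y = c + dot N y) ->
  'D_v f = fun=> dot N v.
Proof.
move=> fE; rewrite (_ : f = cst c + dot N); last by apply/funext => y; exact: fE.
apply/funext => y; rewrite deriveD; last first.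
- by apply: diff_derivable; exact: differentiable_dot.
- exact: derivable_cst.
by rewrite derive_cst add0r derive_dot.
Qed.

Lemma affine_smooth f : affine f -> smooth f.
Proof.
apply: (@smooth_ind [set f | affine f]) => /=.
  move=> g [c [N gE]] x.
  rewrite (_ : g = cst c + dot N); last by apply/funext => y; exact: gE.
  apply: differentiableD; first exact: differentiable_cst.
  exact: differentiable_dot.
by move=> g v [c [N gE]]; rewrite (affine_derive _ gE); exact: affine_cst.
Qed.

Lemma derive_dir f (u v : vec) (c : R) y : smooth f ->
  'D_(u + c *: v) f y = 'D_u f y + c * 'D_v f y.
Proof.
move=> /smooth_differentiable df.
by rewrite !deriveE // linearD linearZ.
Qed.

Lemma smooth_inv f : smooth f -> (forall y, f y != 0) ->
  smooth (fun y => (f y)^-1).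
Proof.
move=> sf f0.
have dV x : differentiable (fun y => (f y)^-1) x.
  by apply: differentiableV => //; exact: smooth_differentiable.
have DV x v : 'D_v (fun y => (f y)^-1) x = - (f x)^-2 * 'D_v f x.
  by rewrite deriveV //; exact: smooth_derivable.
have dVX m x : differentiable (fun y => (f y)^-1 ^+ m) x.
  elim: m => [|m IH]; first exact: differentiable_cst.
  by under eq_fun do rewrite exprS; exact: (@differentiableM _ _ (fun y => (f y)^-1)).
have DVX m x v : 'D_v (fun y => (f y)^-1 ^+ m) x =
    - m%:R * (f x)^-1 ^+ m.+1 * 'D_v f x.
  elim: m => [|m IH].
    by rewrite oppr0 !mul0r; exact: (derive_cst (1 : R)).
  under eq_fun do rewrite exprS.
  rewrite (@deriveM _ _ (fun y => (f y)^-1)); [|exact: diff_derivable..].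
  by rewrite IH DV /GRing.scale /= -exprVn -natr1 !exprS expr0; ring.
(* The invariant class consists of the quotients [a / f^m], since the derivative of such a quotient
   is [(a' f - m a f') / f^(m + 1)]. *)
apply: (@smooth_ind [set h | exists a m, smooth a /\
  h = fun y => a y * (f y)^-1 ^+ m]).
- move=> _ [a [m [sa ->]]] x.
  by apply: (@differentiableM _ _ a); [exact: smooth_differentiable|exact: dVX].
- move=> _ v [a [m [sa ->]]].
  exists (fun y => 'D_v a y * f y - m%:R * (a y * 'D_v f y)), m.+1; split.
    apply: smoothB; first by apply: smoothM => //; exact: smooth_derive.
    by apply: smoothZ; apply: smoothM => //; exact: smooth_derive.
  apply/funext => y.
  rewrite (@deriveM _ _ a); [|exact: smooth_derivable|exact: diff_derivable].
  rewrite DVX /GRing.scale /= exprS; field; exact: f0.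
- exists (fun=> 1), 1%N; split; first exact: smooth_cst.
  by apply/funext => y; rewrite mul1r expr1.
Qed.

End smooth_functions.

Section chain_rule.
Variables (R : realType) (V : normedModType R).
Implicit Types (f : V -> R) (h : R -> R).

Lemma differentiable_comp1 f h dh x : differentiable f x ->
  is_derive (f x) 1 h dh -> differentiable (fun y => h (f y)) x.
Proof.
move=> df [dh1 _]; apply: (@differentiable_comp _ _ _ _ f h) => //.
exact/derivable1_diffP.
Qed.

Lemma derive_comp1 f h dh x v : differentiable f x ->
  is_derive (f x) 1 h dh -> 'D_v (fun y => h (f y)) x = dh * 'D_v f x.
Proof.
move=> df dh1; have dfh := differentiable_comp1 df dh1.
have /derivable1_diffP ddh := @ex_derive _ _ _ _ _ _ _ dh1.
rewrite !deriveE // (@diff_comp _ _ _ _ f h) //=.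
rewrite -[X in 'd h _ X]mulr1 [X in 'd h _ X](_ : _ = 'd f x v *: (1 : R)) //.
have -> : 'd h (f x) ('d f x v *: (1 : R)) = 'd f x v *: 'd h (f x) 1.
  exact: linearZ.
by rewrite -(deriveE (1 : R) ddh) (@derive_val _ _ _ _ _ _ _ dh1) /GRing.scale /= mulrC.
Qed.

End chain_rule.

(** * Flat functions and a smooth step *)

Section exp_bump.
Variable R : realType.
Implicit Types t h : R.

(* The derivative of [exp_bump m] is [- m * exp_bump m.+1 + exp_bump m.+2], so
   this family is closed under differentiation. *)
Definition exp_bump (m : nat) t : R :=
  if 0 < t then t^-1 ^+ m * expR (- t^-1) else 0.

Lemma exp_bump_le0 m t : t <= 0 -> exp_bump m t = 0.
Proof. by move=> t0; rewrite /exp_bump ltNge t0. Qed.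

Lemma exp_bump_gt0 m t : 0 < t -> 0 < exp_bump m t.
Proof.
by move=> t0; rewrite /exp_bump t0 mulr_gt0 ?expR_gt0 // exprn_gt0 // invr_gt0.
Qed.

Lemma exp_bump_ge0 m t : 0 <= exp_bump m t.
Proof.
have [/(exp_bump_le0 m)->|/(exp_bump_gt0 m)/ltW] // := leP t 0.
Qed.

(** Raising [expR s >= s] at [s = 1 / ((m + 2) t)] to the power [m + 2] beats the factor [t^-m] by
    two powers of [t]. A bound of order [t^2] is what makes the difference quotient at [0] tend to
    [0]. *)
Lemma exp_bump_small m t : `|exp_bump m t| <= m.+2%:R ^+ m.+2 * t ^+ 2.
Proof.
have [t0|t0] := leP t 0.
  by rewrite exp_bump_le0 // normr0 mulr_ge0 // ?sqr_ge0 // exprn_ge0.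
rewrite ger0_norm ?exp_bump_ge0 // /exp_bump t0.
have it0 : 0 < t^-1 by rewrite invr_gt0.
have key : expR (- t^-1) <= m.+2%:R ^+ m.+2 * t ^+ m.+2.
  rewrite expRN -exprMn -[leRHS]invrK lef_pV2 ?posrE ?expR_gt0 ?invr_gt0 ?exprn_gt0 ?mulr_gt0 //.
  rewrite -exprVn invfM.
  have -> : expR t^-1 = expR (m.+2%:R^-1 * t^-1) ^+ m.+2.
    by rewrite -expRM_natl mulrA divff ?mul1r.
  rewrite lerXn2r ?nnegrE ?expR_ge0 ?mulr_ge0 ?invr_ge0 ?(ltW t0) //.
  by apply: le_trans (expR_ge1Dx _); rewrite lerDr.
apply: (le_trans (ler_wpM2l _ key)); first by rewrite exprn_ge0 // ltW.
rewrite mulrCA exprVn -[in X in _ * (_ * X)](addn2 m) exprD mulKf //.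
by rewrite expf_neq0 // lt0r_neq0.
Qed.

Lemma exp_bump_derive m t :
  is_derive t 1 (exp_bump m) (- m%:R * exp_bump m.+1 t + exp_bump m.+2 t).
Proof.
have [t0|t0|->] := ltgtP t 0.
- rewrite !exp_bump_le0 ?ltW // mulr0 addr0.
  apply: (@near_eq_is_derive _ _ _ (fun=> 0)).
  by near=> z; rewrite exp_bump_le0 // ltW //; near: z; exact: lt_nbhsl.
- rewrite /exp_bump t0.
  apply: (@near_eq_is_derive _ _ _ (fun z : R => z^-1 ^+ m * expR (- z^-1))).
    by near=> z; have -> // : 0 < z by near: z; exact: lt_nbhsr.
  have tn0 : t != 0 by rewrite lt0r_neq0.
  have dV : is_derive t 1 (fun z : R => z^-1) (- t^-1 ^+ 2).
    have di : derivable (@id R) t 1 by exact: derivable_id.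
    split; first exact: (@derivableV _ _ id).
    by rewrite (@deriveV _ _ id) // derive_id /GRing.scale /= mulr1 exprVn.
  have dX : is_derive t 1 (fun z : R => z^-1 ^+ m) (- m%:R * t^-1 ^+ m.+1).
    have := @is_deriveX _ _ (fun z : R => z^-1) m t 1 _ dV.
    rewrite (_ : (fun z : R => z^-1) ^+ m = (fun z => z^-1 ^+ m)); last first.
      by apply/funext => z; elim: m => // k IH; rewrite !exprS -IH.
    move=> h; apply: (is_derive_eq h); rewrite /GRing.scale /=.
    by case: (m) => [|k]; rewrite ?mul0r ?oppr0 ?mul0r //= !exprS expr0; ring.
  have dE : is_derive t 1 (fun z : R => expR (- z^-1)) (expR (- t^-1) * t^-1 ^+ 2).
    have dN : is_derive t 1 (fun z : R => - z^-1) (t^-1 ^+ 2).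
      by have := @is_deriveN _ _ _ _ _ _ _ dV; rewrite opprK.
    have df : differentiable (fun z : R => - z^-1) t.
      by apply/derivable1_diffP; case: dN.
    split.
      apply/derivable1_diffP.
      exact: (differentiable_comp1 df (is_derive_expR (- t^-1))).
    rewrite (derive_comp1 (1 : R) df (is_derive_expR (- t^-1))).
    by rewrite (@derive_val _ _ _ _ _ _ _ dN).
  have := @is_deriveM _ _ _ _ _ _ _ _ dX dE.
  by move=> h; apply: (is_derive_eq h); rewrite /GRing.scale /= !exprS expr0; ring.
- rewrite !exp_bump_le0 // mulr0 addr0.
  have cvg0 : h^-1 *: (exp_bump m (h *: (1 : R) + 0) - exp_bump m 0) @[h --> 0^'] --> (0 : R).
    apply/cvgr0Pnorm_lt => e e0; pose C : R := m.+2%:R ^+ m.+2.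
    have C0 : 0 < C by rewrite exprn_gt0.
    near=> h.
    have h0 : h != 0 by near: h; exact: nbhs_dnbhs_neq.
    have hC : `|h| < e / C by near: h; apply: dnbhs0_lt; rewrite divr_gt0.
    rewrite addr0 (exp_bump_le0 _ (lexx 0)) subr0 /GRing.scale /= mulr1 normrM normfV.
    rewrite mulrC ltr_pdivrMr ?normr_gt0 //.
    apply: (le_lt_trans (exp_bump_small _ _)); rewrite -/C -real_normK ?num_real // expr2 mulrA.
    by rewrite ltr_pM2r ?normr_gt0 // mulrC -ltr_pdivlMr.
  split; last exact: cvg_lim cvg0.
  by apply/cvg_ex; exists 0.
Unshelve. all: by end_near. Qed.

End exp_bump.

Section step_function.
Variables (R : realType) (n : nat).
Local Notation vec := 'rV[R]_n.
Implicit Types (f g a : vec -> R) (x y v : vec) (t : R).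

(** The class used in [smooth_ind] for the functions [exp_bump m (g y)]: differentiating one term
    shifts [m] by one or two and multiplies the coefficient by a smooth function. *)
Inductive bump_sum g : (vec -> R) -> Prop :=
| Bump_mul a m : smooth a -> bump_sum g (fun y => a y * exp_bump m (g y))
| Bump_add f1 f2 : bump_sum g f1 -> bump_sum g f2 ->
    bump_sum g (fun y => f1 y + f2 y).

Lemma bump_sum_differentiable g f x : smooth g -> bump_sum g f ->
  differentiable f x.
Proof.
move=> sg; elim=> {f}.
  move=> a m sa; have dg := smooth_differentiable x sg.
  apply: (@differentiableM _ _ a); first exact: smooth_differentiable.
  exact: (differentiable_comp1 dg (exp_bump_derive m (g x))).
by move=> f1 f2 _ d1 _ d2; exact: (@differentiableD _ _ _ f1 f2).
Qed.

Lemma smooth_exp_bump g m : smooth g -> smooth (fun y => exp_bump m (g y)).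
Proof.
move=> sg; apply: (@smooth_ind _ _ (bump_sum g)).
- by move=> f bf x; exact: bump_sum_differentiable bf.
- move=> f v; elim=> {f}.
    move=> a k sa.
    rewrite (_ : 'D_v _ = fun y => 'D_v a y * exp_bump k (g y) +
      ((- k%:R * (a y * 'D_v g y)) * exp_bump k.+1 (g y) +
       (a y * 'D_v g y) * exp_bump k.+2 (g y))).
      apply: Bump_add; first by apply: Bump_mul; exact: smooth_derive.
      by apply: Bump_add; apply: Bump_mul; try apply: smoothZ;
        apply: smoothM => //; exact: smooth_derive.
    apply/funext => y; have dg := smooth_differentiable y sg.
    have db := exp_bump_derive k (g y).
    rewrite (@deriveM _ _ a); [|exact: smooth_derivable|].
      by rewrite (derive_comp1 v dg db) /GRing.scale /=; ring.
    by apply: diff_derivable; exact: differentiable_comp1 dg db.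
  move=> f1 f2 b1 C1 b2 C2.
  rewrite (_ : 'D_v _ = fun y => 'D_v f1 y + 'D_v f2 y); first exact: Bump_add.
  apply/funext => y; apply: (@deriveD _ _ _ f1 f2);
    by apply: diff_derivable; exact: bump_sum_differentiable sg _.
- rewrite (_ : (fun y => _) = fun y => 1 * exp_bump m (g y)).
    by apply: Bump_mul; exact: smooth_cst.
  by apply/funext => y; rewrite mul1r.
Qed.

(** The smooth transition from [0] on [t <= 0] to [1] on [1 <= t]. The denominator is positive
    because [t] and [1 - t] are never both non-positive. *)
Definition step t : R := exp_bump 0 t / (exp_bump 0 t + exp_bump 0 (1 - t)).

Lemma step_den_gt0 t : 0 < exp_bump 0 t + exp_bump 0 (1 - t).
Proof.
have [t0|t0] := leP t 0.
  by rewrite ltr_wpDl ?exp_bump_ge0 // exp_bump_gt0 //; lra.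
by rewrite ltr_pwDl ?exp_bump_ge0 // exp_bump_gt0.
Qed.

Lemma step0 t : t <= 0 -> step t = 0.
Proof. by move=> t0; rewrite /step exp_bump_le0 // mul0r. Qed.

Lemma step1 t : 1 <= t -> step t = 1.
Proof.
move=> t1; rewrite /step (@exp_bump_le0 _ _ (1 - t)) ?subr_le0 // addr0 divff //.
by rewrite lt0r_neq0 // exp_bump_gt0 //; lra.
Qed.

Lemma step_ge0 t : 0 <= step t.
Proof. by rewrite divr_ge0 ?exp_bump_ge0 // ltW // step_den_gt0. Qed.

Lemma step_le1 t : step t <= 1.
Proof.
by rewrite ler_pdivrMr ?step_den_gt0 // mul1r lerDl exp_bump_ge0.
Qed.

Lemma smooth_step g : smooth g -> smooth (fun y => step (g y)).
Proof.
move=> sg; apply: smoothM; first exact: smooth_exp_bump.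
apply: smooth_inv; last by move=> y; rewrite lt0r_neq0 // step_den_gt0.
apply: smoothD; first exact: smooth_exp_bump.
by apply: smooth_exp_bump; apply: smoothB => //; exact: smooth_cst.
Qed.

Lemma exp_bump_continuous m : continuous (@exp_bump R m).
Proof.
move=> t; apply: differentiable_continuous; apply/derivable1_diffP.
by case: (exp_bump_derive m t).
Qed.

(** The uniform bound means that a cutoff with argument rescaled by a factor has its gradient
    multiplied by at most that factor, up to a constant; the vanishing outside [[0, 1]] confines
    this gradient to the transition layer. *)
Lemma step_derive : exists (ds : R -> R) (C : R), [/\
  forall t, is_derive t 1 step (ds t), forall t, `|ds t| <= C &
  forall t, t < 0 \/ 1 < t -> ds t = 0].
Proof.
pose e m t := @exp_bump R m t.
pose den t := e 0 t + e 0 (1 - t).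
have den0 t : den t != 0 by rewrite lt0r_neq0 // step_den_gt0.
pose ds t := (e 2 t * den t - e 0 t * (e 2 t - e 2 (1 - t))) / den t ^+ 2.
have de t : is_derive t 1 (e 0%N) (e 2%N t).
  by have := exp_bump_derive 0 t; rewrite oppr0 mul0r add0r.
have de1 t : is_derive t 1 (fun t => e 0%N (1 - t)) (- e 2%N (1 - t)).
  have df : is_derive t 1 (fun t : R => 1 - t) (-1).
    have := @is_deriveB R R R (cst (1 : R)) id t 1 0 1 (is_derive_cst _ _ _) (is_derive_id _ _).
    by rewrite sub0r.
  have df' : differentiable (fun t : R => 1 - t) t.
    by apply/derivable1_diffP; case: df.
  split.
    by apply/derivable1_diffP; exact: (differentiable_comp1 df' (de (1 - t))).
  rewrite (derive_comp1 (1 : R) df' (de (1 - t))).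
  by rewrite (@derive_val _ _ _ _ _ _ _ df) mulrN1.
have dden t : is_derive t 1 den (e 2%N t - e 2%N (1 - t)).
  exact: (@is_deriveD _ _ _ _ _ _ _ _ _ (de t) (de1 t)).
have dst t : is_derive t 1 step (ds t).
  have dV : is_derive t 1 (fun t => (den t)^-1)
      (- (den t) ^- 2 * (e 2%N t - e 2%N (1 - t))).
    have [d1 d2] := dden t; split; first exact: derivableV.
    by rewrite deriveV // d2.
  have h := @is_deriveM _ _ _ _ _ _ _ _ (de t) dV.
  apply: (is_derive_eq h); rewrite /GRing.scale /= /ds.
  by field.
have dsc : continuous ds.
  have ce m : continuous (e m) by exact: exp_bump_continuous.
  have ce1 m : continuous (fun t => e m (1 - t)).
    move=> t; apply: (@continuous_comp _ _ _ (fun t => 1 - t) (e m)); last exact: ce.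
    apply: (@continuousB R R R (cst (1 : R)) id t).
      exact: (@cst_continuous _ _ _ t).
    exact: cvg_id.
  have cden : continuous den.
    by move=> t; apply: (@continuousD _ _ _ (e 0%N)); [exact: ce|exact: ce1].
  move=> t; rewrite /ds; apply: cvgM.
    apply: cvgB; first by apply: cvgM; [exact: ce|exact: cden].
    apply: cvgM; first exact: ce.
    by apply: cvgB; [exact: ce|exact: ce1].
  apply: cvgV; first by rewrite expf_neq0.
  by apply: cvgM; exact: cden.
have ds0 t : t < 0 \/ 1 < t -> ds t = 0.
  rewrite /ds /den; case=> h.
    have -> : e 2%N t = 0 by rewrite /e exp_bump_le0 // ltW.
    have -> : e 0%N t = 0 by rewrite /e exp_bump_le0 // ltW.
    by rewrite !mul0r subr0 mul0r.
  have -> : e 2%N (1 - t) = 0 by rewrite /e exp_bump_le0 // subr_le0 ltW.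
  have -> : e 0%N (1 - t) = 0 by rewrite /e exp_bump_le0 // subr_le0 ltW.
  by rewrite addr0 subr0 (mulrC (e 2%N t)) subrr mul0r.
have /compact_bounded[M [_ hM]] : compact (ds @` `[0, 1]%classic).
  apply: continuous_compact; first exact: continuous_subspaceT.
  exact: segment_compact.
exists ds, (`|M| + 1); split=> // t.
have [/ds0->|t01] := pselect (t < 0 \/ 1 < t); first by rewrite normr0 addr_ge0.
apply: (hM (`|M| + 1)); first by rewrite (le_lt_trans (ler_norm _)) // ltrDl.
exists t => //=; rewrite in_itv /= !leNgt; apply/andP; split; apply/negP => h;
  by apply: t01; first [by left|by right].
Qed.

End step_function.

(** * Integration by parts on R^n and on half-spaces *)

Section compact_smooth.
Variables (R : realType) (n : nat).
Local Notation vec := 'rV[R]_n.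
Local Notation mu := (lebesgue_rV R n).
Implicit Types (f g : vec -> R) (x y z v N : vec) (t : R).

Definition compact_smooth f := smooth f /\
  exists2 K : set vec, compact K & forall y, ~ K y -> f y = 0.

Lemma derive_eq0 f (K : set vec) v y : closed K ->
  (forall z, ~ K z -> f z = 0) -> ~ K y -> 'D_v f y = 0.
Proof.
move=> cK fK Ky; rewrite -(derive_cst (0 : R) y v); apply: near_eq_derive.
have oK : open (~` K) by exact: closed_openC.
by near=> z; rewrite fK //; near: z; exact: open_nbhs_nbhs.
Unshelve. all: by end_near. Qed.

Lemma compact_closed_rV (K : set vec) : compact K -> closed K.
Proof. by apply: compact_closed; exact: norm_hausdorff. Qed.

Lemma compact_smooth_derive f v : compact_smooth f -> compact_smooth ('D_v f).
Proof.
move=> [sf [K cK fK]]; split; first exact: smooth_derive.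
exists K => // y Ky; apply: derive_eq0 Ky => //; exact: compact_closed_rV.
Qed.

Lemma compact_smooth_bounded f : compact_smooth f -> bounded_support f.
Proof.
move=> [sf [K cK fK]]; apply: continuous_bounded_support cK fK.
exact: smooth_continuous.
Qed.

Lemma compact_smoothM f g : compact_smooth f -> smooth g ->
  compact_smooth (fun y => f y * g y).
Proof.
move=> [sf [K cK fK]] sg; split; first exact: smoothM.
by exists K => // y /fK ->; rewrite mul0r.
Qed.

Lemma compact_smoothMl f g : smooth f -> compact_smooth g ->
  compact_smooth (fun y => f y * g y).
Proof. by move=> sf cg; under eq_fun do rewrite mulrC; exact: compact_smoothM. Qed.

Lemma compact_smooth_sum (I : finType) (F : I -> vec -> R) :
  (forall i, compact_smooth (F i)) -> compact_smooth (fun y => \sum_i F i y).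
Proof.
move=> cF; split; first by apply: smooth_sum => i _; case: (cF i).
have /choice[K hK] : forall i, exists K : set vec, compact K /\ forall y, ~ K y -> F i y = 0.
  by move=> i; have [_ [K cK FK]] := cF i; exists K.
exists (\big[setU/set0]_i K i).
  by apply: big_ind => //; [exact: compact0|move=> A B; exact: compactU|move=> i _; case: (hK i)].
move=> y; rewrite -bigcup_seq => Ky; rewrite big1 // => i _.
by apply: (hK i).2 => Kiy; apply: Ky; exists i => //=; rewrite mem_index_enum.
Qed.

Lemma compact_smoothD f g : compact_smooth f -> compact_smooth g ->
  compact_smooth (fun y => f y + g y).
Proof.
move=> [sf [K cK fK]] [sg [K' cK' gK']]; split; first exact: smoothD.
exists (K `|` K'); first exact: compactU.
move=> y /not_orP[/fK-> /gK' ->]; exact: addr0.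
Qed.

Lemma compact_smoothB f g : compact_smooth f -> compact_smooth g ->
  compact_smooth (fun y => f y - g y).
Proof.
move=> cf cg; apply: compact_smoothD => //.
under eq_fun do rewrite -mulN1r.
by apply: compact_smoothMl => //; exact: smooth_cst.
Qed.

Lemma derive_line f y v t : derivable f (y + t *: v) v ->
  is_derive t 1 (fun t => f (y + t *: v)) ('D_v f (y + t *: v)).
Proof.
rewrite /derivable => df.
have E : (fun h : R => h^-1 *: (((fun t => f (y + t *: v)) \o shift t) (h *: (1 : R)) - f (y
  + t *: v)))
    = (fun h : R => h^-1 *: ((f \o shift (y + t *: v)) (h *: v) - f (y + t *: v))).
  apply/funext => h; congr (_ *: (f _ - _)).
  by rewrite /= [h%:A](mulr1 h) scalerDl addrCA.
by split; rewrite /derivable /derive E.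
Qed.

(** The mean value theorem along a line. It gives the majorant of the difference quotients, and
    later the linear decay of a function near a hyperplane on which it vanishes. *)
Lemma line_le f v : compact_smooth f -> exists M, 0 <= M /\ forall y t, 0 <= t ->
  `|f (y + t *: v) - f y| <= M * t.
Proof.
move=> cf; have [sf _] := cf.
have [_ [M hM]] := compact_smooth_bounded (compact_smooth_derive v cf).
exists `|M|; split => // y t; rewrite le_eqVlt => /predU1P[<-|t0].
  by rewrite scale0r addr0 subrr normr0 mulr0.
have dl (s : R) : is_derive s 1 (fun t => f (y + t *: v)) ('D_v f (y + s *: v)).
  by apply: derive_line; exact: smooth_derivable.
have [|c _ hc] := @MVT R (fun t => f (y + t *: v)) (fun t => 'D_v f (y + t *: v))
    0 t t0 (fun s _ => dl s).
  apply: continuous_subspaceT => s; apply: differentiable_continuous.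
  by apply/derivable1_diffP; case: (dl s).
move: hc; rewrite scale0r addr0 subr0 => ->.
rewrite normrM (gtr0_norm t0) ler_pM2r // (le_trans (hM _).1) //.
exact: ler_norm.
Qed.

Lemma quotient_cvg f v y : smooth f ->
  m.+1%:R * (f (y + m.+1%:R^-1 *: v) - f y) @[m --> \oo] --> 'D_v f y.
Proof.
move=> sf; have /cvg_ex[l hl] := @smooth_derivable R n f y v sf.
have -> : 'D_v f y = l by apply: cvg_lim.
have h0 : m.+1%:R^-1 @[m --> \oo] --> (0 : R)^'.
  move=> P P0; have h := @cvg_harmonic R _ P0.
  apply: (@filterS _ \oo _ (fun m => harmonic m != 0 -> P (harmonic m))) h.
  by move=> m; apply; rewrite /= invr_eq0 pnatr_eq0.
have := cvg_comp _ _ h0 hl; apply: cvg_trans; apply: near_eq_cvg.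
by apply: nearW => m; rewrite /= invrK; congr (_ * (f _ - _)); exact: addrC.
Qed.

Lemma quotient_int_cvg f v (H : set vec) : compact_smooth f -> measurable H ->
  \int[mu]_(y in H) (m.+1%:R * (f (y + m.+1%:R^-1 *: v) - f y)) @[m --> \oo] -->
  \int[mu]_(y in H) 'D_v f y.
Proof.
move=> cf mH; have [sf _] := cf; have [mf [B hB]] := compact_smooth_bounded cf.
have [M [M0 hM]] := line_le v cf.
(* [M] bounds the quotients, and a shift of length at most [|v|] enlarges the support radius [|B|]
   by at most [|v|]; the sum covers both uses of the constant. *)
apply: (@bounded_support_cvg _ _ _ _ _ (M + `|B| + `|v|)) => //.
- move=> m; apply: measurable_funM => //; apply: measurable_funB => //.
  by apply: measurableT_comp => //; exact: measurable_rV_shift.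
- by case: (compact_smooth_bounded (compact_smooth_derive v cf)).
- move=> m y; split.
    rewrite normrM ger0_norm // (@le_trans _ _ M) //; last by rewrite -addrA lerDl addr_ge0.
    by rewrite mulrC -ler_pdivlMr ?hM // invr_ge0.
  move=> hy; have hBy : B < `|y|.
    apply: le_lt_trans hy; rewrite (le_trans (ler_norm B)) //.
    by rewrite addrAC lerDr addr_ge0.
  rewrite (hB y).2 // (hB (y + _)).2 ?subrr ?mulr0 //.
  have h1 : `|m.+1%:R^-1 *: v| <= `|v|.
    by rewrite normrZ ler_piMl // ger0_norm ?invr_ge0 // invf_le1 // ler1n.
  have h2 : `|y| - `|v| <= `|y + m.+1%:R^-1 *: v|.
    rewrite lerBlDr -[X in `|X| <= _](addrK (m.+1%:R^-1 *: v)).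
    by apply: (le_trans (ler_normB _ _)); rewrite lerD2l.
  apply: lt_le_trans h2; rewrite ltrBrDr; apply: le_lt_trans hy.
  by rewrite lerD2r (le_trans (ler_norm B)) // lerDr.
- by apply: nearW => y _; exact: quotient_cvg.
Qed.

Lemma int_quotient f v (H : set vec) t : bounded_support f -> measurable H ->
  \int[mu]_(y in H) (f (y + t *: v) - f y) =
  \int[mu]_(y in (fun y => y - t *: v) @^-1` H) f y - \int[mu]_(y in H) f y.
Proof.
move=> bf mH.
have mH' : measurable ((fun y => y - t *: v) @^-1` H).
  by rewrite -[X in measurable X]setTI; apply: measurable_rV_shift.
rewrite -(Rintegral_shift (t *: v) mH' bf).
rewrite (_ : _ @^-1` _ = H); last first.
  by apply/seteqP; split=> y /=; rewrite addrK.
apply: RintegralB => //; last exact: bounded_support_integrable.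
apply: bounded_support_integrable => //.
exact: bounded_support_shift.
Qed.

(** Translation invariance makes the integral of every difference quotient vanish when [H] is
    invariant in the direction [v]; dominated convergence passes to the derivative. *)
Lemma int_derive_invariant f v (H : set vec) : compact_smooth f -> measurable H ->
  (forall t y, H (y - t *: v) <-> H y) -> \int[mu]_(y in H) 'D_v f y = 0.
Proof.
move=> cf mH Hv; have bf := compact_smooth_bounded cf.
have h := quotient_int_cvg (v := v) cf mH; rewrite -(cvg_lim (@norm_hausdorff _ R) h).
have -> : (fun m => \int[mu]_(y in H) (m.+1%:R * (f (y + m.+1%:R^-1 *: v) - f y))) = fun=> 0.
  apply/funext => m; have E := int_quotient v m.+1%:R^-1 bf mH.
  rewrite RintegralZl // ?E.
    rewrite (_ : _ @^-1` _ = H) ?subrr ?mulr0 //.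
    by apply/seteqP; split=> y /=; apply Hv.
  apply: bounded_support_integrable => //; apply: bounded_supportB => //.
  exact: bounded_support_shift.
by rewrite lim_cst.
Qed.

Lemma int_derive f v : compact_smooth f -> \int[mu]_y 'D_v f y = 0.
Proof. by move=> cf; apply: int_derive_invariant. Qed.

Lemma halfspace_measurable c N : measurable [set y | 0 < c + dot N y].
Proof.
apply: measurable_lt => //; apply: continuous_rV_measurable.
by apply: affine_continuous; exists c, N.
Qed.

Lemma strip_measurable c N t : measurable [set y | 0 < c + dot N y <= t].
Proof.
rewrite (_ : mkset _ = [set y | 0 < c + dot N y] `&` [set y | c + dot N y <= t]).
  apply: measurableI; first exact: halfspace_measurable.
  apply: measurable_le => //; apply: continuous_rV_measurable.
  by apply: affine_continuous; exists c, N.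
by apply/seteqP; split=> y /=; [move=> /andP[]|move=> [-> ->]].
Qed.

(** Shifting the half-space by [t N] removes a strip on which [c + dot N y] runs up to
    [t * dot N N]. The rescaled strip integrals stand in for the boundary integral of [f] over the
    hyperplane. *)
Lemma strip_int_cvg f c N : compact_smooth f ->
  \int[mu]_(y in [set y | (0 < c + dot N y <= m.+1%:R^-1 * dot N N)%R])
    (m.+1%:R * f y) @[m --> \oo] -->
  - \int[mu]_(y in [set y | (0 < c + dot N y)%R]) 'D_N f y.
Proof.
move=> cf; have bf := compact_smooth_bounded cf; have mH := halfspace_measurable c N.
have h := quotient_int_cvg (v := N) cf mH.
apply: cvg_trans (cvgN h); apply: near_eq_cvg; apply: nearW => m /=.
rewrite !fctE; set t := m.+1%:R^-1.
have iD D : measurable D -> mu.-integrable D (EFin \o f).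
  by move=> mD; exact: bounded_support_integrable.
rewrite RintegralZl //; last first.
  apply: bounded_support_integrable => //; apply: bounded_supportB => //.
  exact: bounded_support_shift.
rewrite (int_quotient N t bf mH) RintegralZl //; last 2 first.
- exact: strip_measurable.
- by apply: iD; exact: strip_measurable.
rewrite -mulrN opprB; congr (_ * _).
have mH' : measurable ((fun y => y - t *: N) @^-1` [set y | 0 < c + dot N y]).
  by rewrite -[X in measurable X]setTI; apply: measurable_rV_shift.
have mS := strip_measurable c N (t * dot N N).
have N0 : 0 <= t * dot N N.
  rewrite mulr_ge0 ?invr_ge0 //; have [->|/dot_gt0/ltW//] := eqVneq N 0.
  by rewrite dot0r.
apply/eqP; rewrite subr_eq; apply/eqP.
rewrite -Rintegral_setU //; last 2 first.
- by apply: iD; exact: measurableU.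
- apply/disj_setPS => y [/= /andP[_ h1]]; rewrite dotBr dotZr; lra.
congr (Rintegral _ _ _); apply/seteqP; split=> y /=; rewrite dotBr dotZr.
  by move=> ly; have [le|gt] := leP (c + dot N y) (t * dot N N);
    [left; rewrite ly|right; lra].
by case=> [/andP[]|]//; lra.
Qed.

Lemma halfspace_derive_le0 f c N : compact_smooth f -> (forall y, 0 <= f y) ->
  \int[mu]_(y in [set y | (0 < c + dot N y)%R]) 'D_N f y <= 0.
Proof.
move=> cf f0; rewrite -oppr_ge0; apply: (cvgr_to_ge (strip_int_cvg (c := c) (N := N) cf)).
by apply: nearW => m; apply: Rintegral_ge0 => y _; rewrite mulr_ge0.
Qed.

(** A function vanishing on the hyperplane is [O(1 / m)] on the strip, so [m f] stays bounded there
    while the strips shrink pointwise to the empty set. *)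
Lemma halfspace_derive_eq0 f c N : compact_smooth f -> N != 0 ->
  (forall y, c + dot N y = 0 -> f y = 0) ->
  \int[mu]_(y in [set y | (0 < c + dot N y)%R]) 'D_N f y = 0.
Proof.
move=> cf N0 f0; have bf := compact_smooth_bounded cf.
have [mf [B hB]] := bf.
have NN := dot_gt0 N0.
have [M [M0 hM]] := line_le N cf.
have h := strip_int_cvg (c := c) (N := N) cf.
have h0 : \int[mu]_(y in [set y | (0 < c + dot N y <= m.+1%:R^-1 * dot N N)%R])
    (m.+1%:R * f y) @[m --> \oo] --> (0 : R).
  rewrite -[X in _ --> X](mul0r (fine (mu setT))) -(Rintegral_cst mu measurableT).
  rewrite (_ : (fun m => _) = fun m => \int[mu]_y
      (\1_[set y | 0 < c + dot N y <= m.+1%:R^-1 * dot N N] y * (m.+1%:R * f y))).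
    2: by apply/funext => m; rewrite Rintegral_indic //; exact: strip_measurable.
  apply: (@bounded_support_cvg _ _ _ _ _ (M + `|B|)) => //.
  - move=> m; apply: measurable_funM; last exact: measurable_funM.
    by apply: measurable_indic; exact: strip_measurable.
  - move=> m y; split; last first.
      move=> hy; rewrite (hB y).2 ?mulr0 //; apply: le_lt_trans hy.
      by rewrite (le_trans (ler_norm B)) // lerDr.
    rewrite indicE; have [|_] := boolP (_ \in _); last first.
      by rewrite mul0r normr0 addr_ge0.
    rewrite inE /= => /andP[l0 l1]; rewrite mul1r normrM ger0_norm //.
    rewrite (@le_trans _ _ M) ?lerDl // mulrC -ler_pdivlMr //.
    (* [y - s N] is the foot of [y] on the hyperplane, and [s <= 1 / (m + 1)] on the strip. *)
    pose s := (c + dot N y) / dot N N.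
    have s0 : 0 <= s by rewrite divr_ge0 // ltW.
    have fz : f (y - s *: N) = 0.
      by apply: f0; rewrite dotBr dotZr divfK ?lt0r_neq0 //; ring.
    have := hM (y - s *: N) s s0; rewrite subrK fz subr0 => /le_trans; apply.
    by rewrite ler_wpM2l // ler_pdivrMr.
  - apply: nearW => y _; apply: (@cvg_trans _ ((fun=> 0) @ \oo)); last exact: cvg_cst.
    apply: near_eq_cvg; have [l0|l0] := leP (c + dot N y) 0.
      by apply: nearW => m; rewrite indicE memNset ?mul0r //= => /andP[]; rewrite ltNge l0.
    have ll : 0 < (c + dot N y) / dot N N by rewrite divr_gt0.
    have := near_infty_natSinv_lt (PosNum ll); apply: filterS => m /=.
    rewrite ltr_pdivlMr // => hm; rewrite indicE memNset ?mul0r //= => /andP[_].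
    by rewrite leNgt hm.
apply: oppr_inj; rewrite oppr0 -(cvg_lim (@norm_hausdorff _ R) h).
exact: cvg_lim h0.
Qed.

Lemma Rintegral_sum_bounded (I : Type) (s : seq I) (P : pred I)
    (F : I -> vec -> R) (D : set vec) : measurable D ->
  (forall i, P i -> bounded_support (F i)) ->
  \int[mu]_(y in D) (\sum_(i <- s | P i) F i y) =
  \sum_(i <- s | P i) \int[mu]_(y in D) F i y.
Proof.
move=> mD bF; elim: s => [|i s IH].
  under eq_Rintegral do rewrite big_nil.
  by rewrite big_nil Rintegral_cst // mul0r.
under eq_Rintegral do rewrite big_cons.
rewrite big_cons; case Pi: (P i) => //.
rewrite RintegralD ?IH //; apply: bounded_support_integrable => //.
  exact: bF.
exact: bounded_support_sum.
Qed.

(** Each coordinate direction splits as [a N + u] with [u] parallel to the hyperplane. The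
    half-space is invariant along [u], so that part integrates to [0] and only the normal component
    of the field survives. *)
Lemma halfspace_div (X : 'I_n -> vec -> R) c N : N != 0 ->
  (forall i, compact_smooth (X i)) ->
  \int[mu]_(y in [set y | (0 < c + dot N y)%R])
    (\sum_i 'D_(delta_mx ord0 i) (X i) y) =
  (dot N N)^-1 * \int[mu]_(y in [set y | (0 < c + dot N y)%R])
     'D_N (fun y => \sum_i N ord0 i * X i y) y.
Proof.
move=> N0 cX; have NN := dot_gt0 N0; have mH := halfspace_measurable c N.
have sX i : smooth (X i) by case: (cX i).
have bD i v : bounded_support ('D_v (X i)).
  exact/compact_smooth_bounded/compact_smooth_derive.
rewrite [in RHS](@eq_Rintegral _ _ _ mu _
  (fun y => \sum_i 'D_N (fun y => N ord0 i * X i y) y)); last first.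
  by move=> y _; rewrite derive_bigsum // => i _; exact: smoothZ.
rewrite !Rintegral_sum_bounded //; last first.
  move=> i _; apply: compact_smooth_bounded; apply: compact_smooth_derive.
  by apply: compact_smoothMl => //; exact: smooth_cst.
rewrite mulr_sumr; apply: eq_bigr => i _.
rewrite (@eq_Rintegral _ _ _ mu _ (fun y => N ord0 i * 'D_N (X i) y)
  (fun y => 'D_N (fun y => N ord0 i * X i y) y)); last first.
  by move=> y _; rewrite derive_mulr.
rewrite RintegralZl //; last exact: bounded_support_integrable.
pose a := (dot N N)^-1 * N ord0 i; pose u := delta_mx ord0 i - a *: N.
rewrite mulrA -/a.
have uH : \int[mu]_(y in [set y | (0 < c + dot N y)%R]) 'D_u (X i) y = 0.
  apply: int_derive_invariant => // t y /=.
  rewrite dotBr dotZr dotBr dotZr dot_delta /a mulrAC mulVf ?lt0r_neq0 //.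
  by rewrite mul1r subrr mulr0 subr0.
rewrite -[LHS]subr0 -[X in _ - X = _]uH.
rewrite -RintegralB //; [|exact: bounded_support_integrable..].
rewrite -RintegralZl //; last exact: bounded_support_integrable.
apply: eq_Rintegral => y _.
by rewrite /u -scaleNr derive_dir //; ring.
Qed.

End compact_smooth.

(** * Geometry of simplices and of the mesh *)

Section barycentric.
Variables (R : realType) (n : nat).
Local Notation vec := 'rV[R]_n.
Implicit Types (T S : {fset vec}) (a b x y : vec).

(** The first argument of [L] is the vertex and the second the point. The last clause extends the
    family by [0] to non-vertices, so that the nodal function of a fixed [x] makes sense on every
    element. *)
Definition bary_spec T (L : vec -> vec -> R) : Prop :=
  [/\ forall a, affine (L a),
      forall a b, b \in T -> L a b = (a == b)%:R,
      forall y, \sum_(a <- T) L a y = 1,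
      forall y, \sum_(a <- T) L a y *: a = y &
      forall a y, a \notin T -> L a y = 0].

(** Affine independence says that the matrix of vertices with a column of ones appended is
    invertible; the coordinates of [y] are the row [(y, 1)] times its inverse. *)
Lemma bary_exists T : simplex n T -> exists L, bary_spec T L.
Proof.
move=> [cardT indT]; pose s : seq vec := T.
have szs : size s = (n + 1)%N by rewrite addn1 -cardT.
have us : uniq s by exact: fset_uniq.
have sumE (V : nmodType) (F : vec -> V) :
    \sum_(a <- T) F a = \sum_(i < n + 1) F s`_i.
  by rewrite (big_nth 0) big_mkord -/s szs.
pose A : 'M[R]_(n + 1, n) := \matrix_(i, j) (s`_i) ord0 j.
pose M : 'M[R]_(n + 1) := row_mx A (const_mx 1).
have rowA (v : 'rV[R]_(n + 1)) : v *m A = \sum_i v ord0 i *: s`_i.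
  by apply/rowP => j; rewrite mxE summxE; apply: eq_bigr => i _; rewrite !mxE.
have row1 (v : 'rV[R]_(n + 1)) : v *m (const_mx 1 : 'cV[R]_(n + 1)) =
    (\sum_i v ord0 i)%:M.
  apply/rowP => j; rewrite (ord1 j) !mxE mulr1n; apply: eq_bigr => i _.
  by rewrite mxE mulr1.
have sdelta (v : 'I_(n + 1) -> R) (j : 'I_(n + 1)) :
    \sum_i v i * (s`_i == s`_j)%:R = v j.
  rewrite (bigD1 j) //= eqxx mulr1 big1 ?addr0 // => i ij.
  by rewrite nth_uniq ?szs // val_eqE (negPf ij) mulr0.
have Mu : M \in unitmx.
  rewrite -row_free_unit; apply: inj_row_free => v.
  rewrite mul_mx_row -[X in _ = X]row_mx0 => /eq_row_mx[].
  rewrite rowA row1 => vA v1.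
  pose w x := \sum_i v ord0 i * (s`_i == x)%:R.
  have wE (i : 'I_(n + 1)) : w s`_i = v ord0 i by exact: sdelta.
  apply/rowP => i; rewrite mxE -wE; apply: indT.
  - rewrite sumE; under eq_bigr do rewrite wE.
    by have /rowP/(_ ord0) := v1; rewrite !mxE mulr1n.
  - by rewrite sumE; under eq_bigr do rewrite wE.
  - by apply: mem_nth; rewrite szs.
pose C (y : vec) : 'rV[R]_(n + 1) := row_mx y 1%:M *m invmx M.
have CE y : y = \sum_i C y ord0 i *: s`_i /\ \sum_i C y ord0 i = 1.
  have : C y *m M = row_mx y 1%:M by rewrite /C mulmxKV.
  rewrite mul_mx_row rowA row1 => /eq_row_mx[-> /rowP/(_ ord0)].
  by rewrite !mxE !mulr1n.
have Cs (j : 'I_(n + 1)) : C s`_j = delta_mx ord0 j.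
  have E : row_mx s`_j 1%:M = delta_mx ord0 j *m M.
    rewrite -rowE row_row_mx; congr row_mx; first by apply/rowP => i; rewrite !mxE.
    by apply/rowP => i; rewrite (ord1 i) !mxE.
  by rewrite /C E mulmxK.
have affC i : affine (fun y => C y ord0 i).
  exists (invmx M (rshift n ord0) i), (\row_j invmx M (lshift 1 j) i) => y.
  rewrite mxE big_split_ord /= addrC big_ord1; congr (_ + _).
    by rewrite row_mxEr mxE eqxx mul1r.
  by rewrite /dot; apply: eq_bigr => j _; rewrite row_mxEl mxE mulrC.
exists (fun a y => \sum_i C y ord0 i * (s`_i == a)%:R); split.
- move=> a; apply: affine_sum => i _; under eq_fun do rewrite mulrC.
  exact: affineZ.
- move=> a b bT.
  have [j jn <-] : exists2 j, (j < n + 1)%N & s`_j = b.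
    by exists (index b s); [rewrite -szs index_mem|exact: nth_index].
  rewrite (Cs (Ordinal jn)) (bigD1 (Ordinal jn)) //= mxE !eqxx mul1r eq_sym.
  by rewrite big1 ?addr0 // => i ij; rewrite mxE eqxx (negPf ij) mul0r.
- by move=> y; rewrite sumE; under eq_bigr do rewrite sdelta; case: (CE y).
- move=> y; rewrite sumE; under eq_bigr do rewrite sdelta.
  by case: (CE y) => <-.
- move=> a y aT; rewrite big1 // => i _; case: eqP => [E|]; last by rewrite mulr0.
  by move: aT; rewrite -E => /negP[]; apply: mem_nth; rewrite szs.
Qed.

Definition bary T : vec -> vec -> R := xget (fun _ _ => 0) [set L | bary_spec T L].

Lemma baryP T : simplex n T -> bary_spec T (bary T).
Proof. by move=> /bary_exists[L hL]; rewrite /bary; exact: (xgetPex _ (ex_intro _ L hL)). Qed.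

Lemma affine_comb (S : {fset vec}) (f : vec -> R) (w : vec -> R) : affine f ->
  \sum_(a <- S) w a = 1 ->
  f (\sum_(a <- S) w a *: a) = \sum_(a <- S) w a * f a.
Proof.
move=> [c [N fE]] w1; rewrite fE.
have -> : dot N (\sum_(a <- S) w a *: a) = \sum_(a <- S) w a * dot N a.
  elim/big_ind2: _ => [|x x' y y' <- <-|a _]; [exact: dot0r|exact: dotDr|exact: dotZr].
rewrite -[c]mul1r -{1}w1 mulr_suml -big_split; apply: eq_bigr => a _.
by rewrite fE mulrDr.
Qed.

Lemma affine_bary T f y : simplex n T -> affine f ->
  f y = \sum_(a <- T) bary T a y * f a.
Proof.
move=> sT af; have [_ _ b1 bE _] := baryP sT.
by rewrite -(affine_comb af (b1 y)) bE.
Qed.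

Lemma affine_eq0 T f y : simplex n T -> affine f ->
  (forall a, a \in T -> f a = 0) -> f y = 0.
Proof.
move=> sT af f0; rewrite (affine_bary y sT af) big_seq big1 // => a aT.
by rewrite f0 // mulr0.
Qed.

Lemma fset_sum_delta (S : {fset vec}) (w : vec -> R) b : b \in S ->
  \sum_(a <- S) w a * (b == a)%:R = w b.
Proof.
move=> bS; rewrite (bigD1_seq b) //= ?fset_uniq // eqxx mulr1 big1_seq ?addr0 //.
by move=> a /andP[ab _]; rewrite eq_sym (negPf ab) mulr0.
Qed.

Lemma conv_hullE T : simplex n T ->
  conv_hull T = [set y | forall a, a \in T -> 0 <= bary T a y].
Proof.
move=> sT; have [ba bd b1 bE _] := baryP sT.
apply/seteqP; split=> y; last first.
  by move=> y0; exists (bary T ^~ y); split=> //; rewrite bE.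
move=> [w [w0 w1 ->]] b bT; rewrite affine_comb // big_seq.
by apply: sumr_ge0 => a aT; rewrite bd // mulr_ge0 ?w0 // ler0n.
Qed.

Lemma conv_hull_sub T S y a : simplex n T -> (S `<=` T)%fset -> conv_hull S y ->
  a \notin S -> bary T a y = 0.
Proof.
move=> sT /fsubsetP ST [w [w0 w1 ->]] aS; have [ba bd _ _ _] := baryP sT.
rewrite affine_comb // big_seq big1 // => b bS; rewrite bd ?ST //.
by case: eqP => [E|]; rewrite ?mulr0 //; move: aS; rewrite E bS.
Qed.

Definition inner T : set vec := [set y | forall a, a \in T -> 0 < bary T a y].

Lemma inner_conv_hull T y : simplex n T -> inner T y -> conv_hull T y.
Proof. by move=> sT; rewrite conv_hullE // => h a aT; exact/ltW/h. Qed.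

Lemma filter_all_seq (I : eqType) (U : Type) (F : set_system U) (s : seq I)
    (P : I -> U -> Prop) : Filter F -> (forall i, i \in s -> F (P i)) ->
  F [set y | forall i, i \in s -> P i y].
Proof.
move=> FF; elim: s => [|i s IH] h; first exact: filterE.
have h1 : F (P i) by apply: h; rewrite mem_head.
have h2 : F [set y | forall i, i \in s -> P i y].
  by apply: IH => j js; apply: h; rewrite in_cons js orbT.
apply: filterS (filterI h1 h2) => y [y1 y2] j.
by rewrite in_cons => /predU1P[->|/y2].
Qed.

Lemma affine_near_gt0 (f : vec -> R) z : affine f -> 0 < f z -> \forall y \near z, 0 < f y.
Proof.
by move=> /affine_continuous/(_ z) cf f0; exact: (cvgr_gt (f z) cf).
Qed.

Lemma inner_near T z : simplex n T -> inner T z -> \forall y \near z, inner T y.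
Proof.
move=> sT Tz; have [ba _ _ _ _] := baryP sT.
apply: filter_all_seq => a aT; apply: affine_near_gt0 => //; exact: Tz.
Qed.

Lemma inner_open T : simplex n T -> open (inner T).
Proof. by move=> sT; rewrite openE => z Tz; exact: inner_near. Qed.

Lemma conv_hull_closed T : simplex n T -> closed (conv_hull T).
Proof.
move=> sT; rewrite -[X in closed X]setCK; apply: open_closedC.
rewrite openE => z; rewrite /setC /= conv_hullE //= => /existsNP[a].
move=> /not_implyP[aT /negP]; rewrite -ltNge -oppr_gt0 => ha.
have [ba _ _ _ _] := baryP sT.
have := @affine_near_gt0 (fun y => -1 * bary T a y) z (affineZ _ (ba a)).
rewrite mulN1r => /(_ ha); apply: filterS => y; rewrite mulN1r => hy h.
by have := h a aT; rewrite leNgt -oppr_gt0 hy.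
Qed.

Lemma simplex_size T : simplex n T -> size T = n.+1.
Proof. by case. Qed.

Lemma inner_nonempty T : simplex n T -> exists y, inner T y.
Proof.
move=> sT; have [ba bd _ _ _] := baryP sT.
exists (\sum_(a <- T) n.+1%:R^-1 *: a) => b bT.
rewrite affine_comb //; last first.
  rewrite big_const_seq count_predT simplex_size // iter_addr addr0.
  by rewrite -[X in X *+ _]mulr1 -mulrnAr mulVf.
under eq_big_seq => a aT do rewrite bd //.
by rewrite (fset_sum_delta (fun=> n.+1%:R^-1)) // invr_gt0.
Qed.

Lemma fset_sub_card (A B : {fset vec}) : (A `<=` B)%fset -> #|` A| = #|` B| -> A = B.
Proof. by move=> AB E; apply/eqP; rewrite eqEfcard AB E leqnn. Qed.

Lemma inner_disjoint T1 T2 S y : simplex n T1 -> simplex n T2 ->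
  (S `<=` T1)%fset -> (S `<=` T2)%fset ->
  conv_hull T1 `&` conv_hull T2 = conv_hull S -> inner T1 y -> inner T2 y ->
  T1 = T2.
Proof.
move=> s1 s2 S1 S2 E y1 y2.
have Sy : conv_hull S y by rewrite -E; split; exact: inner_conv_hull.
have S1E : S = T1.
  apply/eqP; rewrite eqEfsubset S1; apply/fsubsetP => a aT; apply/negPn/negP => aS.
  by have := y1 a aT; rewrite (conv_hull_sub s1 S1 Sy aS) ltxx.
by move: S2; rewrite S1E => /fset_sub_card; apply; case: s1 s2 => -> _ [-> _].
Qed.

Lemma bary_nonconst T a : simplex n T -> (0 < n)%N -> a \in T ->
  exists c N, N != 0 /\ forall y, bary T a y = c + dot N y.
Proof.
move=> sT n0 aT; have [ba bd _ _ _] := baryP sT.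
have [c [N hN]] := ba a; exists c, N; split=> //; apply/eqP => N0.
have [b bT ba'] : exists2 b, b \in T & b != a.
  have : (0 < #|` (T `\ a)%fset|)%N.
    by have := cardfsD1 a T; rewrite aT; case: sT => -> _ /eqP; rewrite add1n eqSS => /eqP <-.
  by rewrite cardfs_gt0 => /fset0Pn[b]; rewrite in_fsetD1 => /andP[ba' bT]; exists b.
have : bary T a a = bary T a b by rewrite !hN N0 !(dotC 0) !dot0r.
by rewrite !bd // eqxx eq_sym (negPf ba') => /eqP; rewrite oner_eq0.
Qed.

Lemma conv_hull_inner_ae T : simplex n T -> (0 < n)%N ->
  {ae lebesgue_rV R n, forall y, conv_hull T y -> inner T y}.
Proof.
move=> sT n0.
have h a : a \in T -> {ae lebesgue_rV R n, forall y, bary T a y != 0}.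
  move=> aT; have [c [N [N0 hN]]] := bary_nonconst sT n0 aT.
  exists [set y | c + dot N y = 0]; split.
  - exact: hyperplane_measurable.
  - exact: hyperplane_null.
  - by move=> y /= /negP; rewrite negbK hN => /eqP.
have : {ae lebesgue_rV R n, forall y, forall a, a \in T -> bary T a y != 0}.
  exact: (filter_all_seq _ h).
apply: filterS => y hy; rewrite conv_hullE // => Ty a aT.
by rewrite lt_neqAle eq_sym hy // Ty.
Qed.

Lemma inner_measurable T : simplex n T -> measurable (inner T).
Proof. by move=> sT; apply: measurable_rV_open; exact: inner_open. Qed.

End barycentric.

(** * Points interior to elements or to common faces *)

Section facing.
Variables (R : realType) (n : nat).
Local Notation vec := 'rV[R]_n.
Implicit Types (T S : {fset vec}) (a b x y z : vec) (Th : {fset {fset vec}}).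

(** These are whole planes of codimension 2, not only the faces lying in them: the set is then
    covered by finitely many planes given by pairs of affine equations, which can be cut off one at
    a time. *)
Definition skeleton Th : set vec := [set z | exists T a b,
  [/\ T \in Th, a \in T, b \in T & [/\ a != b, bary T a z = 0 & bary T b z = 0]]].

(* [z] is interior to a common face of [T1] and [T2], which lie on the two sides
   of a hyperplane. The last clause is the conformity of the mesh, expressed
   through the barycentric coordinates. *)
Definition facing (Om : set vec) Th T1 T2 (c : R) (N z : vec) : Prop :=
  [/\ T1 \in Th, T2 \in Th, N != 0, c + dot N z = 0 &
    (\forall y \near z, Om y /\ ((0 < c + dot N y -> inner T1 y) /\
                                 (c + dot N y < 0 -> inner T2 y))) /\
    forall x,
      (forall y, c + dot N y = 0 -> bary T1 x y = bary T2 x y) /\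
      ([/\ x \in T1, x \in T2 & c + dot N x = 0] \/
       forall y, c + dot N y = 0 -> bary T1 x y = 0)].

(** If [z] is in no interior, then off the skeleton exactly one barycentric coordinate of an element
    containing [z] vanishes. A small step through the face where it vanishes enters a second
    element, and conformity forces the two to share precisely that face. *)
Lemma generic_point (Om : set vec) Th z : (0 < n)%N -> open Om ->
  simplicial_mesh Om Th -> Om z -> ~ skeleton Th z ->
  (exists2 T, T \in Th & inner T z) \/
  exists T1 T2 c N, facing Om Th T1 T2 c N z.
Proof.
move=> n0 oOm [sTh cov mesh] Omz skz.
(* There are finitely many elements and each is closed, so those missing [z] also miss a
   neighbourhood of [z]. *)
have covz : \forall y \near z, exists T, [/\ T \in Th, conv_hull T z & conv_hull T y].
  have h : \forall y \near z, forall T, T \in Th -> ~ conv_hull T z -> ~ conv_hull T y.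
    apply: filter_all_seq => T TTh; have [Tz|Tz] := pselect (conv_hull T z).
      by apply: (@filterE _ (nbhs z)) => y /(_ Tz).
    have := closed_openC (conv_hull_closed (sTh T TTh)).
    by rewrite openE => /(_ z Tz); apply: filterS => y hy _; exact: hy.
  have hOm : \forall y \near z, Om y by exact: open_nbhs_nbhs.
  apply: filterS (filterI h hOm) => y [hy Omy].
  have : closure Om y by exact: subset_closure.
  rewrite cov => -[T /= TTh Ty]; exists T; split=> //.
  by apply: contrapT => Tz; exact: hy T TTh Tz Ty.
have [T1 [T1Th T1z _]] := nbhs_singleton covz.
have s1 := sTh _ T1Th; have [ba1 bd1 b11 bE1 _] := baryP s1.
have [T1i|] := pselect (inner T1 z); first by left; exists T1.
move=> /existsNP[a] /not_implyP[aT1 /negP]; rewrite -leNgt => la.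
have ge1 : forall b, b \in T1 -> 0 <= bary T1 b z by move: T1z; rewrite conv_hullE.
have {la} la : bary T1 a z = 0 by apply/eqP; rewrite eq_le la ge1.
have gt1 b : b \in T1 -> b != a -> 0 < bary T1 b z.
  move=> bT ba; rewrite lt_neqAle eq_sym ge1 // andbT; apply/eqP => lb.
  by apply: skz; exists T1, a, b; split=> //; split; rewrite // eq_sym.
right; have [c [N [N0 lE]]] := bary_nonconst s1 n0 aT1.
have ly t : bary T1 a (z + t *: (a - z)) = t.
  by rewrite affine_line // la bd1 // eqxx subr0 add0r mulr1.
(* With [t < 0] the point lies beyond the face opposite to [a], since by [ly] its coordinate at [a]
   is [t]; it can be taken as close to [z] as desired. *)
have [t t0 [T2 [T2Th T2z T2y]]] : exists2 t, t < 0 & exists T,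
    [/\ T \in Th, conv_hull T z & conv_hull T (z + t *: (a - z))].
  have /nbhs_ballP[r /= r0 hr] := covz.
  pose d := `|a - z| + 1; have d0 : 0 < d by rewrite ltr_wpDl.
  exists (- (r / (d *+ 2))); first by rewrite oppr_lt0 divr_gt0 // pmulrn_lgt0.
  apply: hr; rewrite -ball_normE /ball_ /= opprD addrA subrr sub0r normrN normrZ.
  rewrite normrN gtr0_norm ?divr_gt0 ?pmulrn_lgt0 //.
  rewrite mulrAC ltr_pdivrMr ?pmulrn_lgt0 // ltr_pM2l //.
  have : `|a - z| < d by rewrite /d ltrDl.
  by move: d0; rewrite mulr2n; lra.
have T12 : T1 != T2.
  apply/eqP => E; move: T2y; rewrite -E conv_hullE // => /(_ a aT1).
  by rewrite ly leNgt t0.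
have s2 := sTh _ T2Th; have [ba2 bd2 b12 bE2 _] := baryP s2.
have [S /andP[S1 S2] SE] := mesh _ _ T1Th T2Th.
have Sz : conv_hull S z by rewrite -SE.
have ST1 b : b \in T1 -> b != a -> b \in S.
  move=> bT ba; apply/negPn/negP => bS.
  by have := gt1 b bT ba; rewrite (conv_hull_sub s1 S1 Sz bS) ltxx.
have card12 : #|` T1| = #|` T2| by case: s1 s2 => -> _ [-> _].
have aS : a \notin S.
  apply/negP => aS; have E1 : S = T1.
    apply/eqP; rewrite eqEfsubset S1; apply/fsubsetP => b bT.
    by have [->//|] := eqVneq b a; exact: ST1.
  by move: S2; rewrite E1 => /fset_sub_card/(_ card12) E; rewrite E eqxx in T12.
have SE1 : S = (T1 `\ a)%fset.
  apply/eqP; rewrite eqEfsubset; apply/andP; split; apply/fsubsetP => b.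
    rewrite in_fsetD1 => bS; rewrite (fsubsetP S1) // andbT.
    by apply: contraNneq aS => <-.
  by rewrite in_fsetD1 => /andP[ba bT]; exact: ST1.
have cardS : #|` (T2 `\` S)%fset| = 1%N.
  rewrite cardfsD (fsetIidPr S2) -card12 (cardfsD1 a T1) aT1 SE1.
  by rewrite addnK.
have /cardfs1P[b bE] : #|` (T2 `\` S)%fset| == 1%N by rewrite cardS.
have [bT2 bS] : b \in T2 /\ b \notin S.
  have : b \in (T2 `\` S)%fset by rewrite bE inE.
  by rewrite inE => /andP[].
have ST2 e : e \in T2 -> e != b -> e \in S.
  move=> eT eb; apply/negPn/negP => eS.
  have : e \in (T2 `\` S)%fset by rewrite inE eS.
  by rewrite bE inE (negPf eb).
have lS e : e \in S -> bary T1 a e = 0.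
  move=> eS; rewrite bd1 ?(fsubsetP S1) //; case: eqP => // E.
  by rewrite E eS in aS.
(* Both sides are affine and agree at the vertices of [T2], as [bary T1 a] vanishes at all of them
   but [b]. The factor turns out to be negative ([lb]), so the two elements lie on opposite sides of
   one hyperplane. *)
have l2 y : bary T1 a y = bary T1 a b * bary T2 b y.
  apply/eqP; rewrite -subr_eq0; apply/eqP.
  apply: (@affine_eq0 _ _ T2 (fun y => bary T1 a y - bary T1 a b * bary T2 b y)) => //.
    apply: affineD => //; under eq_fun do rewrite -mulNr; exact: affineZ.
  move=> e eT; rewrite bd2 //; have [->|eb] := eqVneq b e; first by rewrite mulr1 subrr.
  by rewrite mulr0 subr0 lS // ST2 // eq_sym.
have ge2 e : e \in T2 -> 0 <= bary T2 e z.
  by move: e; have := T2z; rewrite conv_hullE.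
have lb : bary T1 a b < 0.
  have := T2y; rewrite conv_hullE // => /(_ b bT2) hb; have := ly t; rewrite l2 => E.
  by rewrite ltNge; apply/negP => p; move: t0; rewrite -E ltNge mulr_ge0.
have l2z : bary T2 b z = 0.
  by apply/eqP; have /eqP := l2 z; rewrite la eq_sym mulf_eq0 (negPf (ltr0_neq0 lb)).
have gt2 e : e \in T2 -> e != b -> 0 < bary T2 e z.
  move=> eT eb; rewrite lt_neqAle eq_sym ge2 // andbT; apply/eqP => le.
  by apply: skz; exists T2, b, e; split=> //; split; rewrite // eq_sym.
(* On the hyperplane the coordinate at [a] is [0], so the barycentric expansion over [T1] involves
   only vertices of the common face [S]. *)
have mult f : affine f -> (forall e, e \in S -> f e = 0) ->
    forall y, c + dot N y = 0 -> f y = 0.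
  move=> af f0 y; rewrite -lE => ly0.
  rewrite (affine_bary y s1 af) big_seq big1 // => e eT.
  have [->|ea] := eqVneq e a; first by rewrite ly0 mul0r.
  by rewrite f0 ?mulr0 // ST1.
exists T1, T2, c, N; split => //; first by rewrite -lE.
split.
  have hOm : \forall y \near z, Om y by exact: open_nbhs_nbhs.
  have h1 : \forall y \near z, forall e, e \in T1 -> e != a -> 0 < bary T1 e y.
    apply: filter_all_seq => e eT; have [->|ea] := eqVneq e a;
      first by apply: (@filterE _ (nbhs z)).
    by apply: filterS (affine_near_gt0 (ba1 e) (gt1 e eT ea)) => y.
  have h2 : \forall y \near z, forall e, e \in T2 -> e != b -> 0 < bary T2 e y.
    apply: filter_all_seq => e eT; have [->|eb] := eqVneq e b;
      first by apply: (@filterE _ (nbhs z)).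
    by apply: filterS (affine_near_gt0 (ba2 e) (gt2 e eT eb)) => y.
  apply: filterS (filterI hOm (filterI h1 h2)) => y [Omy [y1 y2]]; split=> //.
  rewrite -lE; split=> hy e eT.
    by have [->//|ea] := eqVneq e a; exact: y1.
  have [->|eb] := eqVneq e b; last exact: y2.
  by move: hy; rewrite l2 nmulr_rlt0.
move=> x; split=> [y ly0|].
  apply/eqP; rewrite -subr_eq0; apply/eqP.
  apply: (mult (fun y => bary T1 x y - bary T2 x y)) => //.
    apply: affineD => //; under eq_fun do rewrite -mulN1r; exact: affineZ.
  by move=> e eS; rewrite bd1 ?(fsubsetP S1) // bd2 ?(fsubsetP S2) // subrr.
have [xS|xS] := boolP (x \in S); [left|right].
  by rewrite (fsubsetP S1) // (fsubsetP S2) // -lE lS.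
apply: (mult (bary T1 x)) => // e eS; rewrite bd1 ?(fsubsetP S1) //.
by case: eqP => // E; rewrite E eS in xS.
Qed.

End facing.

(** * The divergence theorem for piecewise smooth fields *)

Section piecewise_divergence.
Variables (R : realType) (n : nat).
Local Notation vec := 'rV[R]_n.
Local Notation mu := (lebesgue_rV R n).
Local Notation field := ('I_n -> vec -> R).
Implicit Types (y z v N : vec) (K : set vec) (f g : vec -> R).

Lemma affine_deriveE f v c N y : (forall y, f y = c + dot N y) ->
  'D_v f y = dot N v.
Proof. by move=> h; have /(congr1 (@^~ y)) := affine_derive v h. Qed.

Definition divergence (F : field) y : R := \sum_i 'D_(delta_mx ord0 i) (F i) y.

Lemma smooth_divergence F : (forall i, smooth (F i)) -> smooth (divergence F).
Proof. by move=> sF; apply: smooth_sum => i _; exact: smooth_derive. Qed.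

Lemma divergence_eq0 F K y : closed K -> (forall i z, ~ K z -> F i z = 0) ->
  ~ K y -> divergence F y = 0.
Proof.
move=> cK FK Ky; rewrite /divergence big1 // => i _.
exact: derive_eq0 cK (FK i) Ky.
Qed.

Lemma divergence_mul f F y : smooth f -> (forall i, smooth (F i)) ->
  divergence (fun i y => f y * F i y) y =
  f y * divergence F y + \sum_i 'D_(delta_mx ord0 i) f y * F i y.
Proof.
move=> sf sF; rewrite /divergence mulr_sumr -big_split; apply: eq_bigr => i _.
by rewrite derive_mul // [F i y * _]mulrC.
Qed.

Lemma compact_divergence K F : compact K -> (forall i, smooth (F i)) ->
  (forall i z, ~ K z -> F i z = 0) -> compact_smooth (divergence F).
Proof.
move=> cK sF FK; split; first exact: smooth_divergence.
by exists K => // y; apply: divergence_eq0 => //; exact: compact_closed_rV.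
Qed.

Lemma int_divergence K F : compact K -> (forall i, smooth (F i)) ->
  (forall i z, ~ K z -> F i z = 0) -> \int[mu]_y divergence F y = 0.
Proof.
move=> cK sF FK.
have cF i : compact_smooth (F i) by split=> //; exists K => // y; exact: FK.
rewrite Rintegral_sum_bounded //; last first.
  by move=> i _; exact/compact_smooth_bounded/compact_smooth_derive.
by rewrite big1 // => i _; exact: int_derive.
Qed.

Variables (Om : set vec) (Th : {fset {fset vec}}).
Hypothesis n_gt0 : (0 < n)%N.
Hypothesis Om_open : open Om.
Hypothesis mesh : simplicial_mesh Om Th.

Let sTh T : T \in Th -> simplex n T. Proof. by case: mesh => h _ _; exact: h. Qed.

Lemma mesh_disjoint T1 T2 y : T1 \in Th -> T2 \in Th -> inner T1 y ->
  inner T2 y -> T1 = T2.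
Proof.
move=> h1 h2; case: mesh => _ _ /(_ _ _ h1 h2)[S /andP[S1 S2] E].
exact: inner_disjoint (sTh h1) (sTh h2) S1 S2 E.
Qed.

Definition piecewise (f : {fset vec} -> vec -> R) y : R :=
  \sum_(T <- Th) \1_(inner T) y * f T y.

Lemma piecewise_inner (f : {fset vec} -> vec -> R) T y : T \in Th -> inner T y ->
  piecewise f y = f T y.
Proof.
move=> TTh Ty; rewrite /piecewise (bigD1_seq T) //= ?fset_uniq //.
rewrite indicE mem_set // mul1r big_seq_cond big1 ?addr0 // => S /andP[STh ST].
rewrite indicE memNset ?mul0r // => Sy.
by rewrite (mesh_disjoint STh TTh Sy Ty) eqxx in ST.
Qed.

Lemma piecewise_out (f : {fset vec} -> vec -> R) y : (forall T, T \in Th -> ~ inner T y) ->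
  piecewise f y = 0.
Proof.
move=> h; rewrite /piecewise big_seq big1 // => T TTh.
by rewrite indicE memNset ?mul0r //; exact: h.
Qed.

Lemma piecewise_eq0 (f : {fset vec} -> vec -> R) y : (forall T, T \in Th -> f T y = 0) ->
  piecewise f y = 0.
Proof.
by move=> h; rewrite /piecewise big_seq big1 // => T TTh; rewrite h // mulr0.
Qed.

Lemma piecewise_bounded (f : {fset vec} -> vec -> R) : (forall T, T \in Th ->
  bounded_support (f T)) ->
  bounded_support (piecewise f).
Proof.
move=> bf; rewrite /piecewise.
rewrite (_ : (fun y => _) = fun y => \sum_(T <- Th | T \in Th) \1_(inner T) y * f T y).
  apply: bounded_support_sum => T TTh; apply: bounded_support_indic.
    by apply: inner_measurable; exact: sTh.
  exact: bf.
by apply/funext => y; rewrite big_seq.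
Qed.

(** The normal component of the field is the same from both sides. It is demanded on the whole
    hyperplane, in the form that [halfspace_derive_eq0] consumes, and is preserved by multiplication
    with a common cutoff. *)
Definition jump_free (X : {fset vec} -> field) :=
  forall T1 T2 c N z, facing Om Th T1 T2 c N z ->
  forall y, c + dot N y = 0 -> \sum_i N ord0 i * (X T1 i y - X T2 i y) = 0.

Definition adm K (X : {fset vec} -> field) :=
  [/\ forall T i, smooth (X T i), forall T i y, ~ K y -> X T i y = 0 & jump_free X].

Definition div_pw (X : {fset vec} -> field) := piecewise (fun T => divergence (X T)).

Definition mulX f (X : {fset vec} -> field) : {fset vec} -> field :=
  fun T i y => f y * X T i y.

Lemma adm_mul K K' f X : adm K X -> smooth f -> (forall y, K y -> ~ K' y -> f y = 0) ->
  adm K' (mulX f X).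
Proof.
move=> [sX XK jX] sf f0; split.
- by move=> T i; exact: smoothM.
- move=> T i y K'y; rewrite /mulX; have [Ky|/XK->] := pselect (K y).
    by rewrite f0 // mul0r.
  by rewrite mulr0.
- move=> T1 T2 c N z fc y ly; have hj := jX _ _ _ _ _ fc y ly.
  rewrite /mulX; under eq_bigr do rewrite -mulrBr mulrCA.
  by rewrite -mulr_sumr hj mulr0.
Qed.

Lemma adm_bounded K X : compact K -> adm K X -> bounded_support (div_pw X).
Proof.
move=> cK [sX XK _]; apply: piecewise_bounded => T _.
apply: compact_smooth_bounded; apply: compact_divergence cK _ _ => //.
by move=> i y; exact: XK.
Qed.

Lemma div_pw_mul K X f y : adm K X -> smooth f ->
  div_pw (mulX f X) y = f y * div_pw X y +
    piecewise (fun T y => \sum_i 'D_(delta_mx ord0 i) f y * X T i y) y.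
Proof.
move=> [sX XK _] sf; rewrite /div_pw /piecewise mulr_sumr -big_split.
apply: eq_bigr => T _; rewrite divergence_mul // mulrDr; congr (_ + _).
by rewrite mulrCA.
Qed.

Lemma int_div_pwB K X f : compact K -> adm K X -> smooth f ->
  \int[mu]_y div_pw X y = \int[mu]_y div_pw (mulX f X) y +
    \int[mu]_y div_pw (mulX (fun y => 1 - f y) X) y.
Proof.
move=> cK aX sf.
have sf1 : smooth (fun y => 1 - f y) by apply: smoothB => //; exact: smooth_cst.
have bi g : smooth g -> mu.-integrable setT (EFin \o div_pw (mulX g X)).
  move=> sg; apply: bounded_support_integrable => //; apply: (adm_bounded cK).
  by apply: adm_mul aX sg _.
rewrite -RintegralD //; [|exact: bi..].
apply: eq_Rintegral => y _; rewrite !(div_pw_mul _ aX) //.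
have -> : piecewise (fun T y => \sum_i 'D_(delta_mx ord0 i) (fun y => 1 - f y) y * X T i y) y =
    - piecewise (fun T y => \sum_i 'D_(delta_mx ord0 i) f y * X T i y) y.
  rewrite /piecewise -sumrN; apply: eq_bigr => T _; rewrite -mulrN -sumrN.
  congr (_ * _); apply: eq_bigr => i _; rewrite derive_sub //; last exact: smooth_cst.
  by rewrite (derive_cst (1 : R)) sub0r mulNr.
by ring.
Qed.

Definition locally_null K := forall X, adm K X -> \int[mu]_y div_pw X y = 0.

(** The norm of the space is the sup norm, which is not smooth; radial cutoffs are built from the
    squared Euclidean distance instead. *)
Definition sqdist z y : R := \sum_i (y ord0 i - z ord0 i) ^+ 2.

Lemma sqdist_smooth z : smooth (sqdist z).
Proof.
apply: smooth_sum => i _; apply: smoothX; apply: affine_smooth.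
exists (- z ord0 i), (delta_mx ord0 i) => y.
by rewrite dotC dot_delta addrC.
Qed.

Lemma sqdist_le z y r : 0 <= r -> sqdist z y <= r ^+ 2 -> `|y - z| <= r.
Proof.
move=> r0 h; rewrite [leLHS]/Num.norm /= mx_normrE; apply/bigmax_leP; split=> //= -[i j] _ /=.
rewrite (ord1 i) !mxE -(ler_pXn2r (isT : (0 < 2)%N)) ?nnegrE // real_normK ?num_real //.
apply: le_trans h; rewrite /sqdist (bigD1 j) //= lerDl sumr_ge0 // => k _.
exact: sqr_ge0.
Qed.

Lemma sqdistxx z : sqdist z z = 0.
Proof. by rewrite /sqdist big1 // => i _; rewrite subrr expr0n. Qed.

Lemma near_sqdist z (P : set vec) : nbhs z P ->
  exists2 r, 0 < r & forall y, sqdist z y <= r -> P y.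
Proof.
move=> /nbhs_ballP[e /= e0 he]; exists ((e / 2) ^+ 2).
  by rewrite exprn_gt0 // divr_gt0.
move=> y hy; apply: he; rewrite -ball_normE /ball_ /= distrC.
apply: (@le_lt_trans _ _ (e / 2)); first by apply: sqdist_le hy; rewrite divr_ge0 // ltW.
by rewrite ltr_pdivrMr // ltr_pMr // ltr1n.
Qed.

Lemma sublevel_closed f r : continuous f -> closed [set y | f y <= r].
Proof. by move=> cf; exact: (closed_comp (fun y _ => cf y) (@closed_le _ r)). Qed.

Lemma superlevel_closed f r : continuous f -> closed [set y | r <= f y].
Proof. by move=> cf; exact: (closed_comp (fun y _ => cf y) (@closed_ge _ r)). Qed.

Lemma sqdist_compact z r : compact [set y | sqdist z y <= r].
Proof.
apply: bounded_closed_compact; last first.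
  by apply: sublevel_closed; apply: smooth_continuous; exact: sqdist_smooth.
exists (`|z| + (`|r| + 1)); split; first exact: num_real.
move=> M hM y /= hy; apply: ltW; apply: le_lt_trans hM.
rewrite -[y](subrK z); apply: (le_trans (ler_normD _ _)); rewrite addrC lerD2l.
apply: sqdist_le; first by rewrite addr_ge0.
apply: (le_trans hy); apply: (le_trans (ler_norm r)).
by have := normr_ge0 r; nra.
Qed.

Lemma local_null_inner z T : T \in Th -> inner T z -> exists2 r, 0 < r &
  locally_null [set y | sqdist z y <= r].
Proof.
move=> TTh Tz; have [r r0 hr] := near_sqdist (inner_near (sTh TTh) Tz).
exists r => // X [sX XK _]; have cK := @sqdist_compact z r.
rewrite -[RHS](@int_divergence [set y | sqdist z y <= r] (X T)) //; last first.
  by move=> i y; exact: XK.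
apply: eq_Rintegral => y _; have [hy|hy] := leP (sqdist z y) r.
  by rewrite /div_pw (piecewise_inner _ TTh) //; exact: hr.
have D0 S : divergence (X S) y = 0.
  apply: (divergence_eq0 (compact_closed_rV cK) (XK S)) => /=.
  by apply/negP; rewrite -ltNge.
by rewrite D0 /div_pw piecewise_eq0.
Qed.

Lemma local_null_facing z T1 T2 c N : facing Om Th T1 T2 c N z ->
  exists2 r, 0 < r & locally_null [set y | sqdist z y <= r].
Proof.
move=> fc; have [T1h T2h N0 lz [nz _]] := fc.
have [r r0 hr] := near_sqdist nz; exists r => // X [sX XK jX].
have cK := @sqdist_compact z r; set K := [set y | sqdist z y <= r] in XK cK *.
have cX T i : compact_smooth (X T i) by split=> //; exists K => // y; exact: XK.
have D0 S y : ~ K y -> divergence (X S) y = 0.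
  exact: (divergence_eq0 (compact_closed_rV cK) (XK S)).
have bD T : bounded_support (divergence (X T)).
  apply: compact_smooth_bounded; apply: compact_divergence cK _ _ => //.
  by move=> i y; exact: XK.
pose H := [set y | 0 < c + dot N y].
have mH : measurable H := halfspace_measurable c N.
(* Off the hyperplane this is the piecewise divergence. The first term integrates to [0] over the
   whole space, and the second is the divergence of the difference of the two fields over a
   half-space, where only its normal component counts. *)
pose g y := divergence (X T2) y + \1_H y * (divergence (X T1) y - divergence (X T2) y).
have bg : bounded_support g.
  by apply: bounded_supportD => //; apply: bounded_support_indic => //; exact: bounded_supportB.
have bE : bounded_support (div_pw X) by apply: piecewise_bounded => T _.
have -> : \int[mu]_y div_pw X y = \int[mu]_y g y.
  apply: Rintegral_ae => //; [by case: bE|by case: bg|].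
  exists [set y | c + dot N y = 0]; split.
  - exact: hyperplane_measurable.
  - exact: hyperplane_null.
  move=> y /=; apply: contra_notP => ly _; rewrite /g.
  have [Ky|Ky] := pselect (K y); last first.
    by rewrite !D0 // subrr mulr0 addr0 /div_pw piecewise_eq0 // => T _; exact: D0.
  have [_ [h1 h2]] := hr y Ky; have [l0|l0|//] := ltgtP (c + dot N y) 0.
    rewrite /div_pw (piecewise_inner _ T2h); last exact: h2.
    by rewrite indicE memNset ?mul0r ?addr0 // /H /= ltNge (ltW l0).
  rewrite /div_pw (piecewise_inner _ T1h); last exact: h1.
  by rewrite indicE mem_set // mul1r addrC subrK.
rewrite /g RintegralD //; [|exact: bounded_support_integrable|]; last first.
  apply: bounded_support_integrable => //; apply: bounded_support_indic => //.
  exact: bounded_supportB.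
rewrite (int_divergence cK) //; last by move=> i y; exact: XK.
rewrite add0r -Rintegral_indic //.
have E : divergence (X T1) \- divergence (X T2) =1
    divergence (fun i y => X T1 i y - X T2 i y).
  move=> y; rewrite /divergence /= -sumrB; apply: eq_bigr => i _.
  by rewrite derive_sub.
under eq_Rintegral => y _ do rewrite [_ - _]E.
rewrite (halfspace_div c N0); last by move=> i; exact: compact_smoothB.
rewrite halfspace_derive_eq0 ?mulr0 //.
- apply: compact_smooth_sum => i; apply: compact_smoothMl; first exact: smooth_cst.
  exact: compact_smoothB.
- exact: jX fc.
Qed.

Lemma adm0 K X : adm K X -> (forall T i y, X T i y = 0) -> \int[mu]_y div_pw X y = 0.
Proof.
move=> [sX XK _] X0; rewrite (@eq_Rintegral _ _ _ _ _ (fun=> 0)).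
  by rewrite Rintegral_cst // mul0r.
move=> y _; apply: piecewise_eq0 => T _; rewrite /divergence big1 // => i _.
rewrite (_ : X T i = fun=> 0); last by apply/funext => z; exact: X0.
exact: derive_cst.
Qed.

(* With a cutoff [b] equal to [1] near each of finitely many points,
   [X = b X + (1 - b) X] peels off one point at a time. *)
Lemma locally_null_glue K (s : seq vec) (r : vec -> R) X : compact K -> adm K X ->
  (forall z, z \in s -> 0 < r z /\ locally_null [set y | sqdist z y <= r z]) ->
  (forall y, (forall z, z \in s -> ~ sqdist z y < r z / 2) ->
    forall T i, X T i y = 0) ->
  \int[mu]_y div_pw X y = 0.
Proof.
move=> cK; elim: s X => [|z s IH] X aX hs X0.
  by apply: (adm0 aX) => T i y; exact: X0.
have [rz hz] := hs z (mem_head _ _).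
(* [b] is [1] where [sqdist z y <= r z / 2] and [0] where [sqdist z y >= r z]: [b X] is supported
   where the theorem is known locally, and [(1 - b) X] vanishes near [z]. *)
pose b y := step (2 - 2 / r z * sqdist z y).
have sb : smooth b.
  apply: smooth_step; apply: smoothB; first exact: smooth_cst.
  by apply: smoothZ; exact: sqdist_smooth.
rewrite (int_div_pwB cK aX sb) hz ?add0r; last first.
  apply: adm_mul aX sb _ => y _ /= /negP; rewrite -ltNge => hy.
  rewrite /b step0 // subr_le0 mulrAC ler_pdivlMr // ler_pM2l //; exact: ltW.
apply: IH.
- by apply: adm_mul aX _ _ => //; apply: smoothB => //; exact: smooth_cst.
- by move=> w ws; apply: hs; rewrite in_cons ws orbT.
- move=> y hy T i; rewrite /mulX; have [h|h] := ltP (sqdist z y) (r z / 2).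
    rewrite /b step1 ?subrr ?mul0r // lerBrDr addrC -lerBrDr mulrAC ler_pdivrMr //.
    by move: h; rewrite ltr_pdivlMr // => h; lra.
  rewrite X0 ?mulr0 // => w; rewrite in_cons => /predU1P[->|/hy //].
  by apply/negP; rewrite -leNgt.
Qed.

Lemma adm_off_skeleton K X : compact K -> K `<=` Om -> adm K X ->
  (forall y, K y -> ~ skeleton Th y) -> \int[mu]_y div_pw X y = 0.
Proof.
move=> cK KOm aX Ksk.
have h z : exists r, K z -> 0 < r /\ locally_null [set y | sqdist z y <= r].
  have [Kz|Kz] := pselect (K z); last by exists 0.
  have [[T TTh Tz]|[T1 [T2 [c [N fc]]]]] :=
      generic_point n_gt0 Om_open mesh (KOm _ Kz) (Ksk _ Kz).
    by have [r r0 hr] := local_null_inner TTh Tz; exists r.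
  by have [r r0 hr] := local_null_facing fc; exists r.
have /choice[r hr] := h.
have := cK; rewrite compact_cover => /(_ vec K (fun z => [set y | sqdist z y < r z / 2])).
case.
- move=> z Kz; apply: (@open_comp _ _ (sqdist z) [set t | t < r z / 2]); last exact: open_lt.
  by move=> y _; apply: smooth_continuous; exact: sqdist_smooth.
- move=> z Kz; exists z => //=; rewrite sqdistxx; have [r0 _] := hr z Kz.
  by rewrite divr_gt0.
move=> D DK Kcov; apply: (@locally_null_glue K (enum_fset D) r X cK aX).
  by move=> z zD; apply: hr; have := DK z zD; rewrite inE.
move=> y hy T i; have [_ XK _] := aX; apply: XK => Ky.
have [z /= zD hz] := Kcov y Ky; exact: hy z zD hz.
Qed.

(** A function of size [k (m + 1)] carried by a set of measure at most [C / (m + 1)^2] has integral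
    at most [k C / (m + 1)]. *)
Lemma int_small (f_ : nat -> vec -> R) (A_ : nat -> set vec) k C :
  (forall m, bounded_support (f_ m)) -> (forall m, measurable (A_ m)) ->
  (forall m, ((m.+1 * m.+1)%:R%:E * mu (A_ m) <= C%:E)%E) -> 0 <= k ->
  (forall m y, `|f_ m y| <= \1_(A_ m) y * (k * m.+1%:R)) ->
  \int[mu]_y f_ m y @[m --> \oo] --> (0 : R).
Proof.
move=> bf mA muA k0 fA.
have w0 m : 0 < m.+1%:R :> R by [].
have finA m : mu (A_ m) \is a fin_num.
  rewrite ge0_fin_numE // ltNge; apply/negP; rewrite leye_eq => /eqP E.
  by have := muA m; rewrite E mulry gtr0_sg ?ltr0n // mul1e leye_eq.
have C0 : 0 <= C.
  by rewrite -lee_fin; apply: le_trans (muA 0%N); rewrite mule_ge0 // lee_fin.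
have AC m : fine (mu (A_ m)) * (m.+1%:R * m.+1%:R) <= C.
  have := muA m; rewrite -(fineK (finA m)) -EFinM lee_fin natrM.
  by rewrite mulrC.
have bound m : `|\int[mu]_y f_ m y| <= k * C * m.+1%:R^-1.
  apply: (@le_trans _ _ (\int[mu]_y (\1_(A_ m) y * (k * m.+1%:R)))).
    apply: (le_trans (le_normr_Rintegral _ _)) => //.
      exact: bounded_support_integrable.
    have iA : mu.-integrable setT (EFin \o (fun y => \1_(A_ m) y * (k * m.+1%:R))).
      rewrite (_ : _ \o _ = fun y => ((k * m.+1%:R)%:E * (\1_(A_ m) y)%:E)%E); last first.
        by apply/funext => y; rewrite /= mulrC.
      apply: integrableZl => //; apply/integrableP; split.
        by apply/measurable_EFinP; exact: measurable_indic.
      rewrite (eq_integral (fun y => (\1_(A_ m) y)%:E)); last first.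
        by move=> t _; rewrite gee0_abs // lee_fin.
      by rewrite integral_indic // setIT ltey_eq finA.
    apply: le_Rintegral => //.
      by apply: integrable_norm; exact: bounded_support_integrable.
  rewrite -Rintegral_indic // Rintegral_cst // ler_pdivlMr // -!mulrA.
  by rewrite ler_wpM2l // mulrC -mulrA AC.
apply/cvgr0Pnorm_lt => e e0.
have kC : 0 < k * C + 1 by rewrite ltr_wpDl // mulr_ge0.
have := near_infty_natSinv_lt (PosNum (divr_gt0 e0 kC)); apply: filterS => m /=.
rewrite ltr_pdivlMr // => hm; apply: (le_lt_trans (bound m)); apply: le_lt_trans hm.
by rewrite mulrC ler_wpM2l ?invr_ge0 // lerDl.
Qed.

(* A cutoff around the codimension 2 plane has a gradient of size [O(m)] on a set
   of measure [O(1/m^2)]. *)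
Lemma skeleton_step (c1 c2 : R) (N1 N2 v1 v2 : vec) K X :
  dot N1 v1 = 1 -> dot N1 v2 = 0 -> dot N2 v1 = 0 -> dot N2 v2 = 1 ->
  compact K -> adm K X ->
  (forall K' X', compact K' -> K' `<=` K -> adm K' X' ->
    (forall y, K' y -> ~ (c1 + dot N1 y = 0 /\ c2 + dot N2 y = 0)) ->
    \int[mu]_y div_pw X' y = 0) ->
  \int[mu]_y div_pw X y = 0.
Proof.
move=> h11 h12 h21 h22 cK aX IH.
have [sX XK jX] := aX.
have N10 : N1 != 0.
  by apply: contra_eqT h11 => /negPn/eqP ->; rewrite dotC dot0r eq_sym oner_neq0.
pose al y := c1 + dot N1 y; pose be y := c2 + dot N2 y.
have aal : affine al by exists c1, N1.
have abe : affine be by exists c2, N2.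
have [sal sbe] : smooth al /\ smooth be by split; exact: affine_smooth.
pose q y := al y * al y + be y * be y.
have sq : smooth q by apply: smoothD; exact: smoothM.
have [ds [C [dst dsC ds0]]] := @step_derive R.
have C0 : 0 <= C := le_trans (normr_ge0 _) (dsC 0).
pose w (m : nat) : R := m.+1%:R.
have w0 m : 0 < w m by rewrite /w.
(* [ze m] is [0] for [q <= 1 / w^2] and [1] for [q >= 2 / w^2]. In between, both affine functions
   are at most [2 / w] in absolute value, so the gradient lives on [A m]. *)
pose ze m y := step (w m ^+ 2 * q y - 1).
have st m : smooth (fun y => w m ^+ 2 * q y - 1).
  by apply: smoothB; [exact: smoothZ|exact: smooth_cst].
have sze m : smooth (ze m) by exact: smooth_step.
pose A m := [set y | `|c1 + dot N1 y| <= 2 / m.+1%:R /\ `|c2 + dot N2 y| <= 2 / m.+1%:R].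
pose P := \sum_i (`|N1 ord0 i| + `|N2 ord0 i|).
have ze_out m i y : ~ A m y -> 'D_(delta_mx ord0 i) (ze m) y = 0.
  move=> Ay; rewrite /ze (derive_comp1 _ (smooth_differentiable y (st m)) (dst _)).
  rewrite ds0 ?mul0r //; apply: contrapT => /not_orP[/negP h1 /negP h2]; apply: Ay.
  move: h1 h2; rewrite -!leNgt lerBlDr => _ h2.
  have key (t u : R) : t * t + u * u = q y -> `|t| <= 2 / m.+1%:R.
    move=> E; rewrite -(ler_pXn2r (isT : (0 < 2)%N)) ?nnegrE ?divr_ge0 //.
    rewrite real_normK ?num_real // expr_div_n ler_pdivlMr ?exprn_gt0 // -/(w m).
    have h3 : 0 <= w m ^+ 2 * (u * u) by rewrite mulr_ge0 ?sqr_ge0 // -expr2 sqr_ge0.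
    by move: h2; rewrite -E mulrDr; rewrite !expr2 in h3 *; lra.
  by split; [apply: (key _ (be y))|apply: (key _ (al y)); rewrite addrC].
have ze_in m i y : A m y -> `|'D_(delta_mx ord0 i) (ze m) y| <= 4 * C * P * w m.
  move=> [A1 A2]; rewrite /ze (derive_comp1 _ (smooth_differentiable y (st m)) (dst _)).
  rewrite derive_sub; [|exact: smoothZ|exact: smooth_cst].
  rewrite (derive_cst (1 : R)) subr0 derive_mulr // derive_add; [|exact: smoothM..].
  have Da : 'D_(delta_mx ord0 i) al y = N1 ord0 i.
    by rewrite (affine_deriveE _ _ (fun y => erefl (al y))) dot_delta.
  have Db : 'D_(delta_mx ord0 i) be y = N2 ord0 i.
    by rewrite (affine_deriveE _ _ (fun y => erefl (be y))) dot_delta.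
  rewrite !derive_mul // Da Db.
  have -> : al y * N1 ord0 i + al y * N1 ord0 i + (be y * N2 ord0 i + be y * N2 ord0 i) =
    2 * (al y * N1 ord0 i + be y * N2 ord0 i) by ring.
  have -> : 4 * C * P * w m = C * (w m ^+ 2 * (2 * (2 / w m * P))).
    by field; rewrite lt0r_neq0.
  rewrite normrM ler_pM // normrM (ger0_norm (sqr_ge0 _)) ler_wpM2l ?sqr_ge0 //.
  rewrite normrM (ger0_norm (ler0n _ _)) ler_wpM2l //.
  apply: (le_trans (ler_normD _ _)); rewrite !normrM.
  apply: (@le_trans _ _ (2 / w m * (`|N1 ord0 i| + `|N2 ord0 i|))).
    by rewrite mulrDr lerD // ler_wpM2r.
  rewrite ler_wpM2l ?divr_ge0 ?(ltW (w0 m)) // /P (bigD1 i) //= lerDl sumr_ge0 //.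
pose G y := \sum_(T <- Th) \sum_i `|X T i y|.
have cX T i : compact_smooth (X T i) by split=> //; exists K => // y; exact: XK.
have [mG [B GB]] : bounded_support G.
  apply: bounded_support_sum => T _; apply: bounded_support_sum => i _.
  have [mX [B hB]] := compact_smooth_bounded (cX T i); split.
    exact: measurableT_comp.
  by exists B => y; rewrite normr_id; split; [exact: (hB y).1|move=> /(hB y).2 ->;
    rewrite normr0].
pose g m := piecewise (fun T y => \sum_i 'D_(delta_mx ord0 i) (ze m) y * X T i y).
have bg m : bounded_support (g m).
  apply: piecewise_bounded => T _; apply: bounded_support_sum => i _.
  apply: compact_smooth_bounded; apply: compact_smoothMl => //.
  exact: smooth_derive.
have gle m y (D : R) : 0 <= D -> (forall i, `|'D_(delta_mx ord0 i) (ze m) y| <= D) ->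
    `|g m y| <= D * G y.
  move=> D0 hD; apply: (le_trans (ler_norm_sum _ _ _)); rewrite /G mulr_sumr.
  apply: ler_sum => T _; rewrite normrM -[leRHS]mul1r ler_pM //.
    by rewrite indicE; case: (_ \in _); rewrite ?normr1 ?normr0.
  apply: (le_trans (ler_norm_sum _ _ _)); rewrite mulr_sumr.
  by apply: ler_sum => i _; rewrite normrM ler_wpM2r.
have G0 y : 0 <= G y by apply: sumr_ge0 => T _; apply: sumr_ge0 => i _.
have P0 : 0 <= P by apply: sumr_ge0 => i _; rewrite addr_ge0.
pose AB m := A m `&` ball 0 (`|B| + 1).
have mA m : measurable (AB m).
  apply: measurableI; last exact: measurable_rV_ball.
  apply: measurableI; apply: measurable_le => //;
    apply: measurableT_comp => //; apply: continuous_rV_measurable;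
    apply: affine_continuous; by [exists c1, N1|exists c2, N2].
have [C' hC'] := @codim2_measure R n c1 c2 N1 N2 v1 v2 (`|B| + 1) h11 h12 h21 h22.
have g0 : \int[mu]_y g m y @[m --> \oo] --> (0 : R).
  apply: (@int_small g AB (4 * C * P * `|B|) C') => //; first by rewrite !mulr_ge0.
  move=> m y; rewrite indicE; have [_|] := boolP (y \in AB m).
    rewrite mul1r; apply: (le_trans (gle m y (4 * C * P * w m) _ _)).
    - by rewrite !mulr_ge0 // ltW.
    - move=> i; have [Ay|/(ze_out m i y) ->] := pselect (A m y); first exact: ze_in.
      by rewrite normr0 !mulr_ge0 // ltW.
    rewrite -/(w m) -(mulrA _ (w m)) -(mulrA _ `|B|) ler_wpM2l ?mulr_ge0 //.
    rewrite mulrC ler_wpM2r ?(ltW (w0 m)) //.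
    by rewrite (le_trans (ler_norm _)) // (le_trans (GB y).1) // ler_norm.
  rewrite notin_setE => hA; rewrite mul0r.
  have [Ay|Ay] := pselect (A m y); last first.
    apply: (le_trans (gle m y 0 _ _)); rewrite ?mul0r //.
    by move=> i; rewrite ze_out // normr0.
  have yB : `|B| + 1 <= `|y|.
    by rewrite leNgt; apply/negP => h; apply: hA; split=> //; apply/mem_rV_ball0.
  have Gy : G y = 0.
    by apply: (GB y).2; apply: lt_le_trans yB; rewrite (le_lt_trans (ler_norm _)) // ltrDl.
  apply: (le_trans (gle m y (4 * C * P * w m) _ _)); rewrite ?Gy ?mulr0 //.
    by rewrite !mulr_ge0 // ltW.
  by move=> i; exact: ze_in.
have be' := adm_bounded cK aX; have [me [Be hBe]] := be'.
have bze m : bounded_support (fun y => ze m y * div_pw X y).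
  under eq_fun do rewrite mulrC.
  apply: bounded_support_cont => //; exact: smooth_continuous.
(* [ze m X] is supported away from the plane, so the hypothesis applies to it; the Leibniz rule then
   leaves only the gradient term [g m], which tends to [0]. *)
have key m : \int[mu]_y (ze m y * div_pw X y) = - \int[mu]_y g m y.
  have := IH (K `&` [set y | 1 <= w m ^+ 2 * q y]) (mulX (ze m) X).
  rewrite (@eq_Rintegral _ _ _ _ _ (fun y => ze m y * div_pw X y + g m y)); last first.
    by move=> y _; exact: div_pw_mul aX (sze m).
  rewrite RintegralD //; [|exact: bounded_support_integrable..].
  move=> h; apply/eqP; rewrite -addr_eq0; apply/eqP; apply: h.
  - apply: compact_closedI => //; apply: superlevel_closed.
    by apply: smooth_continuous; exact: smoothZ.
  - by move=> y [].
  - apply: adm_mul aX (sze m) _ => y Ky /= hy; rewrite /ze step0 // subr_le0 leNgt.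
    by apply/negP => h; apply: hy; split=> //; exact: ltW.
  - move=> y [_ /= hy] [al0 be0]; move: hy.
    by rewrite /q /al /be al0 be0 !mul0r addr0 mulr0 ler10.
have h1 : \int[mu]_y (ze m y * div_pw X y) @[m --> \oo] --> \int[mu]_y div_pw X y.
  apply: (@bounded_support_cvg _ _ _ _ _ Be) => //.
  - by move=> m; case: (bze m).
  - move=> m y; split; last by move=> /(hBe y).2 ->; rewrite mulr0.
    rewrite normrM; apply: le_trans (hBe y).1; rewrite ler_piMl //.
    by rewrite ger0_norm ?step_ge0 // step_le1.
  exists [set y | c1 + dot N1 y = 0]; split.
  - exact: hyperplane_measurable.
  - exact: hyperplane_null.
  move=> y /=; apply: contra_notP => ly _.
  have q0 : 0 < q y.
    rewrite /q -!expr2 ltr_pwDl ?sqr_ge0 // exprn_even_gt0 //=; exact/eqP.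
  apply: (@cvg_trans _ ((fun=> div_pw X y) @ \oo)); last exact: cvg_cst.
  apply: near_eq_cvg.
  have q2 : 0 < q y / 2 by rewrite divr_gt0.
  have := near_infty_natSinv_lt (PosNum q2); apply: filterS => m /=.
  rewrite ltr_pdivlMr // ltr_pdivrMl // => hm; rewrite /ze step1 ?mul1r //.
  have : w m * q y <= w m ^+ 2 * q y.
    by rewrite ler_wpM2r ?(ltW q0) // -[leLHS]mulr1 expr2 ler_wpM2l ?ler1n // ltW.
  by move: hm; rewrite -/(w m); lra.
rewrite -(cvg_lim (@norm_hausdorff _ R) h1).
have -> : (fun m => \int[mu]_y (ze m y * div_pw X y)) = fun m => - \int[mu]_y g m y.
  exact/funext.
by rewrite -oppr0; apply: cvg_lim => //; exact: cvgN.
Qed.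

Theorem piecewise_divergence K X : compact K -> K `<=` Om -> adm K X ->
  \int[mu]_y div_pw X y = 0.
Proof.
have /choice[C hC] : forall p : {fset vec} * vec, exists cN : R * vec,
    p.1 \in Th -> forall y, bary p.1 p.2 y = cN.1 + dot cN.2 y.
  move=> [T a]; have [TTh|] := boolP (T \in Th); last by exists (0, 0).
  by have [/(_ a)[c [N h]] _ _ _ _] := baryP (sTh TTh); exists (c, N).
pose good (t : (R * vec) * (R * vec)) := exists v1 v2,
  [/\ dot t.1.2 v1 = 1, dot t.1.2 v2 = 0, dot t.2.2 v1 = 0 & dot t.2.2 v2 = 1].
pose Z (t : (R * vec) * (R * vec)) y :=
  t.1.1 + dot t.1.2 y = 0 /\ t.2.1 + dot t.2.2 y = 0.
have [s sgood ssk] : exists2 s : seq ((R * vec) * (R * vec)),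
    (forall t, t \in s -> good t) &
    forall y, skeleton Th y -> exists2 t, t \in s & Z t y.
  pose L := flatten [seq [seq (C (T, a), C (T, b)) | a <- enum_fset T, b <- enum_fset T]
    | T <- enum_fset Th].
  (* All pairs of coordinates of one element are listed; the filter drops degenerate ones such as
     [a = b], whose normals have no dual vectors. *)
  exists [seq t <- L | `[< good t >]].
    by move=> t; rewrite mem_filter => /andP[/asboolP].
  move=> y [T [a [b [TTh aT bT [ab la lb]]]]].
  have [_ bd b1 _ _] := baryP (sTh TTh).
  (* The coordinates at [y] sum to [1] while those of [a] and [b] vanish, so there is a third
     vertex. The vectors [a - e] and [b - e] are then dual to the two normals. *)
  have [e eT [ea eb]] : exists2 e, e \in T & e != a /\ e != b.
    apply: contrapT => h; have := b1 y; rewrite big_seq big1 => [/eqP|e eT].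
      by rewrite eq_sym oner_eq0.
    have [->//|ea] := eqVneq e a; have [->//|eb] := eqVneq e b.
    by exfalso; apply: h; exists e.
  have hCa := hC (T, a) TTh; have hCb := hC (T, b) TTh.
  exists (C (T, a), C (T, b)); last by split; rewrite /= -?hCa -?hCb.
  rewrite mem_filter; apply/andP; split; last first.
    apply/flatten_mapP; exists T => //.
    exact: (allpairs_f (fun a b => (C (T, a), C (T, b))) aT bT).
  apply/asboolP; exists (a - e), (b - e) => /=.
  have D (p : {fset vec} * vec) u v : p.1 \in Th ->
      dot (C p).2 (u - v) = bary p.1 p.2 u - bary p.1 p.2 v.
    by move=> pT; rewrite !(hC p pT) dotBr; ring.
  rewrite !D //= !bd // !eqxx (negPf ab) (eq_sym b a) (negPf ab).
  by rewrite (eq_sym a e) (eq_sym b e) (negPf ea) (negPf eb) !subr0.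
(* [l] lists the planes that the support may still meet; with [l] empty the support avoids the
   skeleton, and each induction step removes one plane. *)
suff main : forall l : seq ((R * vec) * (R * vec)), {subset l <= s} ->
  forall K X, compact K -> K `<=` Om -> adm K X ->
    (forall y t, K y -> t \in s -> t \notin l -> ~ Z t y) ->
    \int[mu]_y div_pw X y = 0.
  by move=> cK KOm aX; apply: (main s _ K X) => // y t _ ts; rewrite ts.
elim=> [_|t l IH ls] {K X} K X cK KOm aX hK.
  apply: (adm_off_skeleton cK KOm aX) => y Ky /ssk[t ts]; exact: hK.
have [v1 [v2 [h11 h12 h21 h22]]] := sgood t (ls t (mem_head _ _)).
apply: (skeleton_step h11 h12 h21 h22 cK aX (c1 := t.1.1) (c2 := t.2.1)).
move=> K' X' cK' K'K aX' hZ; apply: (IH _ K' X') => //.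
- by move=> u ul; apply: ls; rewrite in_cons ul orbT.
- exact: subset_trans KOm.
move=> y u K'y us ul; have [->|ut] := eqVneq u t; first exact: hZ.
by apply: hK => //; [exact: K'K|rewrite in_cons negb_or ut].
Qed.

End piecewise_divergence.

(** * Alternating forms *)

Section alternating.
Variables (R : realType) (n : nat).
Local Notation vec := 'rV[R]_n.
Local Notation form j := (('I_j -> vec) -> R).

Definition basis_tuple j (s : 'I_j -> 'I_n) : 'I_j -> vec := fun i => delta_mx ord0 (s i).

Definition set_at j (v : 'I_j -> vec) i x : 'I_j -> vec := [eta v with i |-> x].

Lemma set_at_id j (v : 'I_j -> vec) i : set_at v i (v i) = v.
Proof. by apply/funext => k; rewrite /set_at /=; case: eqP => // ->. Qed.

Section multilinear.
Variables (j : nat) (a : form j).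
Hypothesis ma : multilinear_form a.

Lemma multilinear_set v i c x y :
  a (set_at v i (c *: x + y)) = c * a (set_at v i x) + a (set_at v i y).
Proof. exact: ma. Qed.

Lemma multilinear0 v i : a (set_at v i 0) = 0.
Proof. by have := multilinear_set v i 1 0 0; rewrite scaler0 addr0 mul1r; lra. Qed.

Lemma multilinear_sum (I : Type) (r : seq I) v i (c : I -> R) (x : I -> vec) :
  a (set_at v i (\sum_(k <- r) c k *: x k)) =
  \sum_(k <- r) c k * a (set_at v i (x k)).
Proof.
elim: r => [|k r IH]; first by rewrite !big_nil multilinear0.
by rewrite !big_cons multilinear_set IH.
Qed.

Lemma multilinear_eq0 : (forall s, a (basis_tuple s) = 0) -> forall v, a v = 0.
Proof.
move=> a0 v; suff h : forall k (w : 'I_j -> vec),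
    (forall i : 'I_j, (k <= i)%N -> exists l, w i = delta_mx ord0 l) -> a w = 0.
  by apply: (h j) => i; rewrite leqNgt ltn_ord.
elim=> [|k IH] w hw.
  have /choice[s hs] : forall i, exists l, w i = delta_mx ord0 l by move=> i; exact: hw.
  by rewrite -(a0 s); congr a; apply/funext.
have [jk|kj] := leqP j k.
  by apply: IH => i ki; have := leq_ltn_trans ki (ltn_ord i); rewrite ltnNge jk.
rewrite -[w](set_at_id w (Ordinal kj)) (row_sum_delta (w (Ordinal kj))).
rewrite multilinear_sum big1 // => l _; rewrite IH ?mulr0 // => i ki; rewrite /set_at /=.
case: eqP => [_|/eqP ik]; first by exists l.
by apply: hw; rewrite ltn_neqAle ki andbT eq_sym.
Qed.

End multilinear.

Lemma alternating_lin j (I : Type) (r : seq I) (P : pred I) (c : I -> R) (a : I -> form j) :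
  (forall i, P i -> alternating_form (a i)) ->
  alternating_form (fun v => \sum_(i <- r | P i) c i * a i v).
Proof.
move=> ha; split.
  move=> v i d x y; rewrite mulr_sumr -big_split; apply: eq_bigr => k Pk.
  by have [-> _] := ha k Pk; rewrite mulrDr mulrCA.
move=> v i1 i2 i12 v12; rewrite big1 // => k Pk.
by have [_ /(_ v i1 i2 i12 v12) ->] := ha k Pk; rewrite mulr0.
Qed.

Lemma alternatingB j (a b : form j) : alternating_form a -> alternating_form b ->
  alternating_form (fun v => a v - b v).
Proof.
move=> [ma aa] [mb ab]; split; first by move=> v i c x y; rewrite ma mb; ring.
by move=> v i1 i2 h h'; rewrite (aa v i1 i2) // (ab v i1 i2) // subr0.
Qed.

Lemma alternatingZ j (c : R) (a : form j) : alternating_form a ->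
  alternating_form (fun v => c * a v).
Proof.
move=> [ma aa]; split; first by move=> v i d x y; rewrite ma; ring.
by move=> v i1 i2 h h'; rewrite (aa v i1 i2) // mulr0.
Qed.

Lemma alternating0 j : alternating_form (fun _ : 'I_j -> vec => 0).
Proof. by split=> // v i c x y; rewrite mulr0 addr0. Qed.

Section alternating_form.
Variables (j : nat) (a : form j).
Hypothesis aa : alternating_form a.

Lemma alternating_swap v (i1 i2 : 'I_j) : i1 != i2 ->
  a (v \o tperm i1 i2) = - a v.
Proof.
move=> i12; have [ma za] := aa.
pose B x y := a (set_at (set_at v i1 x) i2 y).
have BDr x y y' : B x (y + y') = B x y + B x y'.
  by rewrite /B -[y in LHS]scale1r (multilinear_set ma) mul1r.
have Bsw x y : set_at (set_at v i1 x) i2 y = set_at (set_at v i2 y) i1 x.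
  apply/funext => k; rewrite /set_at /=; have [->|//] := eqVneq k i2.
  by rewrite eq_sym (negPf i12).
have BDl x x' y : B (x + x') y = B x y + B x' y.
  by rewrite /B !Bsw -[x in LHS]scale1r (multilinear_set ma) mul1r.
have B0 x : B x x = 0.
  by apply: (za _ i1 i2 i12); rewrite /set_at /= !eqxx (negPf i12).
have := B0 (v i1 + v i2); rewrite BDl !BDr !B0 add0r addr0.
have -> : B (v i1) (v i2) = a v by rewrite /B !set_at_id.
have -> : B (v i2) (v i1) = a (v \o tperm i1 i2).
  congr a; apply/funext => k; rewrite /set_at /=.
  case: (tpermP i1 i2 k) => [->|->|/eqP/negPf h1 /eqP/negPf h2].
  - by rewrite (negPf i12) eqxx.
  - by rewrite eqxx.
  - by rewrite h1 h2.
lra.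
Qed.

Lemma alternating_perm v (p : 'S_j) : a (v \o p) = 0 -> a v = 0.
Proof.
have [ts -> dts] := prod_tpermP p.
elim: ts v dts => [|t ts IH] v /=.
  by rewrite big_nil (_ : v \o _ = v) //; apply/funext => k /=; rewrite perm1.
move=> /andP[dt dts]; rewrite big_cons.
rewrite (_ : v \o _ = (v \o (\prod_(j <- ts) tperm j.1 j.2)%g) \o tperm t.1 t.2); last first.
  by apply/funext => k /=; rewrite permM.
rewrite alternating_swap // => /eqP; rewrite oppr_eq0 => /eqP; exact: IH.
Qed.

(** A repeated index gives [0] by alternation; distinct indices are sorted by a permutation, which
    changes the value only by a sign. *)
Lemma alternating_eq0 :
  (forall s : {ffun 'I_j -> 'I_n}, increasing s -> a (basis_tuple s) = 0) ->
  forall v, a v = 0.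
Proof.
move=> a0; have [ma za] := aa; apply: (multilinear_eq0 ma) => s.
have [/injectiveP si|] := boolP (injectiveb s); last first.
  move=> /injectivePn[i1 [i2 i12 E]]; apply: (za _ i1 i2 i12).
  by rewrite /basis_tuple E.
pose t := [tuple s i | i < j]; pose le := (fun x y : 'I_n => (x <= y)%N).
have /tuple_permP[p pE] : perm_eq (sort le t) t by rewrite perm_sort.
apply: (@alternating_perm _ p).
rewrite (_ : _ \o _ = basis_tuple (finfun (s \o p))); last first.
  by apply/funext => k; rewrite /basis_tuple /= ffunE.
apply: a0; apply/forallP => i1; apply/forallP => i2; apply/implyP => i12.
rewrite !ffunE /= ltn_neqAle; apply/andP; split.
  apply/negP => /eqP/val_inj/si/perm_inj E; by rewrite E ltnn in i12.
have st : sorted le (sort le t) by apply: sort_sorted => x y; exact: leq_total.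
have nthE (i : 'I_j) : nth (s i) (sort le t) i = s (p i).
  have szt : size (sort le t) = j by rewrite size_sort size_tuple.
  rewrite {}pE.
  by rewrite -(tnth_nth (s i) [tuple tnth t (p i) | i < j]) !tnth_mktuple.
have le_tr : transitive le by move=> x y z; exact: leq_trans.
have szt : size (sort le t) = j by rewrite size_sort size_tuple.
have := sorted_leq_nth le_tr (fun x => leqnn x) (s i1) st.
move=> /(_ i1 i2); rewrite !inE szt !ltn_ord => /(_ isT isT (ltnW i12)).
by rewrite /le nthE (set_nth_default (s i2)) ?szt ?ltn_ord // nthE.
Qed.

End alternating_form.

Lemma alternating_ext j (a b : form j) : alternating_form a -> alternating_form b ->
  (forall s : {ffun 'I_j -> 'I_n}, increasing s -> a (basis_tuple s) = b (basis_tuple s)) ->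
  forall v, a v = b v.
Proof.
move=> ha hb ab v; apply/eqP; rewrite -subr_eq0; apply/eqP.
apply: (alternating_eq0 (alternatingB ha hb)) => s si.
by rewrite ab // subrr.
Qed.

Lemma alt_ipE j (a b : form j) : alt_ip a b =
  \sum_(s : {ffun 'I_j -> 'I_n} | increasing s) a (basis_tuple s) * b (basis_tuple s).
Proof. by []. Qed.

Lemma alt_ip_ge0 j (a : form j) : 0 <= alt_ip a a.
Proof. by apply: sumr_ge0 => s _; rewrite -expr2 sqr_ge0. Qed.

Lemma alt_ip_eq0 j (a : form j) : alternating_form a -> alt_ip a a = 0 ->
  forall v, a v = 0.
Proof.
move=> ha /eqP; rewrite psumr_eq0; last by move=> s _; rewrite -expr2 sqr_ge0.
move=> /allP h; apply: (alternating_eq0 ha) => s si.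
by have := h s (mem_index_enum _); rewrite si /= -expr2 expf_eq0 /= => /eqP.
Qed.

Lemma alt_ipBl j (a b c : form j) : alt_ip (fun v => a v - b v) c = alt_ip a c - alt_ip b c.
Proof. by rewrite /alt_ip -sumrB; apply: eq_bigr => s _; rewrite mulrBl. Qed.

Lemma alt_ipZl j (d : R) (a c : form j) : alt_ip (fun v => d * a v) c = d * alt_ip a c.
Proof. by rewrite /alt_ip mulr_sumr; apply: eq_bigr => s _; rewrite mulrA. Qed.

Lemma alt_ipC j (a b : form j) : alt_ip a b = alt_ip b a.
Proof. by apply: eq_bigr => s _; rewrite mulrC. Qed.

Lemma alt_ip_sumr j (I : Type) (r : seq I) (P : pred I) (c : I -> R) (a : form j)
    (b : I -> form j) :
  alt_ip a (fun v => \sum_(i <- r | P i) c i * b i v) =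
  \sum_(i <- r | P i) c i * alt_ip a (b i).
Proof.
rewrite /alt_ip; under eq_bigr do rewrite mulr_sumr.
rewrite exchange_big; apply: eq_bigr => i _; rewrite mulr_sumr.
by apply: eq_bigr => s _; rewrite mulrCA.
Qed.

Section dual_basis.
Variable j : nat.
Implicit Types s t : {ffun 'I_j -> 'I_n}.

(** The wedge product of the coordinate forms with indices [s], written as a minor. *)
Definition dual_basis s : form j := fun v => \det (\matrix_(i, k) v i ord0 (s k)).

Lemma dual_basis_alternating s : alternating_form (dual_basis s).
Proof.
split.
  move=> v i c x y; rewrite /dual_basis -[X in _ = _ + X]mul1r.
  apply: (@determinant_multilinear _ _ _ _ _ i).
  - by apply/rowP => k; rewrite !mxE /= eqxx !mxE mul1r.
  - by apply/matrixP => l k; rewrite !mxE /= eq_sym (negPf (neq_lift _ _)).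
  - by apply/matrixP => l k; rewrite !mxE /= eq_sym (negPf (neq_lift _ _)).
move=> v i1 i2 i12 v12; apply: (determinant_alternate i12) => k.
by rewrite !mxE v12.
Qed.

Lemma increasing_inj s : increasing s -> injective s.
Proof.
move=> /forallP si i1 i2 E; apply/eqP/negPn/negP => i12.
have [h|h|h] := ltngtP i1 i2; last by move/val_inj: h i12 => ->; rewrite eqxx.
  by have /forallP/(_ i2)/implyP/(_ h) := si i1; rewrite E ltnn.
by have /forallP/(_ i1)/implyP/(_ h) := si i2; rewrite E ltnn.
Qed.

Lemma increasing_eq s t : increasing s -> increasing t ->
  (forall k, exists i, t i = s k) -> s = t.
Proof.
move=> si ti st.
have srt (u : {ffun 'I_j -> 'I_n}) : increasing u ->
    sorted (fun x y : 'I_n => (x < y)%N) [seq u i | i <- enum 'I_j].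
  move=> ui; rewrite sorted_map.
  apply: (@sub_sorted _ (fun x y : 'I_j => (x < y)%N)).
    by move=> x y xy; have /forallP/(_ x)/forallP/(_ y)/implyP/(_ xy) := ui.
  by rewrite -(@sorted_map _ _ val ltn) val_enum_ord iota_ltn_sorted.
have E : [seq s i | i <- enum 'I_j] = [seq t i | i <- enum 'I_j].
  apply: (@irr_sorted_eq _ (fun x y : 'I_n => (x < y)%N)) => //.
  - by move=> x y z; exact: ltn_trans.
  - by move=> x; exact: ltnn.
  - exact: srt.
  - exact: srt.
  have [] := @uniq_min_size _ [seq s i | i <- enum 'I_j] [seq t i | i <- enum 'I_j].
  - by rewrite map_inj_uniq ?enum_uniq //; exact: increasing_inj.
  - move=> x /mapP[k _ ->]; have [i <-] := st k.
    by apply: map_f; rewrite mem_enum.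
  - by rewrite !size_map.
  - by [].
by apply/ffunP => i; have /eq_in_map/(_ i) := E; rewrite mem_enum => ->.
Qed.

Lemma dual_basisE s t : increasing s -> increasing t ->
  dual_basis s (basis_tuple t) = (s == t)%:R.
Proof.
move=> si ti; have [->|st] := eqVneq s t.
  rewrite /dual_basis (_ : matrix_of_fun _ _ = 1%:M) ?det1 //.
  by apply/matrixP => i k; rewrite !mxE eqxx /= eq_sym (inj_eq (increasing_inj ti)).
have [k hk] : exists k, forall i, t i <> s k.
  apply: contrapT => h; move/eqP: st; apply; apply: increasing_eq => // k.
  by apply: contrapT => h'; apply: h; exists k => i E; apply: h'; exists i.
rewrite /dual_basis (expand_det_col _ k) big1 // => i _; rewrite mxE mxE eqxx /=.
by case: eqP => [/esym E|]; [case: (hk i)|rewrite mul0r].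
Qed.

Lemma dual_basis_sum (a : form j) : alternating_form a ->
  forall v, a v = \sum_(s : {ffun 'I_j -> 'I_n} | increasing s)
     a (basis_tuple s) * dual_basis s v.
Proof.
move=> ha; apply: alternating_ext => //.
  by apply: alternating_lin => s _; exact: dual_basis_alternating.
move=> t ti; rewrite (bigD1 t) //= dual_basisE // eqxx mulr1 big1 ?addr0 // => s.
by move=> /andP[si st]; rewrite dual_basisE // (negPf st) mulr0.
Qed.

End dual_basis.

Lemma vconsE k (x : vec) (v : 'I_k -> vec) : vcons x v = set_at (vcons 0 v) ord0 x.
Proof.
apply/funext => i; rewrite /vcons /set_at /=.
by case: unliftP => [l ->|->]; rewrite ?eqxx // eq_sym (negPf (neq_lift _ _)).
Qed.

Lemma vcons_sum k (a : form k.+1) (x : vec) v : multilinear_form a ->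
  a (vcons x v) = \sum_i x ord0 i * a (vcons (delta_mx ord0 i) v).
Proof.
move=> ma; rewrite vconsE (row_sum_delta x) (multilinear_sum ma).
by apply: eq_bigr => i _; rewrite -vconsE -row_sum_delta.
Qed.

Lemma vcons_alternating k (a : form k.+1) (x : vec) : alternating_form a ->
  alternating_form (fun v => a (vcons x v)).
Proof.
have E v i y : vcons x (set_at v i y) = set_at (vcons x v) (lift ord0 i) y.
  apply/funext => l; rewrite /vcons /set_at /=; case: unliftP => [l' ->|->].
    by rewrite (inj_eq (@lift_inj _ _)).
  by rewrite (negPf (neq_lift _ _)).
move=> [ma aa]; split.
  by move=> v i c y z; rewrite !E (multilinear_set ma).
move=> v i1 i2 i12 v12; apply: (aa _ (lift ord0 i1) (lift ord0 i2)).
  by rewrite (inj_eq (@lift_inj _ _)).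
by rewrite /vcons !liftK.
Qed.

(* The adjoint of [phi |-> (phi (vcons e_i .))_i]: for [q i] the derivatives of
   a form this is its exterior derivative. *)
Lemma riesz k (q : 'I_n -> form k) : exists W : form k.+1, alternating_form W /\
  forall phi : form k.+1, alternating_form phi ->
  alt_ip W phi = \sum_i alt_ip (q i) (fun v => phi (vcons (delta_mx ord0 i) v)).
Proof.
pose F (phi : form k.+1) := \sum_i alt_ip (q i) (fun v => phi (vcons (delta_mx ord0 i) v)).
pose W v := \sum_(s : {ffun 'I_k.+1 -> 'I_n} | increasing s) F (dual_basis s) * dual_basis s v.
have aW : alternating_form W by apply: alternating_lin => s _; exact: dual_basis_alternating.
exists W; split=> // phi ha; rewrite -/(F phi).
have -> : F phi = \sum_(s : {ffun 'I_k.+1 -> 'I_n} | increasing s)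
    phi (basis_tuple s) * F (dual_basis s).
  under [RHS]eq_bigr do rewrite /F mulr_sumr.
  rewrite exchange_big; apply: eq_bigr => i _ /=; rewrite -alt_ip_sumr.
  by congr alt_ip; apply/funext => v; exact: dual_basis_sum.
rewrite alt_ipE; apply: eq_bigr => t ti; rewrite mulrC; congr (_ * _).
rewrite /W (bigD1 t) //= dual_basisE // eqxx mulr1 big1 ?addr0 // => s.
by move=> /andP[si st]; rewrite dual_basisE // (negPf st) mulr0.
Qed.

End alternating.

(** * Piecewise affine forms and their jumps *)

Section affine_forms.
Variables (R : realType) (n : nat).
Local Notation vec := 'rV[R]_n.
Local Notation mu := (lebesgue_rV R n).

Definition affine_form j (p : diff_form R n j) :=
  (forall x, alternating_form (p x)) /\ forall v, affine (fun x => p x v).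

Lemma monomial_affine (m : {ffun 'I_n -> 'I_2}) : (\sum_i m i <= 1)%N ->
  affine (fun x : vec => \prod_i x ord0 i ^+ m i).
Proof.
move=> hm; have [[i0 mi0]|h] := pselect (exists i0, m i0 != ord0); last first.
  rewrite (_ : (fun x => _) = fun=> 1); first exact: affine_cst.
  apply/funext => x; rewrite big1 // => i _; have [->|mi] := eqVneq (m i) ord0.
    exact: expr0.
  by case: h; exists i.
have m1 : (0 < m i0)%N by rewrite lt0n.
move: hm; rewrite (bigD1 i0) //=; have := ltn_ord (m i0).
case E: (nat_of_ord (m i0)) m1 => [|[|k]] // _ _.
rewrite add1n ltnS leqn0 sum_nat_eq0 => /forall_inP h0.
exists 0, (delta_mx ord0 i0) => x; rewrite (bigD1 i0) //= E expr1 add0r dotC dot_delta.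
by rewrite big1 ?mulr1 // => i ii0; rewrite (eqP (h0 i ii0)).
Qed.

Lemma poly_fun_affine (f : vec -> R) : poly_fun 1 f -> affine f.
Proof.
move=> [c fE]; rewrite (_ : f = fun x => \sum_(m : {ffun 'I_n -> 'I_2} |
  (\sum_i m i <= 1)%N) c m * \prod_i x ord0 i ^+ m i); last exact/funext.
by apply: affine_sum => m hm; apply: affineZ; exact: monomial_affine.
Qed.

Lemma affine_poly_fun (f : vec -> R) : affine f -> poly_fun 1 f.
Proof.
move=> [c [N fE]].
pose z : {ffun 'I_n -> 'I_2} := [ffun=> ord0].
pose d (i : 'I_n) : {ffun 'I_n -> 'I_2} := [ffun k => if k == i then ord_max else ord0].
have dinj : injective d.
  by move=> i k /ffunP/(_ i); rewrite !ffunE eqxx; case: eqP.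
have dz i : d i != z.
  by apply/eqP => /ffunP/(_ i); rewrite !ffunE eqxx.
exists (fun m => (if m == z then c else 0) + \sum_i (if m == d i then N ord0 i else 0)).
move=> x; rewrite fE; pose F (m : {ffun 'I_n -> 'I_2}) := \prod_i x ord0 i ^+ m i.
have Fz : F z = 1 by rewrite /F big1 // => i _; rewrite ffunE expr0.
have Fd i : F (d i) = x ord0 i.
  rewrite /F (bigD1 i) //= ffunE eqxx expr1 big1 ?mulr1 // => k ki.
  by rewrite ffunE (negPf ki) expr0.
have hz : (\sum_i z i <= 1)%N by rewrite big1 // => i _; rewrite ffunE.
have hd i : (\sum_k d i k <= 1)%N.
  rewrite (bigD1 i) //= ffunE eqxx big1 // => k ki.
  by rewrite ffunE (negPf ki).
under eq_bigr do rewrite mulrDl mulr_suml.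
rewrite big_split /=; congr (_ + _).
  rewrite (bigD1 z) //= eqxx -/(F z) Fz mulr1 big1 ?addr0 // => m /andP[_ mz].
  by rewrite (negPf mz) mul0r.
rewrite exchange_big /dot; apply: eq_bigr => i _ /=.
rewrite (bigD1 (d i)) //= eqxx -/(F (d i)) Fd big1 ?addr0 // => m /andP[_ mz].
by rewrite (negPf mz) mul0r.
Qed.

Lemma poly_form1E j (p : diff_form R n j) : poly_form 1 p <-> affine_form p.
Proof.
by split=> -[pa pp]; split=> // v; [exact: poly_fun_affine|exact: affine_poly_fun].
Qed.

Lemma poly_fun0 (f : vec -> R) : poly_fun 0 f -> forall x, f x = f 0.
Proof.
move=> [c fE] x; rewrite !fE; apply: eq_bigr => m _; congr (_ * _).
by apply: eq_bigr => i _; rewrite (ord1 (m i)) !expr0.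
Qed.

(** The forms [a] and [b] have constant coefficients, and contraction with the position vector is
    linear in it. *)
Lemma whitney_affine j (p : diff_form R n j) : whitney_form p -> affine_form p.
Proof.
move=> [a [b [[aa pa] [ab pb] pE]]].
have pE' x v : p x v = a 0 v + b 0 (vcons x v).
  by rewrite pE /kappa (poly_fun0 (pa v)) (poly_fun0 (pb (vcons x v))).
have hE x : p x = fun v => a 0 v + b 0 (vcons x v) by apply/funext => v.
split=> [x|v].
  have hb := vcons_alternating x (ab 0); rewrite hE.
  have [ma za] := aa 0; have [mb zb] := hb; split.
    by move=> v i c y z; rewrite ma mb; ring.
  by move=> v i1 i2 h h'; rewrite (za v i1 i2) // (zb v i1 i2) // addr0.
exists (a 0 v), (\row_i b 0 (vcons (delta_mx ord0 i) v)) => x.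
rewrite pE' (vcons_sum x v (ab 0).1); congr (_ + _).
by apply: eq_bigr => i _; rewrite mxE mulrC.
Qed.

Lemma affine_open_eq0 (f : vec -> R) (U : set vec) x : affine f -> open U -> U x ->
  (forall y, U y -> f y = 0) -> forall y, f y = 0.
Proof.
move=> af oU Ux fU y.
have /nbhs_ballP[r /= r0 hr] : nbhs x U by apply: open_nbhs_nbhs.
pose t := r / (`|y - x| + 1) / 2.
have t0 : 0 < t by rewrite !divr_gt0 // ltr_wpDl.
have : f (x + t *: (y - x)) = 0.
  apply: fU; apply: hr; rewrite -ball_normE /ball_ /= opprD addrA subrr sub0r normrN.
  rewrite normrZ gtr0_norm // /t mulrAC ltr_pdivrMr // mulrAC ltr_pdivrMr ?ltr_wpDl //.
  by rewrite -mulrA ltr_pM2l //; have := normr_ge0 (y - x); lra.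
rewrite affine_line // (fU x Ux) subr0 add0r => /eqP.
by rewrite mulf_eq0 (gt_eqF t0) => /eqP.
Qed.

Lemma ae_open_eq0 (f : vec -> R) (U : set vec) : continuous f -> open U ->
  {ae mu, forall y, U y -> f y = 0} -> forall y, U y -> f y = 0.
Proof.
move=> cf oU [A [mA A0 hA]] y Uy; apply: contrapT => fy.
pose V := U `&` [set z | f z != 0].
have oV : open V.
  apply: openI => //; apply: (@open_comp _ _ f [set t | t != 0]); last exact: open_neq.
  by move=> z _; exact: cf.
have Vy : V y by split=> //; exact/eqP.
have := lebesgue_rV_open_gt0 oV Vy; rewrite -A0 ltNge => /negP; apply.
apply: le_measure; rewrite ?inE //; first exact: measurable_rV_open.
by move=> z [Uz /= /eqP fz]; apply: hA => /(_ Uz).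
Qed.

(** The interior of an element is open and nonempty, so almost everywhere equality gives equality
    there, and an affine function is determined by its values on an open set. Hence the choice made
    by [restriction] is unique. *)
Lemma affine_form_unique j (p q : diff_form R n j) T : simplex n T ->
  affine_form p -> affine_form q ->
  {ae mu, forall x, conv_hull T x -> p x = q x} -> p = q.
Proof.
move=> sT [_ ap] [_ aq] pq; apply/funext => x; apply/funext => v.
apply/eqP; rewrite -subr_eq0; apply/eqP.
have aB : affine (fun x => p x v - q x v).
  by apply: affineD => //; under eq_fun do rewrite -mulN1r; exact: affineZ.
have [y yT] := inner_nonempty sT.
apply: (affine_open_eq0 aB (inner_open sT) yT).
apply: ae_open_eq0; [exact: affine_continuous|exact: inner_open|].
by apply: filterS pq => z h /(inner_conv_hull sT)/h ->; rewrite subrr.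
Qed.

Lemma restrictionE j (u p : diff_form R n j) T : simplex n T -> affine_form p ->
  ae_eq_on (conv_hull T) u p -> restriction u T = p.
Proof.
move=> sT ap up; rewrite /restriction.
case: xgetP => [q _ [/poly_form1E aq uq]|/(_ p)]; last by case; split=> //; exact/poly_form1E.
apply: (affine_form_unique sT aq ap).
by apply: filterS (filterI up uq) => x [h1 h2] Tx; rewrite -h1 // -h2.
Qed.

Lemma affine_alt_ip j (p : diff_form R n j) a : affine_form p ->
  affine (fun y => alt_ip (p y) a).
Proof.
move=> [_ ap]; apply: affine_sum => s _.
by under eq_fun do rewrite mulrC; exact: affineZ.
Qed.

Lemma measurable_alt_ip j (D : set vec) (u w : diff_form R n j) :
  (forall v, measurable_fun D (fun x => u x v)) ->
  (forall v, measurable_fun D (fun x => w x v)) ->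
  measurable_fun D (fun x => alt_ip (u x) (w x)).
Proof.
move=> mu_ mw; rewrite (_ : (fun x => _) = fun x => \sum_(s <- index_enum {ffun 'I_j ->
  'I_n} | increasing s)
  u x (basis_tuple R s) * w x (basis_tuple R s)) //.
elim: (index_enum _) => [|s r IH]; first by under eq_fun do rewrite big_nil;
  exact: measurable_cst.
under eq_fun do rewrite big_cons.
by case: (increasing s) => //; apply: measurable_funD => //; exact: measurable_funM.
Qed.

(** The analytic half of [L2_form], on which the integrability of pairings rests; it also covers
    [codiff phi]. *)
Definition L2_measurable j (Om : set vec) (u : diff_form R n j) : Prop :=
  (forall v, measurable_fun Om (fun x => u x v)) /\
  (\int[mu]_(x in Om) (alt_ip (u x) (u x))%:E < +oo)%E.

Lemma L2_form_measurable j (Om : set vec) (u : diff_form R n j) :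
  L2_form Om u -> L2_measurable Om u.
Proof. by case. Qed.

Lemma alt_ip_le j (a b : ('I_j -> vec) -> R) :
  `|alt_ip a b| <= alt_ip a a + alt_ip b b.
Proof.
rewrite /alt_ip -big_split; apply: (le_trans (ler_norm_sum _ _ _)).
apply: ler_sum => s _ /=; set x := a _; set y := b _.
by rewrite ler_norml; apply/andP; split; nra.
Qed.

Lemma L2_integrable j (Om : set vec) (u w : diff_form R n j) : measurable Om ->
  L2_measurable Om u -> L2_measurable Om w ->
  mu.-integrable Om (EFin \o (fun x => alt_ip (u x) (w x))).
Proof.
move=> mOm [mu_ iu] [mw iw].
have i2 (t : diff_form R n j) : (forall v, measurable_fun Om (fun x => t x v)) ->
    (\int[mu]_(x in Om) (alt_ip (t x) (t x))%:E < +oo)%E ->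
    mu.-integrable Om (EFin \o (fun x => alt_ip (t x) (t x))).
  move=> mt it; apply/integrableP; split.
    by apply/measurable_EFinP; exact: measurable_alt_ip.
  by under eq_integral do rewrite /= ger0_norm ?alt_ip_ge0 //.
apply: (@le_integrable _ _ _ mu Om mOm _
  (EFin \o (fun x => alt_ip (u x) (u x)) \+ (EFin \o (fun x => alt_ip (w x) (w x))))%E).
- by apply/measurable_EFinP; exact: measurable_alt_ip.
- move=> x _ /=; rewrite lee_fin; apply: (le_trans (alt_ip_le _ _)).
  exact: ler_norm.
- by apply: integrableD => //; exact: i2.
Qed.

Lemma bounded_L2 j (Om : set vec) (u : diff_form R n j) : measurable Om ->
  (forall v, bounded_support (fun x => u x v)) -> L2_measurable Om u.
Proof.
move=> mOm bu; split; first by move=> v; apply: measurable_funTS; case: (bu v).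
have b : bounded_support (fun x => alt_ip (u x) (u x)).
  apply: bounded_support_sum => s _; apply: bounded_supportZ => //.
    by case: (bu (basis_tuple R s)).
  by have [_ [M hM]] := bu (basis_tuple R s); exists M => y _; exact: (hM y).1.
have /integrableP[_] := bounded_support_integrable mOm b.
by under eq_integral do rewrite /= ger0_norm ?alt_ip_ge0 //.
Qed.

Lemma test_form_smooth j (Om : set vec) (phi : diff_form R n j) v : test_form Om phi ->
  compact_smooth (fun x => phi x v).
Proof.
by move=> [_ sphi [K [cK _ phiK]]]; split=> //; exists K => // x /phiK.
Qed.

Lemma test_form_L2 j (Om : set vec) (phi : diff_form R n j) : measurable Om ->
  test_form Om phi -> L2_measurable Om phi.
Proof.
move=> mOm tphi; apply: bounded_L2 => // v.
by apply: compact_smooth_bounded; exact: test_form_smooth tphi.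
Qed.

Lemma codiff_smooth j (Om : set vec) (phi : diff_form R n j.+1) v : test_form Om phi ->
  compact_smooth (fun x => codiff phi x v).
Proof.
move=> tphi; rewrite /codiff.
under eq_fun do rewrite -mulN1r; apply: compact_smoothMl; first exact: smooth_cst.
apply: (@compact_smooth_sum _ _ 'I_n) => i; apply: compact_smooth_derive.
exact: test_form_smooth tphi.
Qed.

Lemma codiff_L2 j (Om : set vec) (phi : diff_form R n j.+1) : measurable Om ->
  test_form Om phi -> L2_measurable Om (codiff phi).
Proof.
move=> mOm tphi; apply: bounded_L2 => // v.
by apply: compact_smooth_bounded; exact: codiff_smooth tphi.
Qed.

End affine_forms.

(** * Tangential jumps of piecewise affine forms with a weak derivative *)

Section jump.
Variables (R : realType) (n : nat).
Local Notation vec := 'rV[R]_n.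
Local Notation mu := (lebesgue_rV R n).
Local Notation contract phi i := (fun v => phi (vcons (delta_mx ord0 i) v)).

Lemma Rintegral_sub (D : set vec) (f : vec -> R) : measurable D ->
  (forall y, ~ D y -> f y = 0) -> \int[mu]_(y in D) f y = \int[mu]_y f y.
Proof.
move=> mD f0; rewrite Rintegral_indic //; apply: eq_Rintegral => y _.
have [Dy|Dy] := pselect (D y); first by rewrite indicE mem_set // mul1r.
by rewrite f0 // mulr0.
Qed.

Lemma Rintegral_le0_ae (D : set vec) (f : vec -> R) : measurable D -> bounded_support f ->
  (forall y, D y -> 0 <= f y) -> \int[mu]_(y in D) f y <= 0 ->
  {ae mu, forall y, D y -> f y = 0}.
Proof.
move=> mD bf f0 h.
have fint := bounded_support_integrable mD bf.
have E : (\int[mu]_(y in D) `|(f y)%:E| = 0)%E.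
  rewrite (@eq_integral _ _ _ mu _ (EFin \o f)); last first.
    by move=> y /set_mem Dy; rewrite /= ger0_norm // f0.
  rewrite -(fineK (integrable_fin_num mD fint)); congr EFin; apply/eqP.
  rewrite eq_le h /=; apply: fine_ge0; apply: integral_ge0 => y Dy.
  by rewrite lee_fin f0.
have mf : measurable_fun D (EFin \o f) by apply/measurable_EFinP/measurable_funTS; case: bf.
have /ae_eq_integral_abs := E.
move=> /(_ mD mf); apply: filterS => y hy Dy.
by have := hy Dy => -[].
Qed.

Lemma codiff_mul k (chi : vec -> R) (phi : ('I_k.+1 -> vec) -> R) y :
  smooth chi -> codiff (fun y v => chi y * phi v) y =
  fun v => \sum_i (- 'D_(delta_mx ord0 i) chi y) * contract phi i v.
Proof.
move=> sc; apply/funext => v; rewrite /codiff -sumrN; apply: eq_bigr => i _.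
by under eq_fun do rewrite mulrC; rewrite derive_mulr // mulNr mulrC.
Qed.

Lemma mul_test_form k (Om K : set vec) (chi : vec -> R) (phi : ('I_k -> vec) -> R) :
  compact K -> K `<=` Om -> smooth chi -> (forall y, ~ K y -> chi y = 0) ->
  alternating_form phi -> test_form Om (fun y v => chi y * phi v).
Proof.
move=> cK KOm sc c0 ap; split.
- by move=> y; exact: alternatingZ.
- by move=> v; under eq_fun do rewrite mulrC; exact: smoothZ.
- by exists K; split=> // y Ky v; rewrite c0 // mul0r.
Qed.

Variables (k : nat) (Om : set vec) (Th : {fset {fset vec}}).
Variables (c : diff_form R n k) (W : diff_form R n k.+1).
Variable p : {fset vec} -> diff_form R n k.
Hypothesis Om_open : open Om.
Hypothesis Th_simplex : forall T, T \in Th -> simplex n T.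
Hypothesis L2c : L2_form Om c.
Hypothesis cW : is_ext_d Om c W.
Hypothesis cp : forall T, T \in Th -> affine_form (p T) /\ ae_eq_on (conv_hull T) c (p T).

Let mOm : measurable Om := measurable_rV_open Om_open.

(** For constant [phi], the vector field whose divergence is the pairing of the exterior derivative
    of [p T] with [phi]. *)
Definition flux T (phi : ('I_k.+1 -> vec) -> R) i y : R := alt_ip (p T y) (contract phi i).

Definition jump T1 T2 (N : vec) (phi : ('I_k.+1 -> vec) -> R) y : R :=
  \sum_i N ord0 i * (flux T1 phi i y - flux T2 phi i y).

Lemma flux_affine T phi i : T \in Th -> affine (flux T phi i).
Proof. by move=> /cp[ap _]; exact: affine_alt_ip. Qed.

(** Contraction with [N] is adjoint to the exterior product with [N]. Letting [phi] vary, this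
    pairing therefore sees exactly the tangential part of the difference of the two forms. *)
Lemma jumpE T1 T2 N phi y : multilinear_form phi ->
  jump T1 T2 N phi y =
  alt_ip (fun v => p T1 y v - p T2 y v) (fun v => phi (vcons N v)).
Proof.
move=> mphi; rewrite (_ : (fun v => phi _) =
    fun v => \sum_i N ord0 i * contract phi i v); last first.
  by apply/funext => v; exact: vcons_sum.
rewrite alt_ip_sumr; apply: eq_bigr => i _; congr (_ * _).
by rewrite alt_ipBl.
Qed.

Lemma jump_affine T1 T2 N phi : T1 \in Th -> T2 \in Th -> affine (jump T1 T2 N phi).
Proof.
move=> h1 h2; apply: affine_sum => i _; apply: affineZ; apply: affineD; first exact: flux_affine.
by under eq_fun do rewrite -mulN1r; apply: affineZ; exact: flux_affine.
Qed.

(* The weak derivative tested against [chi phi]. *)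
Lemma jump_test T1 T2 c0 N z phi K (chi : vec -> R) :
  facing Om Th T1 T2 c0 N z -> alternating_form phi ->
  compact K -> (forall y, K y -> Om y /\ ((0 < c0 + dot N y -> inner T1 y) /\
                                 (c0 + dot N y < 0 -> inner T2 y))) ->
  smooth chi -> (forall y, ~ K y -> chi y = 0) ->
  let H := [set y | 0 < c0 + dot N y] in
  let g y := \1_H y * divergence (flux T1 phi) y +
     (1 - \1_H y) * divergence (flux T2 phi) y - alt_ip (W y) phi in
  mu.-integrable Om (EFin \o (fun y => chi y * g y)) /\
  \int[mu]_(y in H) 'D_N (fun y => chi y * jump T1 T2 N phi y) y =
    dot N N * \int[mu]_(y in Om) (chi y * g y).
Proof.
move=> [T1h T2h N0 lz _] aphi cK hK schi chi0 H g.
have KOm : K `<=` Om by move=> y /hK[].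
have mH : measurable H := halfspace_measurable c0 N.
have tPhi := mul_test_form cK KOm schi chi0 aphi.
have cchi : compact_smooth chi by split=> //; exists K.
have sF T i : T \in Th -> smooth (flux T phi i).
  by move=> TTh; apply: affine_smooth; exact: flux_affine.
pose D y := \1_H y * divergence (flux T1 phi) y + (1 - \1_H y) * divergence (flux T2 phi) y.
have sD T : T \in Th -> smooth (divergence (flux T phi)).
  by move=> TTh; apply: smooth_divergence => i; exact: sF.
have cD T : T \in Th -> bounded_support (fun y => chi y * divergence (flux T phi) y).
  by move=> TTh; apply: compact_smooth_bounded; apply: compact_smoothM => //; exact: sD.
have bD : bounded_support (fun y => chi y * D y).
  rewrite (_ : (fun y => _) = fun y => (\1_H y * (chi y * divergence (flux T1 phi) y)) +
    (chi y * divergence (flux T2 phi) y - \1_H y * (chi y * divergence (flux T2 phi) y))).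
    apply: bounded_supportD; first by apply: bounded_support_indic => //; exact: cD.
    apply: bounded_supportB; first exact: cD.
    by apply: bounded_support_indic => //; exact: cD.
  by apply/funext => y; rewrite /D; ring.
have LW : L2_measurable Om W by apply: L2_form_measurable; case: cW.
have iW : mu.-integrable Om (EFin \o (fun y => chi y * alt_ip (W y) phi)).
  rewrite (_ : (fun y => _) = fun y => alt_ip (W y) (fun v => chi y * phi v)).
    by apply: L2_integrable => //; exact: test_form_L2 tPhi.
  by apply/funext => y; rewrite alt_ipC [RHS]alt_ipC alt_ipZl.
have gE y : chi y * g y = chi y * D y - chi y * alt_ip (W y) phi by rewrite -mulrBr.
have iD : mu.-integrable Om (EFin \o (fun y => chi y * D y)).
  exact: bounded_support_integrable.
split.
  have := integrableB mOm iD iW; congr (_.-integrable _ _); apply/funext => y.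
  by rewrite /= -EFinB gE.
have -> : \int[mu]_(y in Om) (chi y * g y) =
    \int[mu]_y (chi y * D y) - L2_ip Om W (fun y v => chi y * phi v).
  under eq_Rintegral do rewrite gE.
  rewrite RintegralB //; congr (_ - _); last first.
    by apply: eq_Rintegral => y _; rewrite alt_ipC [RHS]alt_ipC alt_ipZl.
  rewrite Rintegral_sub // => y Omy; rewrite chi0 ?mul0r // => /KOm; exact: Omy.
case: cW => LW' <- //.
pose X T i y := chi y * flux T phi i y.
have sX T i : T \in Th -> smooth (X T i).
  by move=> TTh; apply: smoothM => //; exact: sF.
have X0 T i y : ~ K y -> X T i y = 0 by move=> Ky; rewrite /X chi0 // mul0r.
have csX T i : T \in Th -> compact_smooth (X T i).
  by move=> TTh; split; [exact: sX|exists K => // y; exact: X0].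
have bdX T : T \in Th -> bounded_support (divergence (X T)).
  move=> TTh; apply: compact_smooth_bounded; apply: compact_divergence cK _ _.
    by move=> i; exact: sX.
  by move=> i y; exact: X0.
have -> : \int[mu]_(y in H) 'D_N (fun y => chi y * jump T1 T2 N phi y) y =
    dot N N * \int[mu]_(y in H) (divergence (X T1) y - divergence (X T2) y).
  rewrite (_ : (fun y => chi y * jump T1 T2 N phi y) =
      fun y => \sum_i N ord0 i * (X T1 i y - X T2 i y)); last first.
    apply/funext => y; rewrite /jump mulr_sumr; apply: eq_bigr => i _.
    by rewrite mulrCA mulrBr.
  have E y : divergence (X T1) y - divergence (X T2) y =
      divergence (fun i y => X T1 i y - X T2 i y) y.
    rewrite /divergence /= -sumrB; apply: eq_bigr => i _.
    by rewrite derive_sub //; exact: sX.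
  under [in RHS]eq_Rintegral => y _ do rewrite E.
  rewrite (halfspace_div c0 N0); last by move=> i; apply: compact_smoothB; exact: csX.
  by rewrite mulVKf // gt_eqF // dot_gt0.
congr (_ * _).
(* On either side of the hyperplane the Leibniz rule reduces [h] to [- \sum_i D_i chi * flux_i],
   which is the pairing of [c] with the codifferential of [chi phi]. *)
pose h y := chi y * D y - divergence (X T2) y - \1_H y * (divergence (X T1) y - divergence
  (X T2) y).
have bd12 : bounded_support (fun y => divergence (X T1) y - divergence (X T2) y).
  by apply: bounded_supportB; exact: bdX.
have b1 : bounded_support (fun y => \1_H y * (divergence (X T1) y - divergence (X T2) y)).
  exact: bounded_support_indic.
have b2 : bounded_support (fun y => chi y * D y - divergence (X T2) y).
  by apply: bounded_supportB => //; exact: bdX.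
have bh : bounded_support h by exact: bounded_supportB.
have div0 T y : T \in Th -> ~ K y -> divergence (X T) y = 0.
  move=> TTh; apply: (divergence_eq0 (compact_closed_rV cK)) => i w; exact: X0.
have dX T y : T \in Th -> divergence (X T) y = chi y * divergence (flux T phi) y +
   \sum_i 'D_(delta_mx ord0 i) chi y * flux T phi i y.
  by move=> TTh; rewrite /X divergence_mul // => i; exact: sF.
have -> : L2_ip Om c (codiff (fun y v => chi y * phi v)) = \int[mu]_y h y.
  rewrite -(@Rintegral_sub Om h) //; last first.
    move=> y Omy; have Ky : ~ K y by move=> /KOm.
    by rewrite /h chi0 // !div0 // mul0r !subr0 mulr0 subrr.
  apply: Rintegral_ae => //.
  - apply: measurable_alt_ip; first by case: L2c.
    by case: (codiff_L2 mOm tPhi).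
  - by apply: measurable_funTS; case: bh.
  have l0 : {ae mu, forall y, c0 + dot N y != 0}.
    exists [set y | c0 + dot N y = 0]; split; [exact: hyperplane_measurable|exact:
      hyperplane_null|].
    by move=> y /= /negP; rewrite negbK => /eqP.
  have [_ c1] := cp T1h; have [_ c2] := cp T2h.
  apply: filterS (filterI l0 (filterI c1 c2)) => y [ly [cy1 cy2]] _.
  rewrite codiff_mul // alt_ip_sumr.
  have [Ky|Ky] := pselect (K y); last first.
    rewrite /h chi0 // !div0 // mul0r !subr0 mulr0 subrr big1 // => i _.
    by rewrite (@derive_eq0 _ _ chi K _ y (compact_closed_rV cK) chi0 Ky) oppr0 mul0r.
  have [_ [i1 i2]] := hK y Ky; rewrite /h /D.
  have [ln|lp|E] := ltgtP (c0 + dot N y) 0; last by rewrite E eqxx in ly.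
    rewrite cy2; last by apply: inner_conv_hull; [exact: Th_simplex|exact: i2].
    rewrite indicE memNset; last by rewrite /H /= ltNge (ltW ln).
    rewrite !mul0r !subr0 add0r mul1r dX // opprD addrA subrr add0r -sumrN.
    by apply: eq_bigr => i _; rewrite mulNr.
  rewrite cy1; last by apply: inner_conv_hull; [exact: Th_simplex|exact: i1].
  rewrite indicE mem_set // !mul1r subrr mul0r addr0 opprB addrA subrK.
  rewrite dX // opprD addrA subrr add0r -sumrN.
  by apply: eq_bigr => i _; rewrite mulNr.
have ib f : bounded_support f -> mu.-integrable setT (EFin \o f).
  by move=> bf; exact: bounded_support_integrable.
rewrite /h (@RintegralB _ _ _ mu setT _ _ _ (ib _ b2) (ib _ b1)) //.
rewrite (@RintegralB _ _ _ mu setT _ _ _ (ib _ bD) (ib _ (bdX _ T2h))) //.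
rewrite -Rintegral_indic // (int_divergence cK); last 2 first.
- by move=> i; exact: sX.
- by move=> i y; exact: X0.
by rewrite subr0 opprB addrC subrK.
Qed.

(* The factor [(1 - l^2)^m] added to [chi], where [l] is the affine function
   vanishing on the face, leaves the surface term unchanged and sends the volume
   term to [0]. *)
Lemma jump_test_eq0 T1 T2 c0 N z phi K (chi : vec -> R) :
  facing Om Th T1 T2 c0 N z -> alternating_form phi ->
  compact K -> (forall y, K y -> Om y /\ ((0 < c0 + dot N y -> inner T1 y) /\
                                 (c0 + dot N y < 0 -> inner T2 y))) ->
  (forall y, K y -> `|c0 + dot N y| <= 1) ->
  smooth chi -> (forall y, ~ K y -> chi y = 0) ->
  \int[mu]_(y in [set y | 0 < c0 + dot N y])
    'D_N (fun y => chi y * jump T1 T2 N phi y) y = 0.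
Proof.
move=> fc aphi cK hK lK schi chi0; set H := [set y | _].
have [T1h T2h N0 lz _] := fc.
have mH : measurable H := halfspace_measurable c0 N.
pose l y := c0 + dot N y.
have sl : smooth l by apply: affine_smooth; exists c0, N.
pose b m y := (1 - l y ^+ 2) ^+ m.
have sb m : smooth (b m).
  by apply: smoothX; apply: smoothB; [exact: smooth_cst|exact: smoothX].
have sJ : smooth (jump T1 T2 N phi) by apply: affine_smooth; exact: jump_affine.
pose chi_ m y := chi y * b m y.
have schi_ m : smooth (chi_ m) by exact: smoothM.
have chi_0 m y : ~ K y -> chi_ m y = 0 by move=> /chi0; rewrite /chi_ => ->; rewrite mul0r.
pose g y := \1_H y * divergence (flux T1 phi) y +
     (1 - \1_H y) * divergence (flux T2 phi) y - alt_ip (W y) phi.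
have [ig _] : mu.-integrable Om (EFin \o (fun y => chi y * g y)) /\ _ :=
  jump_test fc aphi cK hK schi chi0.
have hm m : mu.-integrable Om (EFin \o (fun y => chi_ m y * g y)) /\
    \int[mu]_(y in H) 'D_N (fun y => chi_ m y * jump T1 T2 N phi y) y =
    dot N N * \int[mu]_(y in Om) (chi_ m y * g y).
  exact: (jump_test fc aphi cK hK (schi_ m) (chi_0 m)).
have E m : \int[mu]_(y in H) 'D_N (fun y => chi y * jump T1 T2 N phi y) y =
    dot N N * \int[mu]_(y in Om) (chi_ m y * g y).
  rewrite -(hm m).2; apply/eqP; rewrite -subr_eq0; apply/eqP.
  have cs f : smooth f -> (forall y, ~ K y -> f y = 0) ->
      compact_smooth (fun y => f y * jump T1 T2 N phi y).
    by move=> sf f0; apply: compact_smoothM => //; split=> //; exists K.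
  rewrite -RintegralB //; last 2 first.
  - by apply: bounded_support_integrable => //; apply/compact_smooth_bounded/compact_smooth_derive/cs
    .
  - apply: bounded_support_integrable => //; apply/compact_smooth_bounded/compact_smooth_derive/cs => //
    .
    exact: chi_0.
  rewrite -(@halfspace_derive_eq0 _ _ (fun y => chi y * jump T1 T2 N phi y -
     chi_ m y * jump T1 T2 N phi y) c0 N) //.
  - apply: eq_Rintegral => y _; rewrite derive_sub //; first exact: smoothM.
    exact: smoothM.
  - by apply: compact_smoothB; apply: cs => //; exact: chi_0.
  - by move=> y ly; rewrite /chi_ /b /l ly expr0n /= subr0 expr1n mulr1 subrr.
(* As [|l| <= 1] on [K], the base [1 - l^2] lies in [[0, 1)] off the hyperplane: its powers tend to
   [0], and [|chi g|] is a majorant. *)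
have lim : \int[mu]_(y in Om) (chi_ m y * g y) @[m --> \oo] --> (0 : R).
  have := @Rintegral_cvg R n Om (fun m y => chi_ m y * g y) (fun=> 0) (fun y =>
    `|chi y * g y|) mOm.
  rewrite Rintegral_cst // mul0r; apply.
  - by move=> m; have [/integrableP[/measurable_EFinP]] := hm m.
  - exact: measurable_cst.
  - exact: integrable_norm ig.
  - move=> m y _; have [Ky|Ky] := pselect (K y); last by rewrite chi_0 // mul0r normr0.
    have h := lK y Ky; rewrite /chi_ mulrAC normrM ler_piMr // normrX exprn_ile1 //.
    have : l y ^+ 2 <= 1 by rewrite -real_normK ?num_real // exprn_ile1.
    by have := sqr_ge0 (l y); move=> h1 h2; rewrite ger0_norm; lra.
  - exists [set y | c0 + dot N y = 0]; split; [exact: hyperplane_measurable|exact: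
    hyperplane_null|].
    move=> y /=; apply: contra_notP => ly _.
    have [Ky|Ky] := pselect (K y); last first.
      by rewrite (_ : (fun m => _) = fun=> 0) ?chi_0; [exact: cvg_cst|apply/funext => m;
        rewrite chi_0 // mul0r].
    rewrite (_ : (fun m => _) = fun m => (chi y * g y) * (1 - l y ^+ 2) ^+ m); last first.
      by apply/funext => m; rewrite mulrAC.
    rewrite -[X in _ --> X](mulr0 (chi y * g y)); apply: cvgMr.
    apply: cvg_expr.
    have := lK y Ky; rewrite -/(l y) => hl.
    have l2 : 0 < l y ^+ 2 by rewrite exprn_even_gt0 //=; apply/eqP.
    have : l y ^+ 2 <= 1 by rewrite -real_normK ?num_real // exprn_ile1.
    by move=> h; rewrite ger0_norm; lra.
have h : dot N N * \int[mu]_(y in Om) (chi_ m y * g y) @[m --> \oo] --> (0 : R).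
  by rewrite -[X in _ --> X](mulr0 (dot N N)); exact: cvgM (cvg_cst _) lim.
rewrite -(cvg_lim (@norm_hausdorff _ R) h); apply/esym; apply: cvg_lim;
  first exact: norm_hausdorff.
by under eq_fun do rewrite /= -E; exact: cvg_cst.
Qed.

(* If the jump did not vanish at [z], a radial bump [chi] at [z] would satisfy
   [\int_H D_N chi >= 0], whereas [D_N chi < 0] on [H] near [z]. *)
Lemma jump_eq0 T1 T2 c0 N z phi :
  facing Om Th T1 T2 c0 N z -> alternating_form phi -> jump T1 T2 N phi z = 0.
Proof.
move=> fc aphi; have [T1h T2h N0 lz [nz _]] := fc.
have al : affine (fun y => c0 + dot N y) by exists c0, N.
have aJ := jump_affine N phi T1h T2h.
apply: contrapT => /eqP J0; set a := jump T1 T2 N phi z in J0.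
have n1 : \forall y \near z, 0 < a * jump T1 T2 N phi y - a ^+ 2 / 2.
  pose f y := a * jump T1 T2 N phi y + - (a ^+ 2 / 2).
  apply: (@affine_near_gt0 _ _ f).
    by apply: affineD; [exact: affineZ|exact: affine_cst].
  rewrite /f -/a -expr2.
  have : 0 < a ^+ 2 by rewrite exprn_even_gt0.
  by lra.
have n2 : \forall y \near z, 0 < 1 - (c0 + dot N y).
  apply: (@affine_near_gt0 _ _ (fun y => 1 - (c0 + dot N y))).
    apply: affineD; first exact: affine_cst.
    by under eq_fun do rewrite -mulN1r; exact: affineZ.
  by rewrite lz subr0.
have n3 : \forall y \near z, 0 < 1 + (c0 + dot N y).
  apply: (@affine_near_gt0 _ _ (fun y => 1 + (c0 + dot N y))).
    by apply: affineD => //; exact: affine_cst.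
  by rewrite lz addr0.
have [r r0 hr] := near_sqdist (filterI nz (filterI n1 (filterI n2 n3))).
pose K := [set y | sqdist z y <= r].
have cK : compact K := @sqdist_compact _ _ z r.
have hK y : K y -> Om y /\ ((0 < c0 + dot N y -> inner T1 y) /\
                                 (c0 + dot N y < 0 -> inner T2 y)) by move=> /hr[].
have lK y : K y -> `|c0 + dot N y| <= 1.
  by move=> /hr[_ [_ [/= h1 h2]]]; rewrite ler_norml; apply/andP; split; lra.
pose q y := r - sqdist z y.
have sq : smooth q by apply: smoothB; [exact: smooth_cst|exact: sqdist_smooth].
pose chi y := exp_bump 0 (q y).
have schi : smooth chi by exact: smooth_exp_bump.
have chi0 y : ~ K y -> chi y = 0.
  by move=> /negP; rewrite -ltNge => h; rewrite /chi exp_bump_le0 // /q subr_le0 ltW.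
have cchi : compact_smooth chi by split=> //; exists K.
pose H := [set y | 0 < c0 + dot N y].
have mH : measurable H := halfspace_measurable c0 N.
have sJ : smooth (jump T1 T2 N phi) by exact: affine_smooth.
have cJ : compact_smooth (fun y => chi y * jump T1 T2 N phi y) by exact: compact_smoothM.
have I0 : \int[mu]_(y in H) 'D_N (fun y => chi y * jump T1 T2 N phi y) y = 0.
  exact: jump_test_eq0 fc aphi cK hK lK schi chi0.
(* Near [z] one has [a J >= a^2 / 2] for the jump [J], so [f] is non-negative. Its normal derivative
   has integral at most [0] over [H], and the part with [J] contributes [0]; this gives the sign for
   [chi]. *)
pose f y := a * (chi y * jump T1 T2 N phi y) - (a ^+ 2 / 2) * chi y.
have ca b h : compact_smooth h -> compact_smooth (fun y => b * h y).
  by move=> ch; apply: compact_smoothMl => //; exact: smooth_cst.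
have cf : compact_smooth f by apply: compact_smoothB; exact: ca.
have f0 y : 0 <= f y.
  rewrite /f mulrCA [_ * chi y]mulrC -mulrBr.
  have [/hr[_ [h _]]|/chi0->] := pselect (K y); last by rewrite mul0r.
  by apply: mulr_ge0; [exact: exp_bump_ge0|exact: ltW].
have := halfspace_derive_le0 c0 N cf f0.
have Df y : 'D_N f y = a * 'D_N (fun y => chi y * jump T1 T2 N phi y) y -
    (a ^+ 2 / 2) * 'D_N chi y.
  have s1 : smooth (fun y => chi y * jump T1 T2 N phi y) by case: cJ.
  rewrite /f derive_sub; [|exact: smoothZ..].
  by rewrite !derive_mulr.
under eq_Rintegral do rewrite Df.
have bI h : compact_smooth h -> mu.-integrable H (EFin \o 'D_N h).
  by move=> ch; apply: bounded_support_integrable => //; apply: compact_smooth_bounded;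
    exact: compact_smooth_derive.
have bI' b h : compact_smooth h -> mu.-integrable H (EFin \o (fun y => b * 'D_N h y)).
  move=> ch; apply: bounded_support_integrable => //; apply: bounded_support_mulr.
  by apply: compact_smooth_bounded; exact: compact_smooth_derive.
rewrite RintegralB //; [|exact: bI'..].
rewrite !RintegralZl //; [|exact: bI..].
rewrite I0 mulr0 sub0r oppr_le0.
have a2 : 0 < a ^+ 2 / 2 by rewrite divr_gt0 // exprn_even_gt0.
rewrite pmulr_rge0 // => hI.
(* This is minus the normal derivative of [chi]: the derivative of [exp_bump 0] is [exp_bump 2], and
   since [z] is on the hyperplane that of [sqdist z] along [N] is [2 (c0 + dot N y)]. *)
pose e2 y := exp_bump 2 (q y) * (2 * (c0 + dot N y)).
have Dchi y : 'D_N chi y = - e2 y.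
  have := derive_comp1 N (smooth_differentiable y sq) (exp_bump_derive 0 (q y)).
  rewrite -/(chi _) => ->; rewrite oppr0 mul0r add0r /e2 -mulrN; congr (_ * _).
  rewrite /q derive_sub; [|exact: smooth_cst|exact: sqdist_smooth].
  rewrite (derive_cst (r : R)) sub0r; congr (- _).
  have sc i : smooth (fun y : vec => y ord0 i - z ord0 i).
    by apply: affine_smooth; exists (- z ord0 i), (delta_mx ord0 i) => w;
      rewrite dotC dot_delta addrC.
  rewrite /sqdist derive_bigsum; last by move=> i _; exact: smoothX.
  have -> : c0 = - dot N z by apply/eqP; rewrite -addr_eq0 lz.
  rewrite addrC -dotBr.
  rewrite /dot mulr_sumr.
  apply: eq_bigr => i _; rewrite (_ : (fun y => _) = fun y : vec =>
    (y ord0 i - z ord0 i) * (y ord0 i - z ord0 i)); last by apply/funext => w; rewrite expr2.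
  rewrite derive_mul // (@affine_deriveE _ _ _ N (- z ord0 i) (delta_mx ord0 i)); last first.
    by move=> w; rewrite dotC dot_delta addrC.
  by rewrite dotC dot_delta !mxE; ring.
have se2 : bounded_support e2.
  rewrite (_ : e2 = fun y => -1 * 'D_N chi y); last by apply/funext => y;
    rewrite Dchi mulN1r opprK.
  by apply: bounded_support_mulr; apply/compact_smooth_bounded/compact_smooth_derive.
have e20 : {ae mu, forall y, H y -> e2 y = 0}.
  apply: Rintegral_le0_ae => //.
    by move=> y Hy; rewrite /e2 mulr_ge0 ?exp_bump_ge0 // mulr_ge0 // ltW.
  have := hI; under eq_Rintegral do rewrite Dchi.
  rewrite (_ : (fun y => - e2 y) = fun y => -1 * e2 y); last by apply/funext => y; rewrite mulN1r.
  by rewrite RintegralZl ?mulN1r ?oppr_ge0 //; exact: bounded_support_integrable.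
pose U := H `&` [set y | 0 < q y].
have oU : open U.
  apply: openI.
    by apply: (@open_comp _ _ (fun y => c0 + dot N y) [set t | 0 < t]) => [y _|];
      [exact: affine_continuous|exact: open_gt].
  by apply: (@open_comp _ _ q [set t | 0 < t]) => [y _|];
    [exact: smooth_continuous|exact: open_gt].
have cl := affine_continuous al.
have ce : continuous e2.
  apply: smooth_continuous; apply: smoothM; first exact: smooth_exp_bump.
  by apply: smoothZ; exact: affine_smooth.
have eU := ae_open_eq0 ce oU _.
have {eU} : forall y, U y -> e2 y = 0.
  by apply: eU; apply: filterS e20 => y h [Hy _]; exact: h.
have NN := dot_gt0 N0.
(* [t] is small enough that [z + t N], a point of [H], has squared distance [t^2 |N|^2 < r] from
   [z]; there [e2] is positive, a contradiction. *)
pose t := Num.min 1 (r / (2 * dot N N)).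
have t0 : 0 < t by rewrite lt_min ltr01 divr_gt0 // mulr_gt0.
have sqd : sqdist z (z + t *: N) = t ^+ 2 * dot N N.
  rewrite /sqdist /dot mulr_sumr; apply: eq_bigr => i _; rewrite !mxE; ring.
have lt_ : c0 + dot N (z + t *: N) = t * dot N N by rewrite dotDr addrA lz add0r dotZr.
have qt : 0 < q (z + t *: N).
  have : t <= r / (2 * dot N N) by rewrite ge_min lexx orbT.
  rewrite ler_pdivlMr ?mulr_gt0 // => h.
  have t1 : t <= 1 by rewrite ge_min lexx.
  rewrite /q sqd subr_gt0.
  have : t ^+ 2 * dot N N <= t * dot N N by rewrite ler_wpM2r ?(ltW NN) // expr2 ler_piMl // ltW.
  move=> h'; apply: (le_lt_trans h'); apply: lt_le_trans h.
  by rewrite mulrCA ltr_pMl ?mulr_gt0 // ltr1n.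
move=> /(_ (z + t *: N)); rewrite /U /= /H /= /e2 lt_ => /(_ (conj (mulr_gt0 t0 NN) qt)) /eqP.
by rewrite gt_eqF // mulr_gt0 ?exp_bump_gt0 // mulr_gt0 // mulr_gt0.
Qed.

(** The relation [facing] persists under small displacements of [z] within the hyperplane, so the
    jump vanishes at [z] and at a point between [z] and [y]; being affine, it vanishes at [y]. *)
Lemma jump_hyperplane T1 T2 c0 N z phi : facing Om Th T1 T2 c0 N z -> alternating_form phi ->
  forall y, c0 + dot N y = 0 -> jump T1 T2 N phi y = 0.
Proof.
move=> fc aphi y ly; have [T1h T2h N0 lz [nz hx]] := fc.
have [r r0 hr] := near_sqdist (near_join nz).
have aJ := jump_affine N phi T1h T2h.
pose d := sqdist z y.
have d0 : 0 <= d by apply: sumr_ge0 => i _; exact: sqr_ge0.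
pose t := Num.min 1 (r / (d + 1)).
have t0 : 0 < t by rewrite lt_min ltr01 divr_gt0 // ltr_wpDl.
have t1 : t <= 1 by rewrite ge_min lexx.
have ft : facing Om Th T1 T2 c0 N (z + t *: (y - z)).
  split=> //.
    by rewrite (@affine_line _ _ (fun y => c0 + dot N y)) ?lz ?ly; [ring|exists c0, N].
  split=> //; apply: hr.
  rewrite (_ : sqdist _ _ = t ^+ 2 * d); last first.
    by rewrite /d /sqdist mulr_sumr; apply: eq_bigr => i _; rewrite !mxE; ring.
  have : t <= r / (d + 1) by rewrite ge_min lexx orbT.
  rewrite ler_pdivlMr ?ltr_wpDl // => h; apply: le_trans h.
  rewrite expr2 -mulrA ler_wpM2l ?(ltW t0) //.
  by apply: (@le_trans _ _ d); [rewrite ler_piMl|rewrite lerDl].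
have := jump_eq0 ft aphi; rewrite affine_line // (jump_eq0 fc aphi) subr0 add0r => /eqP.
by rewrite mulf_eq0 (gt_eqF t0) => /eqP.
Qed.

End jump.

(** * Piecewise affine forms without tangential jumps *)

Section piecewise_forms.
Variables (R : realType) (n : nat).
Local Notation vec := 'rV[R]_n.
Local Notation mu := (lebesgue_rV R n).
Local Notation contract phi i := (fun v => phi (vcons (delta_mx ord0 i) v)).

Lemma conv_hull_norm (T : {fset vec}) y : conv_hull T y -> `|y| <= \sum_(a <- T) `|a|.
Proof.
move=> [w [w0 w1 ->]]; apply: (le_trans (ler_norm_sum _ _ _)).
rewrite big_seq [leRHS]big_seq; apply: ler_sum => a aT.
rewrite normrZ ger0_norm ?w0 // ler_piMl // -w1 (bigD1_seq a) ?fset_uniq //=.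
by rewrite lerDl big_seq_cond sumr_ge0 // => b /andP[bT _]; exact: w0.
Qed.

Lemma conv_hull_compact (T : {fset vec}) : simplex n T -> compact (conv_hull T).
Proof.
move=> sT; apply: bounded_closed_compact; last exact: conv_hull_closed.
exists (\sum_(a <- T) `|a|); split; first exact: num_real.
by move=> M hM y /conv_hull_norm h; apply: ltW; exact: le_lt_trans hM.
Qed.

Lemma inner_bounded_support (T : {fset vec}) (f : vec -> R) : simplex n T -> continuous f ->
  bounded_support (fun y => \1_(inner T) y * f y).
Proof.
move=> sT cf; have [M hM] := continuous_compact_bounded cf (conv_hull_compact sT).
apply: bounded_supportZ.
- split; first by apply: measurable_indic; exact: inner_measurable.
  exists (Num.max 1 (\sum_(a <- T) `|a|)) => y; split.
    by rewrite le_max indicE; case: (_ \in _); rewrite ?normr1 ?normr0 ?lexx ?ler01.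
  rewrite gt_max => /andP[_ h]; rewrite indicE memNset // => /(inner_conv_hull sT)/conv_hull_norm.
  by rewrite leNgt h.
- exact: continuous_rV_measurable.
- exists M => y; rewrite indicE; have [/set_mem yT _|] := boolP (y \in inner T).
    by apply: hM; exact: inner_conv_hull.
  by rewrite eqxx.
Qed.

Variables (k : nat) (Om : set vec) (Th : {fset {fset vec}}).
Hypothesis n_gt0 : (0 < n)%N.
Hypothesis Om_open : open Om.
Hypothesis mesh : simplicial_mesh Om Th.

Let mOm : measurable Om := measurable_rV_open Om_open.
Let sTh T : T \in Th -> simplex n T. Proof. by case: mesh => h _ _; exact: h. Qed.

Definition pw_form j (p : {fset vec} -> diff_form R n j) : diff_form R n j :=
  fun y v => piecewise Th (fun T y => p T y v) y.

Lemma pw_form_inner j (p : {fset vec} -> diff_form R n j) T y : T \in Th -> inner T y ->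
  pw_form p y = p T y.
Proof. by move=> TTh Ty; apply/funext => v; rewrite /pw_form (piecewise_inner mesh _ TTh Ty). Qed.

Lemma pw_form_out j (p : {fset vec} -> diff_form R n j) y :
  (forall T, T \in Th -> ~ inner T y) -> pw_form p y = fun=> 0.
Proof. by move=> h; apply/funext => v; rewrite /pw_form piecewise_out. Qed.

Lemma pw_form_bounded j (p : {fset vec} -> diff_form R n j) v :
  (forall T, affine_form (p T)) -> bounded_support (fun y => pw_form p y v).
Proof.
move=> ap; rewrite /pw_form /piecewise.
rewrite (_ : (fun y => _) = fun y => \sum_(T <- Th | T \in Th) \1_(inner T) y * p T y v);
  last first.
  by apply/funext => y; rewrite big_seq.
apply: bounded_support_sum => T TTh; apply: inner_bounded_support; first exact: sTh.
by apply: affine_continuous; case: (ap T).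
Qed.

Lemma pw_form_L2 j (p : {fset vec} -> diff_form R n j) :
  (forall T, affine_form (p T)) -> L2_form Om (pw_form p).
Proof.
move=> ap; have [h1 h2] : L2_measurable Om (pw_form p).
  by apply: bounded_L2 => // v; exact: pw_form_bounded.
split=> // y _; apply: alternating_lin => T _; by case: (ap T).
Qed.

Lemma pw_form_ae j (p : {fset vec} -> diff_form R n j) T : T \in Th ->
  ae_eq_on (conv_hull T) (pw_form p) (p T).
Proof.
move=> TTh; apply: filterS (conv_hull_inner_ae (sTh TTh) n_gt0) => y h /h Ty.
exact: pw_form_inner.
Qed.

Variable p : {fset vec} -> diff_form R n k.
Hypothesis p_affine : forall T, affine_form (p T).
Hypothesis p_jump : forall T1 T2 c0 N z phi, facing Om Th T1 T2 c0 N z ->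
  alternating_form phi -> forall y, c0 + dot N y = 0 ->
  alt_ip (fun v => p T1 y v - p T2 y v) (fun v => phi (vcons N v)) = 0.

(** The weak derivative is taken element by element. On each element the field [X] has divergence
    [<W, phi> - <p, codiff phi>], so [piecewise_divergence] is the defining identity; [p_jump] makes
    [X] jump-free. *)
Lemma pw_form_H : H_form Om (pw_form p).
Proof.
split; first exact: pw_form_L2.
(* The coefficients are affine, so their derivatives are constant and may be read off at [0]. *)
pose dp T i v := 'D_(delta_mx ord0 i) (fun y => p T y v) 0.
have dpE T i v y : 'D_(delta_mx ord0 i) (fun y => p T y v) y = dp T i v.
  have [_ /(_ v)[c [N h]]] := p_affine T.
  by rewrite /dp !(affine_deriveE _ _ h).
have /choice[W hW] := fun T => @riesz R n k (dp T).
exists (pw_form (fun T _ => W T)); split.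
  apply: pw_form_L2 => T; split; first by move=> _; case: (hW T).
  by move=> v; exact: affine_cst.
move=> phi tphi; have [aphi sphi [K [cK KOm phiK]]] := tphi.
pose X T i y := alt_ip (p T y) (contract (phi y) i).
have sp T v : smooth (fun y => p T y v) by apply: affine_smooth; case: (p_affine T).
have sX T i : smooth (X T i).
  by apply: smooth_sum => s _; exact: smoothM.
have X0 T i y : ~ K y -> X T i y = 0.
  by move=> Ky; rewrite /X /alt_ip big1 // => s _; rewrite phiK // mulr0.
have aX : adm Om Th K X.
  split=> // T1 T2 c0 N z fc y ly.
  rewrite -[RHS](p_jump fc (aphi y) ly).
  rewrite [X in _ = alt_ip _ X](_ : _ = fun v => \sum_i N ord0 i * contract (phi y) i v);
    last first.
    by apply/funext => v; apply: vcons_sum; case: (aphi y).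
  by rewrite alt_ip_sumr; apply: eq_bigr => i _; rewrite alt_ipBl.
have divX T y : divergence (X T) y = alt_ip (W T) (phi y) - alt_ip (p T y) (codiff phi y).
  have [_ ->] := hW T; last exact: aphi.
  rewrite (_ : codiff phi y = fun v => \sum_i (-1) *
      'D_(delta_mx ord0 i) (fun y => phi y (vcons (delta_mx ord0 i) v)) y); last first.
    by apply/funext => v; rewrite /codiff -mulr_sumr mulN1r.
  rewrite alt_ip_sumr -sumrB; apply: eq_bigr => i _; rewrite mulN1r opprK /X /alt_ip.
  rewrite derive_bigsum; last by move=> s _; exact: smoothM.
  rewrite -big_split; apply: eq_bigr => s _.
  by rewrite derive_mul // dpE addrC mulrC.
have := piecewise_divergence n_gt0 Om_open mesh cK KOm aX.
have E y : div_pw Th X y = alt_ip (pw_form (fun T _ => W T) y) (phi y) -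
    alt_ip (pw_form p y) (codiff phi y).
  have [[T TTh Ty]|h] := pselect (exists2 T, T \in Th & inner T y).
    by rewrite /div_pw (piecewise_inner mesh _ TTh Ty) !(pw_form_inner _ TTh Ty).
  have {}h T : T \in Th -> ~ inner T y by move=> h1 h2; apply: h; exists T.
  rewrite /div_pw piecewise_out // !pw_form_out // /alt_ip !big1 ?subr0 // => s _;
    by rewrite mul0r.
rewrite -(@Rintegral_sub _ _ Om) //; last first.
  move=> y Omy; rewrite /div_pw piecewise_eq0 // => T _.
  apply: (divergence_eq0 (compact_closed_rV cK)) => [i w|/KOm //]; exact: X0.
under eq_Rintegral do rewrite E.
rewrite RintegralB //.
- by move=> /eqP; rewrite subr_eq0 => /eqP.
- apply: L2_integrable => //; last exact: test_form_L2 tphi.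
  by apply: L2_form_measurable; apply: pw_form_L2 => T; split=> [_|v];
    [case: (hW T)|exact: affine_cst].
- apply: L2_integrable => //; last exact: codiff_L2 tphi.
  by apply: L2_form_measurable; exact: pw_form_L2.
Qed.

Lemma pw_form_P1 : P1_space Om Th (pw_form p).
Proof.
split; first exact: pw_form_H.
by move=> T TTh; exists (p T); split; [exact/poly_form1E|exact: pw_form_ae].
Qed.

End piecewise_forms.

(** * Locality *)

Section locality.
Variables (R : realType) (n : nat).
Local Notation vec := 'rV[R]_n.
Local Notation mu := (lebesgue_rV R n).

(** The [n] incidence conditions on the [n + 1] unknowns [(c, N)] have a nonzero solution; [N = 0]
    would force [c = 0], since [f] has a point. *)
Lemma face_hyperplane (f : {fset vec}) : (0 < n)%N -> #|` f| = n -> exists c N,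
  N != 0 /\ forall y, conv_hull f y -> c + dot N y = 0.
Proof.
move=> n0 fn.
pose B : 'M[R]_(1 + n, n) := col_mx (const_mx 1) (\matrix_(i, j) (nth 0 f j) ord0 i).
have : kermx B != 0.
  rewrite -mxrank_eq0 mxrank_ker -lt0n subn_gt0.
  by apply: (leq_ltn_trans (rank_leq_col B)); rewrite add1n.
case/rowV0Pn => w /sub_kermxP; rewrite -[w]hsubmxK.
move: (lsubmx w) (rsubmx w) => c1 N; rewrite mul_row_col => hw w0.
pose c := c1 ord0 ord0.
have hf a : a \in f -> c + dot N a = 0.
  move=> af; have ja : (index a f < n)%N by rewrite -[X in (_ < X)%N]fn index_mem.
  have /rowP/(_ (Ordinal ja)) := hw; rewrite !mxE big_ord1 !mxE mulr1 /c => h.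
  rewrite -[RHS]h /dot; congr (_ + _); apply: eq_bigr => i _; by rewrite mxE /= nth_index.
exists c, N; split.
  apply: contraNneq w0 => N0.
  have [a af] : exists a, a \in f by apply/fset0Pn; rewrite -cardfs_gt0 fn.
  have c0 : c = 0 by have := hf a af; rewrite N0 /dot big1 ?addr0 // => i _; rewrite mxE mul0r.
  apply/eqP; rewrite N0 (_ : c1 = 0) ?row_mx0 //.
  by apply/rowP => i; rewrite (ord1 i) mxE.
move=> y [w' [_ w1 ->]].
rewrite (@affine_comb _ _ f (fun y => c + dot N y)) //; last by exists c, N.
by rewrite big_seq big1 // => a af; rewrite hf // mulr0.
Qed.

Section cutoff.
Variables (I : eqType) (s : seq I) (g : I -> vec -> R).

(** Vanishes as soon as some [g i] is below [1 / (m + 1)], and is eventually [1] wherever all [g i]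
    are positive. *)
Definition cutoff (m : nat) y : R := \prod_(i <- s) step (m.+1%:R * g i y - 1).

Lemma cutoff_smooth m : (forall i, i \in s -> smooth (g i)) -> smooth (cutoff m).
Proof.
move=> sg; rewrite /cutoff.
rewrite (_ : (fun y => _) = fun y => \prod_(i <- s | i \in s) step (m.+1%:R * g i y - 1));
  last first.
  by apply/funext => y; rewrite big_seq.
apply: smooth_prod => i si; apply: smooth_step; apply: smoothB; last exact: smooth_cst.
by apply: smoothZ; exact: sg.
Qed.

Lemma cutoff_ge0 m y : 0 <= cutoff m y.
Proof. by apply: prodr_ge0 => i _; exact: step_ge0. Qed.

Lemma cutoff_le1 m y : cutoff m y <= 1.
Proof.
have /andP[] // : 0 <= cutoff m y <= 1; rewrite /cutoff.
elim/big_ind: _ => [|a b /andP[a0 a1] /andP[b0 b1]|i _]; first by rewrite ler01 lexx.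
  by rewrite mulr_ge0 //= mulr_ile1.
by rewrite step_ge0 step_le1.
Qed.

Lemma cutoff_eq0 m y i : i \in s -> m.+1%:R * g i y < 1 -> cutoff m y = 0.
Proof.
move=> si h; rewrite /cutoff; apply/eqP; rewrite prodf_seq_eq0; apply/hasP; exists i => //=.
by rewrite step0 // subr_le0 ltW.
Qed.

Lemma cutoff_cvg y : (forall i, i \in s -> 0 < g i y) -> cutoff m y @[m --> \oo] --> (1 : R).
Proof.
move=> g0; apply: cvg_near_cst.
have : \forall m \near \oo, forall i, i \in s -> cutoff m y = cutoff m y -> 2 <= m.+1%:R * g i y.
  apply: filter_all_seq => i si.
  have h : 0 < g i y / 2 by rewrite divr_gt0 // g0.
  apply: filterS (near_infty_natSinv_lt (PosNum h)) => m /= hm _.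
  by move: hm; rewrite ltr_pdivlMr // mulrC ltr_pdivrMr // mulrC => /ltW.
apply: filterS => m hm; rewrite /cutoff big_seq big1 // => i si.
by rewrite step1 // lerBrDr; exact: hm.
Qed.

End cutoff.

Lemma Rintegral_sum_integrable (I : Type) (s : seq I) (D : set vec) (f : I -> vec -> R) :
  measurable D -> (forall i, mu.-integrable D (EFin \o f i)) ->
  \int[mu]_(y in D) (\sum_(i <- s) f i y) = \sum_(i <- s) \int[mu]_(y in D) f i y.
Proof.
move=> mD fi; elim: s => [|i s IH].
  under eq_Rintegral do rewrite big_nil.
  by rewrite Rintegral_cst // mul0r big_nil.
rewrite big_cons -IH -RintegralD //.
  by apply: eq_Rintegral => y _; rewrite big_cons.
rewrite (_ : EFin \o _ = fun y => (\sum_(i <- s) (f i y)%:E)%E); last first.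
  by apply/funext => y; rewrite /= sumEFin.
by apply: integrable_sum => // k _; exact: fi.
Qed.

Variables (k : nat) (Om : set vec) (Th : {fset {fset vec}}).
Hypothesis n_gt0 : (0 < n)%N.
Hypothesis dom : polyhedral_domain Om.
Hypothesis mesh : simplicial_mesh Om Th.

Let Om_open : open Om. Proof. by case: dom. Qed.
Let mOm : measurable Om := measurable_rV_open Om_open.
Let sTh T : T \in Th -> simplex n T. Proof. by case: mesh => h _ _; exact: h. Qed.

Lemma inner_pairing_integrable j (p W : diff_form R n j) T : T \in Th -> affine_form p ->
  L2_form Om W -> mu.-integrable Om (EFin \o (fun y => \1_(inner T) y * alt_ip (p y) (W y))).
Proof.
move=> TTh ap LW.
rewrite (_ : (fun y => _) = fun y => alt_ip (fun v => \1_(inner T) y * p y v) (W y)); last first.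
  by apply/funext => y; rewrite alt_ipZl.
apply: (@L2_integrable _ _ _ _ (fun y v => \1_(inner T) y * p y v)) => //;
  last exact: L2_form_measurable.
apply: bounded_L2 => // v; apply: inner_bounded_support; first exact: sTh.
by apply: affine_continuous; case: ap.
Qed.

(* Test against [chi_m p], where the cutoffs [chi_m] exhaust the part of the
   element lying off the boundary faces of the domain. *)
Lemma ext_d_inner_eq0 (c : diff_form R n k) (W p : diff_form R n k.+1) T :
  T \in Th -> is_ext_d Om c W -> (forall y, inner T y -> c y = fun=> 0) ->
  affine_form p -> \int[mu]_(y in Om) (\1_(inner T) y * alt_ip (p y) (W y)) = 0.
Proof.
move=> TTh [LW cW] c0 [aap ap]; have sT := sTh TTh.
have [_ _ _ _ [F [sF bd]]] := dom; have [_ cov _] := mesh.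
have /choice[C hC] : forall f : {fset vec}, exists cN : R * vec, f \in F ->
    cN.2 != 0 /\ forall y, conv_hull f y -> cN.1 + dot cN.2 y = 0.
  move=> f; have [fF|] := boolP (f \in F); last by exists (0, 0).
  have [card_f _] := sF f fF; rewrite prednK // in card_f.
  by have [c' [N h]] := face_hyperplane n_gt0 card_f; exists (c', N).
(* The square of the equation of a boundary face is smooth, non-negative and zero exactly on its
   hyperplane, whichever side the element is on. *)
pose l f y := ((C f).1 + dot (C f).2 y) ^+ 2.
have [ba _ _ _ _] := baryP sT.
pose chi m y := cutoff T (bary T) m y * cutoff F l m y.
have schi m : smooth (chi m).
  apply: smoothM; apply: cutoff_smooth => i _; first exact: affine_smooth.
  by apply: smoothX; apply: affine_smooth; exists (C i).1, (C i).2.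
pose K m := [set y | (forall a, a \in T -> 1 <= m.+1%:R * bary T a y) /\
  (forall f, f \in F -> 1 <= m.+1%:R * l f y)].
have chi0 m y : ~ K m y -> chi m y = 0.
  move=> Ky; apply: contrapT => h; apply: Ky; split=> i si; rewrite leNgt; apply/negP => hi.
    by apply: h; rewrite /chi (cutoff_eq0 si hi) mul0r.
  by apply: h; rewrite /chi (cutoff_eq0 si hi) mulr0.
have KT m y : K m y -> inner T y.
  by move=> [h _] a aT; rewrite -(pmulr_rgt0 _ (ltr0Sn R m)); apply: lt_le_trans (h a aT).
(* The interior of an element may contain boundary points of the domain, namely on a slit. Such a
   point lies on a boundary face, and these are cut away by the second condition in [K m]. *)
have KOm m : K m `<=` Om.
  move=> y Ky; apply: contrapT => Omy.
  have : (closure Om `\` Om) y.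
    by split=> //; rewrite cov; exists T => //; apply: inner_conv_hull => //; exact: KT Ky.
  rewrite bd => -[f /= fF yf]; have [_ /(_ f fF)] := Ky.
  by have [_ /(_ y yf) E] := hC f fF; rewrite /l E expr0n mulr0 ler10.
have cK m : compact (K m).
  apply: (subclosed_compact _ (conv_hull_compact sT)); last first.
    by move=> y /KT; exact: inner_conv_hull.
  rewrite (_ : K m = \bigcap_(a in [set` T]) [set y | 1 <= m.+1%:R * bary T a y] `&`
     \bigcap_(f in [set` F]) [set y | 1 <= m.+1%:R * l f y]).
    apply: closedI; apply: closed_bigI => i _; apply: superlevel_closed;
      apply: smooth_continuous; apply: smoothZ; first exact: affine_smooth.
    by apply: smoothX; apply: affine_smooth; exists (C i).1, (C i).2.
  by [].
pose Phi m : diff_form R n k.+1 := fun y v => chi m y * p y v.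
have tPhi m : test_form Om (Phi m).
  split.
  - by move=> y; exact: alternatingZ.
  - by move=> v; apply: smoothM => //; exact: affine_smooth.
  - by exists (K m); split=> // y Ky v; rewrite /Phi chi0 // mul0r.
have int0 m : \int[mu]_(y in Om) (chi m y * alt_ip (p y) (W y)) = 0.
  rewrite (@eq_Rintegral _ _ _ mu _ (fun y => alt_ip (W y) (Phi m y))); last first.
    by move=> y _; rewrite [RHS]alt_ipC alt_ipZl.
  rewrite -[LHS]/(L2_ip Om W (Phi m)) -cW //.
  rewrite /L2_ip (@eq_Rintegral _ _ _ mu _ (fun=> 0)) ?Rintegral_cst ?mul0r // => y _.
  rewrite /alt_ip big1 // => s _; have [/KT/c0->|Ky] := pselect (K m y); first by rewrite mul0r.
  rewrite /codiff big1 ?oppr0 ?mulr0 // => i _.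
  rewrite (@derive_eq0 _ _ _ (K m)) //; first exact: compact_closed_rV.
  by move=> w Kw; rewrite /Phi chi0 // mul0r.
have iW := inner_pairing_integrable TTh (conj aap ap) LW.
have chiE m y : chi m y = chi m y * \1_(inner T) y.
  have [Ty|Ty] := pselect (inner T y); first by rewrite indicE mem_set // mulr1.
  by rewrite chi0 ?mul0r // => /KT.
have chi_le1 m y : `|chi m y| <= 1.
  rewrite ger0_norm ?mulr_ge0 ?cutoff_ge0 //.
  by rewrite mulr_ile1 ?cutoff_ge0 ?cutoff_le1.
have mW : measurable_fun Om (fun y => alt_ip (p y) (W y)).
  apply: measurable_alt_ip; last by case: LW.
  by move=> v; apply: measurable_funTS; apply: continuous_rV_measurable; exact: affine_continuous.
have := @Rintegral_cvg R n Om (fun m y => chi m y * alt_ip (p y) (W y))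
  (fun y => \1_(inner T) y * alt_ip (p y) (W y)) (fun y => `|\1_(inner T) y * alt_ip (p y)
    (W y)|) mOm.
move=> h; rewrite -(cvg_lim (@norm_hausdorff _ R) (h _ _ _ _ _)).
- by under eq_fun do rewrite int0; rewrite (cvg_lim (@norm_hausdorff _ R) (@cvg_cst _ _ _ _ _)).
- move=> m; apply: measurable_funM => //; apply: measurable_funTS.
  by apply: continuous_rV_measurable; exact: smooth_continuous.
- by have /integrableP[/measurable_EFinP] := iW.
- exact: integrable_norm iW.
- by move=> m y _; rewrite chiE -mulrA normrM ler_piMl.
have : {ae mu, forall y, forall f, f \in F -> l f y != 0}.
  apply: filter_all_seq => f fF; have [N0 _] := hC f fF.
  exists [set y | (C f).1 + dot (C f).2 y = 0]; split; [exact: hyperplane_measurable|exact: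
    hyperplane_null|].
  by move=> y /= /negP; rewrite negbK /l expf_eq0 /= => /eqP.
apply: filterS => y ly _; have [Ty|Ty] := pselect (inner T y); last first.
  rewrite indicE memNset // mul0r (_ : (fun m => _) = fun=> 0); first exact: cvg_cst.
  by apply/funext => m; rewrite chi0 ?mul0r // => /KT.
rewrite indicE mem_set //; apply: cvgM; last exact: cvg_cst.
rewrite -[X in _ --> X](mulr1 (1 : R)); apply: cvgM; apply: cutoff_cvg => // f fF.
by rewrite lt0r ly //= sqr_ge0.
Qed.

Lemma affine_formB j (p q : diff_form R n j) : affine_form p -> affine_form q ->
  affine_form (fun y v => p y v - q y v).
Proof.
move=> [pa pp] [qa qq]; split=> [y|v]; first exact: alternatingB.
by apply: affineD => //; under eq_fun do rewrite -mulN1r; exact: affineZ.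
Qed.

Lemma affine_form0 j : affine_form (fun (_ : vec) (_ : 'I_j -> vec) => 0 : R).
Proof. by split=> [_|v]; [exact: alternating0|exact: affine_cst]. Qed.

Lemma volume_gt0 T : T \in Th -> 0 < volume T.
Proof.
move=> TTh; have sT := sTh TTh; have [z Tz] := inner_nonempty sT.
have mT : measurable (conv_hull T).
  rewrite -[conv_hull T]setCK; apply: measurableC; apply: measurable_rV_open.
  by apply: closed_openC; exact: conv_hull_closed.
apply: fine_gt0; apply/andP; split.
  apply: (lt_le_trans (lebesgue_rV_open_gt0 (inner_open sT) Tz)).
  apply: le_measure; rewrite ?inE //; first exact: inner_measurable.
  by move=> y; exact: inner_conv_hull.
have [C hC] := lebesgue_rV_ballE (0 : vec) (\sum_(a <- T) `|a| + 1).
apply: (@le_lt_trans _ _ (mu (ball (0 : vec) (\sum_(a <- T) `|a| + 1)))); last by rewrite hC ltry.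
apply: le_measure; rewrite ?inE //; first exact: measurable_rV_ball.
by move=> y /conv_hull_norm h; apply/mem_rV_ball0; apply: (le_lt_trans h); rewrite ltrDl.
Qed.

Lemma P1_restriction j (u : diff_form R n j) T : P1_space Om Th u -> T \in Th ->
  affine_form (restriction u T) /\ ae_eq_on (conv_hull T) u (restriction u T).
Proof.
move=> [_ h] TTh; have [p [/poly_form1E ap up]] := h T TTh.
by rewrite (restrictionE (sTh TTh) ap up).
Qed.

(* Off the macroelement [u - v] is piecewise affine and [tau] vanishes. *)
Lemma macroelement_orthogonal x (u v : diff_form R n k.+1) (tau : diff_form R n k)
    (W : diff_form R n k.+1) :
  whitney_space Om Th u -> whitney_space Om Th v -> ae_eq_on (macroelement Th x) u v ->
  is_ext_d Om tau W ->
  (forall T y, T \in Th -> x \notin T -> inner T y -> tau y = fun=> 0) ->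
  L2_ip Om u W = L2_ip Om v W.
Proof.
move=> [[Lu _] pu] [[Lv _] pv] uv tW tau0; have LW := tW.1.
have [/L2_form_measurable LMu /L2_form_measurable LMv] := (Lu, Lv).
have LMW := L2_form_measurable LW.
apply/eqP; rewrite -subr_eq0; apply/eqP.
rewrite /L2_ip -RintegralB //; [|exact: L2_integrable..].
(* [q T] is the affine form representing [u - v] on [T], chosen to be [0] on the elements of the
   macroelement. *)
have /choice[q hq] : forall T, exists q : diff_form R n k.+1, [/\ affine_form q,
    T \in Th -> ae_eq_on (conv_hull T) (fun y w => u y w - v y w) q &
    x \in T -> q = fun _ _ => 0].
  move=> T; have [xT|xT] := boolP (x \in T).
    exists (fun _ _ => 0); split=> // [|TTh]; first exact: affine_form0.
    apply: filterS uv => y h Ty; rewrite h; last by exists T.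
    by apply/funext => w; rewrite subrr.
  have [TTh|TTh] := boolP (T \in Th); last by exists (fun _ _ => 0); split=> //;
    exact: affine_form0.
  have [p1 [/whitney_affine ap1 up]] := pu T TTh; have [p2 [/whitney_affine ap2 vp]] := pv T TTh.
  exists (fun y w => p1 y w - p2 y w); split=> //; first exact: affine_formB.
  by move=> _; apply: filterS (filterI up vp) => y [h1 h2] Ty; rewrite h1 // h2.
have hcov : {ae mu, forall y, forall T, T \in Th -> conv_hull T y ->
    inner T y /\ (fun w => u y w - v y w) = q T y}.
  apply: filter_all_seq => T TTh; have [_ /(_ TTh) h _] := hq T.
  apply: filterS (filterI h (conv_hull_inner_ae (sTh TTh) n_gt0)) => y [h1 h2] Ty.
  by split; [exact: h2|exact: h1].
have [_ cov _] := mesh.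
pose f T y := \1_(inner T) y * alt_ip (q T y) (W y).
have fi T : T \in Th -> mu.-integrable Om (EFin \o f T).
  by move=> TTh; apply: inner_pairing_integrable => //; case: (hq T).
(* The factor [(T \in Th)%:R] is [1] on every index that occurs; it makes the summand integrable for
   all [T], as [Rintegral_sum_integrable] asks. *)
transitivity (\int[mu]_(y in Om) (\sum_(T <- Th) (T \in Th)%:R * f T y)); last first.
  rewrite Rintegral_sum_integrable //.
    rewrite big_seq big1 // => T TTh; rewrite TTh.
    under eq_Rintegral do rewrite mul1r.
    have [aq _ q0] := hq T; have [/q0 E|xT] := boolP (x \in T).
      under eq_Rintegral do rewrite /f E.
      rewrite (@eq_Rintegral _ _ _ mu _ (fun=> 0)) ?Rintegral_cst ?mul0r // => y _.
      by rewrite /alt_ip big1 ?mulr0 // => s _; rewrite mul0r.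
    by apply: (ext_d_inner_eq0 TTh tW _ aq) => y; exact: tau0.
  move=> T; case: (boolP (T \in Th)) => [TTh|_].
    by under eq_fun do rewrite mul1r; exact: fi.
  by under eq_fun do rewrite mul0r; exact: integrable0.
apply: Rintegral_ae => //.
- apply: measurable_funB; apply: measurable_alt_ip; first by case: LMu.
  + by case: LMW.
  + by case: LMv.
  + by case: LMW.
- rewrite (_ : (fun y => _) = fun y => \sum_(T <- Th | T \in Th) f T y); last first.
    apply/funext => y; rewrite big_seq [RHS]big_seq_cond; under [RHS]eq_bigl do rewrite andbb.
    by apply: eq_bigr => T ->; rewrite mul1r.
  elim: (enum_fset Th) => [|T r IH]; first by under eq_fun do rewrite big_nil;
    exact: measurable_cst.
  under eq_fun do rewrite big_cons.
  case: (boolP (T \in Th)) => // TTh; apply: measurable_funD => //.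
  by have /integrableP[/measurable_EFinP] := fi T TTh.
apply: filterS hcov => y h Omy.
have : closure Om y by exact: subset_closure.
rewrite cov => -[T /= TTh Ty]; have [iT E] := h T TTh Ty.
rewrite -alt_ipBl E (bigD1_seq T) ?fset_uniq //= TTh mul1r /f indicE mem_set // mul1r.
rewrite big_seq_cond big1 ?addr0 // => S /andP[STh ST].
rewrite indicE memNset ?mul0r ?mulr0 // => Sy.
by rewrite (mesh_disjoint mesh STh TTh Sy iT) eqxx in ST.
Qed.

Lemma P1_jump (c : diff_form R n k) T1 T2 c0 N z phi y : P1_space Om Th c ->
  facing Om Th T1 T2 c0 N z -> alternating_form phi -> c0 + dot N y = 0 ->
  alt_ip (fun v => restriction c T1 y v - restriction c T2 y v) (fun v => phi (vcons N v)) = 0.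
Proof.
move=> cP1 fc aphi ly; have [[Lc [W cW]] _] := cP1.
have := @jump_hyperplane R n k Om Th c W (restriction c) Om_open sTh Lc cW
  (fun T TTh => P1_restriction cP1 TTh) T1 T2 c0 N z phi fc aphi y ly.
by rewrite jumpE; case: aphi.
Qed.

End locality.

Theorem theorem4p2 (R : realType) (n k : nat) (kn : (k < n)%N)
    (Om : set 'rV[R]_n) (Th : {fset {fset 'rV[R]_n}})
    (dom : polyhedral_domain Om) (mesh : simplicial_mesh Om Th)
    (dh : diff_form R n k.+1 -> diff_form R n k)
    (dhP : is_discrete_coderivative Om Th dh)
    (x : 'rV[R]_n) (u v : diff_form R n k.+1)
    (uW : whitney_space Om Th u) (vW : whitney_space Om Th v)
    (uv : ae_eq_on (macroelement Th x) u v) :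
  forall T : {fset 'rV[R]_n}, T \in Th -> x \in T ->
    restriction (dh u) T x = restriction (dh v) T x.
Proof.
have n0 : (0 < n)%N := leq_ltn_trans (leq0n k) kn.
have oOm : open Om by case: dom.
have sTh T : T \in Th -> simplex n T by case: mesh => h _ _; exact: h.
have [uP uI] := dhP u uW; have [vP vI] := dhP v vW.
pose sigma T w := restriction (dh u) T x w - restriction (dh v) T x w.
have asigma T : T \in Th -> alternating_form (sigma T).
  move=> TTh; have [[au _] _] := P1_restriction mesh uP TTh.
  have [[av _] _] := P1_restriction mesh vP TTh; exact: alternatingB.
(* The value [0] outside the mesh makes [p T] affine for every [T], as [pw_form_P1] asks. *)
pose p T : diff_form R n k := fun y w => if T \in Th then bary T x y * sigma T w else 0.
have pE T y : T \in Th -> p T y = fun w => bary T x y * sigma T w.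
  by move=> TTh; apply/funext => w; rewrite /p TTh.
have ap T : affine_form (p T).
  have [TTh|TTh] := boolP (T \in Th); last first.
    rewrite (_ : p T = fun _ _ => 0); first exact: affine_form0.
    by apply/funext => y; apply/funext => w; rewrite /p (negPf TTh).
  split=> [y|w]; first by rewrite pE //; apply: alternatingZ; exact: asigma.
  have [/(_ x) ab _ _ _ _] := baryP (sTh T TTh).
  by under eq_fun do rewrite pE // mulrC; exact: affineZ.
have jp T1 T2 c0 N z phi : facing Om Th T1 T2 c0 N z -> alternating_form phi ->
    forall y, c0 + dot N y = 0 ->
    alt_ip (fun w => p T1 y w - p T2 y w) (fun w => phi (vcons N w)) = 0.
  move=> fc aphi y ly; have [T1h T2h _ _ [_ /(_ x)[h12 h]]] := fc.
  rewrite !pE // -h12 //.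
  (* Either [x] is a common vertex on the hyperplane, and the jumps of both coderivatives vanish at
     [x] itself, or the nodal function of [x] vanishes on the hyperplane. *)
  case: h => [[_ _ lx]|->//]; last by rewrite /alt_ip big1 // => s _; rewrite !mul0r subrr mul0r.
  rewrite (_ : (fun w => _) = fun w => bary T1 x y *
     ((restriction (dh u) T1 x w - restriction (dh u) T2 x w) -
      (restriction (dh v) T1 x w - restriction (dh v) T2 x w))); last first.
    by apply/funext => w; rewrite /sigma; ring.
  rewrite alt_ipZl alt_ipBl (P1_jump dom mesh uP fc aphi lx).
  by rewrite (P1_jump dom mesh vP fc aphi lx) subrr mulr0.
have tP := pw_form_P1 n0 oOm mesh ap jp.
set tau := pw_form Th p in tP.
(* [ext_d] is a chosen representative; membership of [tau] in [H Lambda] guarantees that the choice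
   is a genuine weak derivative and not the default [0]. *)
have tW : is_ext_d Om tau (ext_d Om tau) by apply: xgetPex; case: tP => -[].
have tau0 T y : T \in Th -> x \notin T -> inner T y -> tau y = fun=> 0.
  move=> TTh xT Ty; rewrite /tau (pw_form_inner mesh p TTh Ty) pE //.
  have [_ _ _ _ b0] := baryP (sTh T TTh).
  by apply/funext => w; rewrite b0 // mul0r.
have rtau T : T \in Th -> restriction tau T = p T.
  by move=> TTh; apply: restrictionE => //; [exact: sTh|exact: (pw_form_ae n0 mesh)].
(* At a vertex [a] of [T] the form [tau] is [sigma T] if [a = x] and [0] otherwise, so the vertex
   sum collapses to one squared norm. *)
have term T : T \in Th -> \sum_(a <- T) (alt_ip (restriction (dh u) T a) (restriction tau T a) -
    alt_ip (restriction (dh v) T a) (restriction tau T a)) = (x \in T)%:R * alt_ip (sigma T)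
      (sigma T).
  move=> TTh; have [_ bd _ _ b0] := baryP (sTh T TTh).
  have E a : alt_ip (restriction (dh u) T a) (restriction tau T a) -
    alt_ip (restriction (dh v) T a) (restriction tau T a) = bary T x a *
     alt_ip (sigma T) (fun w => restriction (dh u) T a w - restriction (dh v) T a w).
    by rewrite rtau // pE // -alt_ipBl alt_ipC alt_ipZl.
  under eq_bigr do rewrite E.
  have [xT|xT] := boolP (x \in T); last first.
    by rewrite mul0r big1 // => a _; rewrite b0 // mul0r.
  rewrite (bigD1_seq x) ?fset_uniq //= bd // eqxx mul1r.
  rewrite big_seq_cond big1 ?addr0 ?mul1r // => a /andP[aT ax].
  by rewrite bd // eq_sym (negPf ax) mul0r.
have sum0 : \sum_(T <- Th) volume T / n.+1%:R * ((x \in T)%:R * alt_ip (sigma T) (sigma T)) = 0.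
  have : ip_h Th (dh u) tau - ip_h Th (dh v) tau = 0.
    rewrite uI // vI //; apply/eqP; rewrite subr_eq0; apply/eqP.
    apply: (macroelement_orthogonal n0 dom mesh uW vW uv tW).
    by move=> S y STh xS Sy; exact: tau0 STh xS Sy.
  rewrite /ip_h -sumrB => h; rewrite -[RHS]h big_seq [RHS]big_seq; apply: eq_bigr => T TTh.
  by rewrite -mulrBr -sumrB term.
move=> T TTh xT.
have vpos S : S \in Th -> 0 < volume S / n.+1%:R.
  by move=> STh; rewrite divr_gt0 ?ltr0Sn // (volume_gt0 mesh).
have : volume T / n.+1%:R * ((x \in T)%:R * alt_ip (sigma T) (sigma T)) = 0.
  move: sum0 => /eqP; rewrite big_seq psumr_eq0; last first.
    by move=> S STh; rewrite mulr_ge0 ?(ltW (vpos S STh)) // mulr_ge0 // alt_ip_ge0.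
  by move=> /allP/(_ T TTh); rewrite TTh => /eqP.
rewrite xT mul1r => /eqP; rewrite mulf_eq0 (gt_eqF (vpos T TTh)) => /eqP h.
apply/funext => w; apply/eqP; rewrite -subr_eq0; apply/eqP.
exact: (alt_ip_eq0 (asigma T TTh) h).
Qed.
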